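(* Let $m$, $n$, $e$, $X$ and $\omega(x;z)$ be as in the context, and assume $e\le1$ if $m$ is odd. Then for every $x\in X$, as rational functions of $q^{z_1},\dots,q^{z_n}$, $$\omega(x;z)=q^{2ez_n}\,\gamma_m(z_n)\,\omega(x;\tau(z)),\qquad \gamma_m(z_n)=\begin{cases}1&m=2n,\\[1mm] \dfrac{1-q^{-1+2z_n}}{q^{2z_n}-q^{-1}}&m=2n+1,\end{cases}$$ where $\tau(z)=(z_1,\dots,z_{n-1},-z_n)$.
   Context: Let $k$ be a finite extension of $\mathbb{Q}_p$ with ring of integers $\mathcal{O}_k$, prime element $\pi$, residue field of cardinality $q$, valuation $v_\pi$ and absolute value $|\cdot|$ with $|\pi|=q^{-1}$; put $e=v_\pi(2)$. Let $k'$ be the unramified quadratic extension with ring of integers $\mathcal{O}_{k'}$, $N=N_{k'/k}$, and $a^*$ the conjugate transpose of a matrix over $k'$. Let $m\ge2$, $n=\lfloor m/2\rfloor$, $j_m$ the $m\times m$ anti-diagonal matrix with entries $1$, $G=\{g\in GL_m(k'):g^*j_mg=j_m\}$, $X=\{x\in G:x^*=x,\ \det(t1_m-xj_m)=\det(t1_m-j_m)\}$ with action $g\cdot x=gxg^*$, $K=G\cap M_m(\mathcal{O}_{k'})$ with Haar measure $dk$ of total mass $1$. For $y\in X$ and $1\le i\le n$ let $d_i(y)$ be the determinant of the lower right $i\times i$ block of $y$. For $x\in X$ and $s\in\mathbb{C}^n$ let $\omega(x;s)=\int_K\prod_{i=1}^n|d_i(k\cdot x)|^{s_i}\,dk$ (integrand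 $0$ if some $d_i(k\cdot x)=0$); it converges for $\mathrm{Re}(s_i)\ge0$ and continues to a rational function of $q^{s_1},\dots,q^{s_n}$. Write $\omega(x;z)=\omega(x;s)$ under the change of variables $s_i=-z_i+z_{i+1}-1+\frac{\pi\sqrt{-1}}{\log q}$ ($1\le i\le n-1$), and $s_n=-z_n-\frac12$ if $m=2n$, $s_n=-z_n-1+\frac{\pi\sqrt{-1}}{2\log q}$ if $m=2n+1$ (here $\pi$ in exponents means $3.14\ldots$). *)

(* Defs.v *)
From HB Require Import structures.
From mathcomp Require Import all_boot all_order all_algebra all_field.
From mathcomp Require Import complex.
From mathcomp Require Import all_classical all_reals all_analysis.
(* Notations not imported: they clash with those of mathcomp-analysis. *)
From mathcomp Require mpoly.
Import (canonicals) mpoly.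

Set Implicit Arguments.
Unset Strict Implicit.
Unset Printing Implicit Defensive.

Import Order.TTheory GRing.Theory Num.Theory.

Local Open Scope classical_set_scope.
Local Open Scope ring_scope.

(** * Valued fields *)

(* An additive valuation is a function [v : F -> int] whose value at [0] is
   irrelevant; [vge v N x] reads "v(x) >= N" with the convention v(0) = +oo. *)
Definition vge (F : fieldType) (v : F -> int) (N : int) (x : F) : bool :=
  (x == 0) || (N <= v x).

Record normalized_valuation (F : fieldType) (v : F -> int) : Prop := {
  valM : forall x y, x != 0 -> y != 0 -> v (x * y) = v x + v y ;
  valD : forall N x y, vge v N x -> vge v N y -> vge v N (x + y) ;
  val_uniformizer : exists2 t : F, t != 0 & v t = 1 }.

(* (Q, v) is the field of p-adic numbers: the completion of the field of
   rational numbers for the p-adic valuation. *)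
Record is_padic_field (p : nat) (Q : fieldType) (v : Q -> int) : Prop := {
  padic_prime : prime p ;
  padic_valuation : normalized_valuation v ;
  padic_nat : forall n : nat, (0 < n)%N ->
    (n%:R : Q) != 0 /\ v n%:R = (logn p n)%:Z ;
  padic_dense : forall (x : Q) (N : int), exists r : rat, vge v N (x - ratr r) ;
  padic_complete : forall u : nat -> Q,
    (forall N : int, exists n0 : nat, forall i j : nat,
       (n0 <= i)%N -> (n0 <= j)%N -> vge v N (u i - u j)) ->
    exists l : Q, forall N : int, exists n0 : nat, forall i : nat,
      (n0 <= i)%N -> vge v N (u i - l) }.

(* [w] restricts to [c] times [v] on the base field; when both are normalized
   valuations, [c] is the ramification index. *)
Definition extends_valuation (F : fieldType) (L : fieldExtType F) (c : int)
    (v : F -> int) (w : L -> int) : Prop :=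
  forall a : F, a != 0 -> w (a%:A) = c * v a.

(* Residue classes x + m of the elements x of the valuation ring, m being the
   maximal ideal: the elements of the residue field. *)
Definition residue_field (F : fieldType) (v : F -> int) : set (set F) :=
  [set [set y | vge v 1 (y - x)] | x in [set x | vge v 0 x]].

(* The absolute value for which elements of valuation 1 have absolute value
   q^-1.  On k' (unramified over k) it is the one extending that of k, so [q]
   is always the cardinality of the residue field of k. *)
Definition vabs (R : realType) (q : nat) (F : fieldType) (v : F -> int)
  (x : F) : R := if x == 0 then 0 else (q%:R : R) ^ (- v x).

(** * Hermitian matrices *)

Definition antidiag (F : fieldType) (m : nat) : 'M[F]_m :=
  \matrix_(i, j) ((i : nat) + j == m.-1)%N%:R.

Section Hermitian.
Context (L : fieldType) (conj : L -> L) (m : nat).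

Definition conjtr (a : 'M[L]_m) : 'M[L]_m := (map_mx conj a)^T.

Definition unitaryG : set 'M[L]_m :=
  [set g | g \in unitmx /\ conjtr g *m antidiag L m *m g = antidiag L m].

Definition hermX : set 'M[L]_m :=
  [set x | [/\ unitaryG x, conjtr x = x
             & char_poly (x *m antidiag L m) = char_poly (antidiag L m)]].

Definition herm_act (g x : 'M[L]_m) : 'M[L]_m := g *m x *m conjtr g.

Definition integralK (v : L -> int) : set 'M[L]_m :=
  [set g | unitaryG g /\ forall i j, vge v 0 (g i j)].

End Hermitian.

(* Determinant of the lower right i x i block. *)
Definition lower_right_minor (L : fieldType) (m i : nat) (hi : (i <= m)%N)
    (y : 'M[L]_m) : L :=
  \det (drsubmx (castmx (esym (subnK hi), esym (subnK hi)) y)).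

Lemma half_index_le (m : nat) (i : 'I_(m./2)) : (i.+1 <= m)%N.
Proof.
apply: leq_trans (ltn_ord i) _.
by rewrite -{2}(odd_double_half m) -addnn addnA leq_addl.
Qed.

(* Indices are shifted: [dmin i] is d_{i+1}, for i = 0, ..., n-1. *)
Definition dmin (L : fieldType) (m : nat) (i : 'I_(m./2)) (y : 'M[L]_m) : L :=
  lower_right_minor (half_index_le i) y.

(** * Haar measure on K *)

(* Alias of the matrix type, to carry the pointed structure required by
   [measurableType]. *)
Definition mx_space (F : fieldType) (m : nat) : Type := 'M[F]_m.

HB.instance Definition _ (F : fieldType) (m : nat) :=
  Choice.on (mx_space F m).
HB.instance Definition _ (F : fieldType) (m : nat) :=
  isPointed.Build (mx_space F m) (0 : 'M[F]_m).

Definition mx_open (F : fieldType) (v : F -> int) (m : nat) :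
    set (set (mx_space F m)) :=
  [set U | forall x : 'M[F]_m, U x -> exists N : int, forall y : 'M[F]_m,
     (forall i j, vge v N (y i j - x i j)) -> U y].

Definition borel_mx (F : fieldType) (v : F -> int) (m : nat) :=
  g_sigma_algebraType (@mx_open F v m).

(* The Haar measure of total mass 1 of a closed subgroup K of GL_m, seen as a
   Borel measure on the space of matrices; only its values on Borel subsets of
   K are constrained, and only those matter for integrals over K. *)
Definition is_haar (R : realType) (F : fieldType) (v : F -> int) (m : nat)
    (K : set 'M[F]_m) (mu : {measure set (borel_mx v m) -> \bar R}) : Prop :=
  mu K = 1%E /\
  forall (g : 'M[F]_m) (A : set (borel_mx v m)),
    K g -> measurable A -> A `<=` K ->
    mu [set g *m (a : 'M[F]_m) | a in A] = mu A.

(** * The spherical function *)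

(* a ^ s = exp (s log a), for a > 0 and s complex. *)
Definition cpow (R : realType) (a : R) (s : R[i]) : R[i] :=
  (expR (complex.Re s * ln a))%:C%C *
  (cos (complex.Im s * ln a) +i* sin (complex.Im s * ln a))%C.

Definition qpow (R : realType) (q : nat) (s : R[i]) : R[i] :=
  cpow (q%:R : R) s.

Definition omega_integrand (R : realType) (q : nat) (L : fieldType)
    (v : L -> int) (m : nat) (s : 'I_(m./2) -> R[i]) (y : 'M[L]_m) : R[i] :=
  if [exists i, dmin i y == 0] then 0
  else \prod_i cpow (vabs R q v (dmin i y)) (s i).

Definition omega (R : realType) (q : nat) (L : fieldType) (conj : L -> L)
    (v : L -> int) (m : nat) (mu : {measure set (borel_mx v m) -> \bar R})
    (x : 'M[L]_m) (s : 'I_(m./2) -> R[i]) : R[i] :=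
  let f (g : 'M[L]_m) := omega_integrand q v s (herm_act conj g x) in
  ((\int[mu]_(g in integralK conj v) complex.Re (f g)) +i*
   (\int[mu]_(g in integralK conj v) complex.Im (f g)))%C.

(** * Rational functions of q^(s_1), ..., q^(s_n) *)

Record ratfun (R : realType) (n : nat) := RatFun {
  rf_num : mpoly.mpoly n R[i] ;
  rf_den : mpoly.mpoly n R[i] ;
  rf_den_neq0 : rf_den != 0 }.

Section RationalFunctions.
Context (R : realType) (q n : nat).
Implicit Types (W : ratfun R n) (s : 'I_n -> R[i]).

Definition num_at W s : R[i] := mpoly.meval (fun i => qpow q (s i)) (rf_num W).
Definition den_at W s : R[i] := mpoly.meval (fun i => qpow q (s i)) (rf_den W).

(* The rational function W(q^s1, ..., q^sn) continues [f], given on the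
   domain where all Re s_i >= 0.  This determines num / den. *)
Definition continues (f : ('I_n -> R[i]) -> R[i]) W : Prop :=
  forall s, (forall i, 0 <= complex.Re (s i)) ->
    den_at W s * f s = num_at W s.

End RationalFunctions.

(** * The variables z *)

Lemma last_index_lt (m : nat) (hm : (2 <= m)%N) : (m./2.-1 < m./2)%N.
Proof. by case: m hm => [|[|m]]. Qed.

Definition last_index (m : nat) (hm : (2 <= m)%N) : 'I_(m./2) :=
  Ordinal (last_index_lt hm).

(* [insub i.+1] is the next index when there is one, and [None] for the last
   index. *)
Definition s_of_z (R : realType) (q m : nat) (z : 'I_(m./2) -> R[i])
    (i : 'I_(m./2)) : R[i] :=
  if (insub i.+1 : option 'I_(m./2)) is Some j
  then - z i + z j - 1 + (0 +i* (pi / ln q%:R))%C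
  else if odd m then - z i - 1 + (0 +i* (pi / (2 * ln q%:R)))%C
  else - z i - 2^-1.

Definition tau (R : realType) (m : nat) (hm : (2 <= m)%N)
    (z : 'I_(m./2) -> R[i]) (i : 'I_(m./2)) : R[i] :=
  if i == last_index hm then - z i else z i.

(* W in the variables z. *)
Definition rfz (R : realType) (q m : nat) (W : ratfun R m./2)
    (z : 'I_(m./2) -> R[i]) : R[i] :=
  num_at q W (s_of_z q z) / den_at q W (s_of_z q z).

Definition rfz_defined (R : realType) (q m : nat) (W : ratfun R m./2)
    (z : 'I_(m./2) -> R[i]) : Prop :=
  den_at q W (s_of_z q z) != 0.

Definition gamma_num (R : realType) (q m : nat) (t : R[i]) : R[i] :=
  if odd m then 1 - qpow q (- 1 + 2 * t) else 1.

Definition gamma_den (R : realType) (q m : nat) (t : R[i]) : R[i] :=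
  if odd m then qpow q (2 * t) - (q%:R)^-1 else 1.

Definition gamma (R : realType) (q m : nat) (t : R[i]) : R[i] :=
  gamma_num q m t / gamma_den q m t.

(* Main.v *)
(* Idea.  Write x = j - 2 W C W^* with W of rank n (the eigenspace of x j for -1) and let Y = gW.
   The minors d_1, ..., d_(n-1) of g.x only involve the last n-1 rows of Y; the vector orthogonal
   to these rows is mapped by Y to a vector with at most three nonzero entries (a, c, b), with
   c = 0 when m is even, and d_n is a constant times N(b) while d_(n-1) is a constant times the
   hermitian norm a b* + a* b + N(c).  The elements of K acting on the middle coordinates fix
   d_1, ..., d_(n-1) and move (a, c, b); counting residues shows that, once d_1, ..., d_(n-1) and
   the content of (a, c, b) are fixed, the distribution of v(b) only depends on the valuation l of
   the norm of the primitive vector.  Summing a geometric series turns the integral of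
   |d_n|^(s_n) into an expression A(w) + B(w) w^l with w = q^(2 z_n), for which the functional
   equation holds pointwise in g because A(1/w) and B(1/w) are proportional to B(w) and A(w).
   The resulting integral converges beyond Re s_n >= 0 when the other Re s_i are large, so that
   it continues omega to both sides of the reflection; Laurent polynomials in q^(s_i) that agree
   on infinite sets in each variable are equal, which gives the identity everywhere. *)

Require Import Defs.
From HB Require Import structures.
From mathcomp Require Import all_boot all_order all_algebra all_field.
From mathcomp Require Import complex.
From mathcomp Require Import all_classical all_reals all_analysis.
From mathcomp Require mpoly.
From mathcomp Require Import measurable_realfun perm zify ring lra.
Import (canonicals) mpoly.

Set Implicit Arguments.
Unset Strict Implicit.
Unset Printing Implicit Defensive.

Import Order.TTheory GRing.Theory Num.Theory.
Import numFieldNormedType.Exports.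

Local Open Scope classical_set_scope.
Local Open Scope ring_scope.

(** * Valuations *)

(** Residue characteristic two is allowed, so no integral element may be divided by 2: an element
    [kap] of trace 1 replaces 1/2, and a skew unit [eps] completes it to an integral basis of k'
    over k. The factor q^(2 e z_n) also comes from 2: d_n and d_(n-1) carry the constants (-2)^n det
    C and (-2)^(n-1) det C, whose valuations differ by e, and the reflection turns this shift into
    w^e. The obstacle is that [W] is tied to an integral only where all X_i = q^(-s_i) have absolute
    value at most 1, while the reflection sends X_n to P / X_n with P = q or P = - q^2, which leaves
    this range. The remedy uses real X_i only: once the last minor is integrated out, the integral
    is, up to polynomial factors and a power of X_n, given by power series with Cauchy bounds of
    radius |P| + 1, so relations with Laurent polynomials known for 0 < X_n < 1 persist up to that
    radius. For odd m the constant P is negative and so are reflected coordinates: the one of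
    s_(n-1) is reached by an imaginary part of s_(n-1), the one of s_n by the power series, which
    cover both signs. *)

Section Valuation.
Variables (F : fieldType) (v : F -> int) (hv : normalized_valuation v).

Lemma vge0 N : vge v N 0. Proof. by rewrite /vge eqxx. Qed.

Lemma vgeE N x : x != 0 -> vge v N x = (N <= v x).
Proof. by rewrite /vge => /negPf ->. Qed.

Lemma vge_val x : vge v (v x) x. Proof. by rewrite /vge lexx orbT. Qed.

Lemma vge_le M N x : M <= N -> vge v N x -> vge v M x.
Proof. by rewrite /vge => MN /orP[->//|Nx]; rewrite (le_trans MN Nx) orbT. Qed.

Lemma val1 : v 1 = 0.
Proof. by apply: (addrI (v 1)); rewrite -(Defs.valM hv) ?oner_neq0// mulr1 addr0. Qed.

Lemma vge1 : vge v 0 1. Proof. by rewrite vgeE ?oner_neq0// val1. Qed.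

Lemma valN1 : v (-1) = 0.
Proof.
have n1 : (-1 : F) != 0 by rewrite oppr_eq0 oner_neq0.
by have := Defs.valM hv n1 n1; rewrite mulN1r opprK val1; lia.
Qed.

Lemma valN x : v (- x) = v x.
Proof.
have [->|x0] := eqVneq x 0; first by rewrite oppr0.
by rewrite -mulN1r (Defs.valM hv) ?valN1 ?add0r// oppr_eq0 oner_neq0.
Qed.

Lemma vgeN N x : vge v N (- x) = vge v N x.
Proof. by rewrite /vge oppr_eq0 valN. Qed.

Lemma vgeD N x y : vge v N x -> vge v N y -> vge v N (x + y).
Proof. exact: Defs.valD. Qed.

Lemma vgeB N x y : vge v N x -> vge v N y -> vge v N (x - y).
Proof. by move=> hx hy; apply: vgeD; rewrite ?vgeN. Qed.

Lemma vgeBC N x y : vge v N (x - y) = vge v N (y - x).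
Proof. by rewrite -vgeN opprB. Qed.

Lemma vgeDl N x y : vge v N y -> vge v N (x + y) = vge v N x.
Proof.
move=> hy; apply/idP/idP => [hxy|hx]; last exact: vgeD.
by rewrite -(addrK y x) vgeB.
Qed.

Lemma vgeDr N x y : vge v N x -> vge v N (x + y) = vge v N y.
Proof. by rewrite addrC; exact: vgeDl. Qed.

Lemma vge_trans N y x z : vge v N (x - y) -> vge v N (y - z) -> vge v N (x - z).
Proof. by move=> h1 h2; rewrite -(subrK y x) -addrA vgeD. Qed.

Lemma vgeM M N x y : vge v M x -> vge v N y -> vge v (M + N) (x * y).
Proof.
rewrite /vge mulf_eq0; case: eqP => //= /eqP x0; case: eqP => //= /eqP y0.
by rewrite (Defs.valM hv)//; lia.
Qed.

Lemma vgeMr N x y : vge v N x -> vge v 0 y -> vge v N (x * y).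
Proof. by move=> hx hy; rewrite -(addr0 N) vgeM. Qed.

Lemma vgeMl N x y : vge v 0 x -> vge v N y -> vge v N (x * y).
Proof. by move=> hx hy; rewrite mulrC vgeMr. Qed.

Lemma vge_sum N (I : Type) (r : seq I) (P : pred I) (f : I -> F) :
  (forall i, P i -> vge v N (f i)) -> vge v N (\sum_(i <- r | P i) f i).
Proof. by move=> h; apply: (big_ind (vge v N)) => //; [exact: vge0|exact: vgeD]. Qed.

Lemma vge_prod N (I : Type) (r : seq I) (f : I -> F) :
  (forall i, vge v N (f i)) -> vge v ((size r)%:Z * N) (\prod_(i <- r) f i).
Proof.
move=> h; elim: r => [|i r IH]; first by rewrite big_nil mul0r vge1.
by rewrite big_cons /= intS mulrDl mul1r vgeM.
Qed.

Lemma valV x : x != 0 -> v x^-1 = - v x.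
Proof. by move=> x0; have := Defs.valM hv x0 (invr_neq0 x0); rewrite divff// val1; lia. Qed.

Lemma valX x n : x != 0 -> v (x ^+ n) = n%:Z * v x.
Proof.
move=> x0; elim: n => [|n IH]; first by rewrite expr0 val1 mul0r.
by rewrite exprS (Defs.valM hv)// ?expf_neq0// IH; lia.
Qed.

Lemma valXz x (n : int) : x != 0 -> v (x ^ n) = n * v x.
Proof.
move=> x0; case: n => n; first by rewrite -exprnP valX.
by rewrite NegzE -exprnN valV ?expf_neq0// valX//; lia.
Qed.

Lemma vgeMK N x y : x != 0 -> vge v (N + v x) (x * y) = vge v N y.
Proof.
by move=> x0; rewrite /vge mulf_eq0 (negPf x0) /=; case: eqP => //= /eqP y0;
  rewrite (Defs.valM hv)// [v x + _]addrC lerD2r.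
Qed.

Lemma vge_all0 x : (forall N : nat, vge v N%:Z x) -> x = 0.
Proof.
move=> h; apply/eqP; have [//|x0] := eqVneq x 0.
by have := h `|v x|.+1; rewrite vgeE//; lia.
Qed.

Lemma vge_unitM x y : v x = 0 -> x != 0 -> forall N, vge v N (x * y) = vge v N y.
Proof. by move=> vx x0 N; rewrite -(vgeMK N y x0) vx addr0. Qed.

Lemma unit_neq0 x : ~~ vge v 1 x -> x != 0.
Proof. by apply: contraNneq => ->; exact: vge0. Qed.

Lemma val_unit x : vge v 0 x -> ~~ vge v 1 x -> v x = 0.
Proof. by move=> h0 h1; have x0 := unit_neq0 h1; move: h0 h1; rewrite !vgeE//; lia. Qed.

Lemma val_exact N x : vge v N x -> ~~ vge v (N + 1) x -> x != 0 /\ v x = N.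
Proof.
move=> h0 h1; have x0 : x != 0 by apply: contraNneq h1 => ->; exact: vge0.
by split=> //; move: h0 h1; rewrite !vgeE//; lia.
Qed.

End Valuation.
#[global] Hint Resolve vge0 : core.

(** * Completeness of finite extensions *)

Definition vcauchy (F : fieldType) (v : F -> int) (u : nat -> F) :=
  forall N : int, exists n0 : nat, forall i j : nat,
    (n0 <= i)%N -> (n0 <= j)%N -> vge v N (u i - u j).

Definition vcvg (F : fieldType) (v : F -> int) (u : nat -> F) (l : F) :=
  forall N : int, exists n0 : nat, forall i : nat,
    (n0 <= i)%N -> vge v N (u i - l).

Definition vcomplete (F : fieldType) (v : F -> int) :=
  forall u, vcauchy v u -> exists l, vcvg v u l.

Section CompleteExtension.
Variables (F : fieldType) (L : fieldExtType F) (v : F -> int) (w : L -> int).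
Hypotheses (hv : normalized_valuation v) (hw : normalized_valuation w).
Variable c : int.
Hypotheses (c0 : 0 < c) (hext : extends_valuation c v w) (hcv : vcomplete v).

Lemma vge_scale N (a : F) (x : L) M :
  (a == 0) || (N <= c * v a) -> vge w M x -> vge w (N + M) (a *: x).
Proof.
move=> ha hx; rewrite -mulr_algl; apply: vgeM => //.
have [->|a0] := eqVneq a 0; first by rewrite scale0r.
move: ha; rewrite (negPf a0) /= => ha.
by rewrite /vge hext// ha orbT.
Qed.

Lemma vge_vcauchy_coef n (a : nat -> 'I_n -> F) (C : int) :
  (forall (i : 'I_n) (M N : nat), (M <= N)%N -> (a M i - a N i == 0) ||
     (M%:Z <= c * v (a M i - a N i) + C)) ->
  exists l : 'I_n -> F, forall i, vcvg v (a ^~ i) (l i).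
Proof.
move=> h; apply: (@fin_all_exists _ (fun=> F) (fun i l => vcvg v (a ^~ i) l)) => i.
apply: hcv => N.
pose n0 := `|(c * N + C)%R|%N; exists n0 => j k.
wlog jk : j k / (j <= k)%N.
  move=> H hj hk; have [|/ltnW] := leqP j k => jk; first exact: H.
  by rewrite vgeBC//; exact: H.
move=> hj _; rewrite /vge; have /orP[->//|hh] := h i j k jk.
apply/orP; right; rewrite -(ler_pM2l c0); move: hj hh; rewrite /n0; lia.
Qed.

(** Equivalence of norms over a complete field, by induction on n. The span of the first n vectors
    is complete, hence closed, so the last vector stays at positive distance from it. This distance
    bounds the last coordinate, and the induction hypothesis then bounds the others. *)
Lemma norm_equivalence n (e : 'I_n -> L) :
  (forall a : 'I_n -> F, \sum_i a i *: e i = 0 -> forall i, a i = 0) ->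
  exists C : int, forall (a : 'I_n -> F) N, vge w N (\sum_i a i *: e i) ->
    forall i, (a i == 0) || (N <= c * v (a i) + C).
Proof.
elim: n e => [|n IH] e free; first by exists 0 => a N _ [].
pose e' i := e (widen_ord (leqnSn n) i).
pose ext (a : 'I_n -> F) b i := if unlift ord_max i is Some j then a j else b : F.
have wl i : widen_ord (leqnSn n) i = lift ord_max i.
  by apply: val_inj; rewrite /= /bump leqNgt ltn_ord.
have extE a b : \sum_i ext a b i *: e i = \sum_i a i *: e' i + b *: e ord_max.
  rewrite big_ord_recr /= /ext unlift_none; congr (_ + _).
  by apply: eq_bigr => i _; rewrite /e' wl liftK.
have aE (a : 'I_n.+1 -> F) i : a i = ext (fun j => a (lift ord_max j)) (a ord_max) i.
  by rewrite /ext; case: unliftP => [j ->|->].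
have [|C hC] := IH e'.
  move=> a ha i; have := free (ext a 0); rewrite extE ha scale0r addr0.
  by move=> /(_ erefl (lift ord_max i)); rewrite /ext liftK.
(* M measures the distance from the last vector to the span of the others. Were there none,
   approximations of increasing precision would have Cauchy coordinates by the induction hypothesis,
   and their limits would give a linear relation. *)
have [M hM] : exists M : nat, forall a, ~~ vge w M (e ord_max + \sum_i a i *: e' i).
  apply: contrapT => /forallNP hn.
  have {}hn (M : nat) : exists a, vge w M (e ord_max + \sum_i a i *: e' i).
    by have /existsNP[a /negP/negPn ha] := hn M; exists a.
  pose a M := projT1 (cid (hn M)).
  have ha (M : nat) : vge w M%:Z (e ord_max + \sum_i a M i *: e' i) := projT2 (cid (hn M)).
  have [|l hl] := @vge_vcauchy_coef n a C.
    move=> i M N MN; apply: hC (fun i => a M i - a N i) _ _ i.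
    rewrite (_ : \sum_i _ = (e ord_max + \sum_i a M i *: e' i) -
                            (e ord_max + \sum_i a N i *: e' i)).
      by apply: vgeB => //; apply: vge_le (ha N); lia.
    rewrite opprD addrACA subrr add0r -sumrB.
    by apply: eq_bigr => i' _; rewrite scalerBl.
  suff : e ord_max + \sum_i l i *: e' i = 0.
    move=> h0; have := free (ext l 1); rewrite extE scale1r addrC h0.
    move=> /(_ erefl ord_max); rewrite /ext unlift_none => /eqP.
    by rewrite oner_eq0.
  apply: (vge_all0 (v := w)) => N.
  pose B := \sum_i `|w (e' i)|%N.
  have hB i : - B%:Z <= w (e' i).
    have : (`|w (e' i)| <= B)%N by rewrite /B (bigD1 i)//= leq_addr.
         lia.
  have [n0 hn0] : exists n0 : nat, forall i, forall j, (n0 <= j)%N ->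
      vge v (N%:Z + B%:Z) (a j i - l i).
    have /fin_all_exists[f hf] : forall i, exists n0 : nat, forall j, (n0 <= j)%N ->
      vge v (N%:Z + B%:Z) (a j i - l i) by move=> i; exact: hl.
    exists (\max_i f i)%N => i j hj; apply: hf; apply: leq_trans hj.
    exact: leq_bigmax.
  pose k := maxn n0 N.
  rewrite (_ : _ + _ = (e ord_max + \sum_i a k i *: e' i) -
     \sum_i (a k i - l i) *: e' i); last first.
    rewrite -addrA; congr (_ + _); rewrite -sumrB; apply: eq_bigr => i _.
    by rewrite scalerBl opprB addrC subrK.
  apply: vgeB => //; first by apply: vge_le (ha k); rewrite /k; lia.
  apply: vge_sum => // i _.
  apply: vge_le (_ : _ <= (N%:Z + B%:Z) + w (e' i)) _; first by have := hB i; lia.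
  apply: vge_scale (vge_val _ _).
  have /orP[->//|hh] := hn0 i k (leq_maxl _ _).
  by apply/orP; right; move: hh; nia.
pose C' := Num.max M%:Z (C - Num.min 0 (w (e ord_max) - M%:Z)).
exists C' => a N; have -> : \sum_i a i *: e i =
    \sum_i ext (fun j => a (lift ord_max j)) (a ord_max) i *: e i.
  by apply: eq_bigr => i _; rewrite -aE.
rewrite extE => hN i.
have hlast : (a ord_max == 0) || (N <= c * v (a ord_max) + M%:Z).
  have [//|b0] /= := eqVneq (a ord_max) 0.
  (* Were the last coordinate too large, dividing the combination by it would bring the span closer
     to the last vector than M allows. *)
  rewrite leNgt; apply/negP => hlt.
  apply/negP: (hM (fun i => a (lift ord_max i) / a ord_max)); apply/negPn.
  have := @vge_scale (- (c * v (a ord_max))) (a ord_max)^-1 _ N _ hN.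
  rewrite invr_eq0 (negPf b0) /= (valV hv)// mulrN lexx => /(_ isT).
  rewrite scalerDr scalerA mulVf// scale1r scaler_sumr [X in vge _ _ X]addrC.
  rewrite (eq_bigr (fun j => (a (lift ord_max j) / a ord_max) *: e' j)).
    by move=> hh; apply: vge_le hh; lia.
  by move=> j _; rewrite scalerA mulrC.
have {}hN : vge w (N + Num.min 0 (w (e ord_max) - M%:Z))
    (\sum_i a (lift ord_max i) *: e' i).
  rewrite -(addrK (a ord_max *: e ord_max) (\sum_i _)); apply: vgeB => //.
    by apply: vge_le hN; lia.
  have := vge_scale (N := N - M%:Z) (a := a ord_max) _ (vge_val w (e ord_max)).
  rewrite lerBlDr hlast => /(_ isT); apply: vge_le; lia.
case: (unliftP ord_max i) => [j|] ->; last first.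
  by move: hlast => /orP[->//|hh]; apply/orP; right; rewrite /C'; lia.
have /orP[->//|hh] := hC _ _ hN j.
by apply/orP; right; rewrite /C'; lia.
Qed.

Lemma complete_extension : vcomplete w.
Proof.
move=> u hu.
pose b := vbasis {:L}; pose d := \dim {:L}.
have bfree : free b by apply: basis_free; exact: vbasisP.
have xE (x : L) : x = \sum_(i < d) coord b i x *: b`_i.
  by apply: coord_vbasis; rewrite memvf.
have [|C hC] := @norm_equivalence d (fun i => b`_i).
  by move=> a; move/freeP: bfree; exact.
have /(_ _)/fin_all_exists[] := (fun i => hcv (u := fun n => coord b i (u n)) _).
  move=> i N; have [n0 hn0] := hu (c * N + C); exists n0 => j k hj hk.
  have := hn0 j k hj hk; rewrite (xE (_ - _)) => /hC /(_ i).
  rewrite linearB /= /vge => /orP[->//|hh]; apply/orP; right.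
  by rewrite -(ler_pM2l c0) -(lerD2r C).
move=> l hl; exists (\sum_i l i *: b`_i) => N.
pose B := \sum_(i < d) `|w b`_i|%N.
have hB i : (i < d)%N -> - B%:Z <= w b`_i.
  move=> id; have : (`|w b`_i| <= B)%N.
    by rewrite /B (bigD1 (Ordinal id))//= leq_addr.
  lia.
have /fin_all_exists[f hf] : forall i, exists n0 : nat, forall j, (n0 <= j)%N ->
    vge v (`|N|%:Z + B%:Z) (coord b i (u j) - l i) by move=> i; exact: hl.
exists (\max_i f i)%N => j hj.
rewrite [u j]xE -sumrB; apply: vge_sum => // i _; rewrite -scalerBl.
apply: vge_le (_ : _ <= (`|N|%:Z + B%:Z) + w b`_i) _; first by have := hB i (ltn_ord i); lia.
apply: vge_scale (vge_val _ _).
have /orP[->//|hh] := hf i j (leq_trans (leq_bigmax _) hj).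
apply/orP; right; apply: le_trans (hh) _; rewrite ler_peMl//.
by apply: le_trans hh; lia.
Qed.

End CompleteExtension.

(** * The unramified quadratic extension *)

(* [T] is a system of representatives of the residue field of the fixed field
   of [s]. *)
Record unramified_quadratic (L : fieldType) (v : L -> int) (s : {rmorphism L -> L})
    (T : seq L) (pi eps kap : L) : Prop := {
  uq_val : normalized_valuation v ;
  uq_invol : involutive s ;
  uq_vals : forall x, v (s x) = v x ;
  uq_pi : [/\ s pi = pi, pi != 0 & v pi = 1] ;
  uq_eps : [/\ s eps = - eps, eps != 0 & v eps = 0] ;
  uq_kap : kap + s kap = 1 /\ vge v 0 kap ;
  uq_T : forall t, t \in T -> s t = t /\ vge v 0 t ;
  uq_repr : forall x, s x = x -> vge v 0 x ->
    count (fun t => vge v 1 (x - t)) T = 1%N }.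

(** * Representatives of the residue field *)

Section ResidueRepr.
Variables (F : fieldType) (v : F -> int) (hv : normalized_valuation v).
Variables (q : nat) (hq : (residue_field v #= `I_q)%card).

(** The cardinality of the residue field is given by a bijection of sets of classes; later arguments
    count residues with [count], hence a list that meets each class once. *)
Lemma residue_representatives :
  exists T : seq F, [/\ size T = q, forall t, t \in T -> vge v 0 t &
    forall x, vge v 0 x -> count (fun t => vge v 1 (x - t)) T = 1%N].
Proof.
pose cls x := [set y | vge v 1 (y - x)].
have clsE x y : vge v 1 (x - y) -> cls x = cls y.
  move=> xy; apply/seteqP; split=> z /= hz.
    exact: vge_trans hz xy.
  by apply: vge_trans hz _ => //; rewrite vgeBC.
have clsI x y : cls x = cls y -> vge v 1 (x - y).
  by move=> xy; have : cls y x by rewrite -xy /cls /= subrr vge0.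
have [f [fh fi fs]] : exists f : nat -> set F, set_bij `I_q (residue_field v) f.
  by apply/card_set_bijP; rewrite card_eq_sym.
have hf (i : 'I_q) : exists x, vge v 0 x /\ f i = cls x.
  by have [x hx <-] := fh i (ltn_ord i); exists x.
have /fin_all_exists[g hg] := hf.
exists [seq g i | i <- enum 'I_q]; split.
- by rewrite size_map size_enum_ord.
- by move=> t /mapP[i _ ->]; case: (hg i).
move=> x hx; rewrite count_map.
have [i iq fix_] : [set f i | i in `I_q] (cls x) by apply: fs; exists x.
rewrite (eq_count (a2 := pred1 (Ordinal iq))); last first.
  move=> j /=; apply/idP/eqP => [h|->].
    apply: val_inj => /=; apply: fi; [exact/mem_set/ltn_ord|exact/mem_set|].
    by rewrite fix_ (hg j).2; apply: clsE => //; rewrite vgeBC.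
  by apply: clsI; rewrite -fix_; case: (hg (Ordinal iq)).
by rewrite count_uniq_mem ?enum_uniq// mem_enum.
Qed.

End ResidueRepr.

Lemma quadratic_conjugate (F : fieldType) (x y b c : F) :
  y != x -> x * x = b + c * x -> y * y = b + c * y -> y = c - x.
Proof.
move=> yx hx hy; apply: (@mulfI _ (y - x)); first by rewrite subr_eq0.
by ring: hx hy.
Qed.

(** * Integral generator of k' and isometry of the conjugation *)

Section Quadratic.
Variables (k : fieldType) (v : k -> int) (hv : normalized_valuation v).
Variables (L : fieldExtType k) (w : L -> int) (hw : normalized_valuation w).
Hypotheses (hcv : vcomplete v) (hdim : \dim {:L} = 2%N).
Hypothesis hun : extends_valuation 1 v w.
Variable s : {lrmorphism L -> L}.
Hypothesis hs : exists a : L, s a != a.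

Lemma vge_alg N (a : k) : vge w N a%:A = vge v N a.
Proof.
have [->|a0] := eqVneq a 0; first by rewrite scale0r !vge0.
rewrite !vgeE ?hun ?mul1r// scaler_eq0 negb_or a0; exact: oner_neq0.
Qed.

Lemma vgeZ M N (a : k) x : vge v M a -> vge w N x -> vge w (M + N) (a *: x).
Proof. by move=> ha hx; rewrite -mulr_algl; apply: vgeM => //; rewrite vge_alg. Qed.

(** By [norm_equivalence] the valuations of the translates of [a] by elements of k are bounded, so
    one of them is maximal. As k and k' have the same value group, scaling by an element of k makes
    it a unit th. Maximality says that no b + th has positive valuation: the residue of th is
    outside the residue field of k, whence 1 and th form an integral basis. *)
Lemma unramified_generator : exists th : L,
  (forall x, exists b c : k, x = b%:A + c *: th) /\
  (forall b c N, vge w N (b%:A + c *: th) = vge v N b && vge v N c).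
Proof.
have [a ha] := hs.
have sA (b : k) : s b%:A = b%:A by exact: rmorph_alg.
have ind (b c : k) : b%:A + c *: a = 0 -> b = 0 /\ c = 0.
  move=> h0; have c0 : c = 0.
    apply/eqP; apply: contraNT ha => c0.
    have -> : a = (- (c^-1 * b))%:A.
      apply: (scalerI c0); rewrite scalerA mulrN mulrA divff// mul1r scaleNr.
      by apply/eqP; rewrite eq_sym -subr_eq0 -opprD oppr_eq0 h0.
    by rewrite sA.
  split=> //; apply/eqP; move/eqP: h0; rewrite c0 scale0r addr0 scaler_eq0.
  by rewrite oner_eq0 orbF.
have bas : basis_of {:L} [tuple 1; a].
  rewrite basisEfree subvf hdim leqnn !andbT; apply/freeP => c.
  rewrite big_ord_recl big_ord1 /= => /ind[h0 h1] i.
  case: (unliftP ord0 i) => [j|] -> //; by rewrite (ord1 j).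
have spn x : exists b c : k, x = b%:A + c *: a.
  exists (coord [tuple 1; a] ord0 x), (coord [tuple 1; a] (lift ord0 ord0) x).
  rewrite {1}(coord_basis bas (memvf x)) big_ord_recl big_ord1 /=.
  by [].
have [C hC] : exists C : int, forall b N, vge w N (b%:A + a) -> N <= C.
  have [|C hC] := norm_equivalence hv hw (ltr01 : 0 < 1 :> int) hun hcv
    (e := fun i : 'I_2 => if i == ord0 then 1 else a).
    move=> c; rewrite big_ord_recl big_ord1 /= => /ind[h0 h1] i.
    case: (unliftP ord0 i) => [j|] -> //; by rewrite (ord1 j).
  exists C => b N hN.
  have := hC (fun i => if i == ord0 then b else 1) N.
  rewrite big_ord_recl big_ord1 /= scale1r => /(_ hN (lift ord0 ord0)) /=.
  by rewrite oner_eq0 (val1 hv) mulr0 add0r.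
(* Valuations are integers, so the maximum below C is found as the least natural number n for which
   C - n is attained. *)
pose P n := `[< exists b : k, w (b%:A + a) = C - n%:Z >].
have exP : exists n, P n.
  exists `|(C - w a)%R|%N; apply/asboolP; exists 0; rewrite scale0r add0r.
  have := hC 0 (w a); rewrite scale0r add0r => /(_ (vge_val _ _)) h.
  by rewrite gez0_abs ?subr_ge0// opprB addrCA subrr addr0.
case: (ex_minnP exP) => n0 /asboolP[b0 hb0] nmin.
set a1 := b0%:A + a in hb0.
have a1max (b : k) : w (b%:A + a1) <= w a1.
  rewrite /a1 addrA -scalerDl.
  have h1 := hC (b + b0) _ (vge_val _ _).
  have : P `|(C - w ((b + b0)%:A + a))%R|%N.
    apply/asboolP; exists (b + b0).
    by rewrite gez0_abs ?subr_ge0// opprB addrCA subrr addr0.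
  move=> /nmin; rewrite -lez_nat gez0_abs ?subr_ge0// => h2.
  by rewrite hb0 lerBrDl -lerBrDr.
have [t t0 ht] := val_uniformizer hv.
pose u := t ^ (w a1).
have u0 : u != 0 by rewrite expfz_neq0.
have vu : v u = w a1 by rewrite (valXz hv)// ht mulr1.
pose th := u^-1 *: a1.
have wuth : w (u%:A : L) = w a1 by rewrite hun// mul1r.
have aE : a1 = u%:A * th by rewrite mulr_algl scalerA divff// scale1r.
have thE b : b%:A + th = u^-1 *: ((u * b)%:A + a1).
  by rewrite scalerDr scalerA mulrA mulVf// mul1r.
have th0 b : b%:A + th != 0.
  rewrite thE scaler_eq0 negb_or invr_eq0 u0 /=; apply/eqP.
  by rewrite /a1 addrA -scalerDl -[a]scale1r => /ind[_ /eqP]; rewrite oner_eq0.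
have wth b : w (b%:A + th) <= 0.
  rewrite thE -mulr_algl (Defs.valM hw).
  - rewrite hun ?invr_eq0// mul1r (valV hv)// vu.
    by rewrite addrC subr_le0; exact: a1max.
  - by rewrite scaler_eq0 negb_or invr_eq0 u0 oner_neq0.
  - by have := th0 b; rewrite thE scaler_eq0 negb_or => /andP[].
have wth0 : w th = 0.
  have tt : th != 0 by have := th0 0; rewrite scale0r add0r.
  apply: (addrI (w a1)); rewrite addr0 -{1}wuth -(Defs.valM hw) -?aE//.
  by rewrite scaler_eq0 negb_or u0 oner_neq0.
exists th; split.
  move=> x; have [b [c ->]] := spn x.
  exists (b - c * b0), (c * u); rewrite /th scalerA mulfK// /a1 scalerDr scalerA.
  by rewrite addrA -scalerDl subrK.
move=> b c N; have [->|c0] := eqVneq c 0.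
  by rewrite scale0r addr0 vge0 andbT vge_alg.
apply/idP/andP => [h|[hb hc]]; last first.
  apply: (vgeD hw); first by rewrite vge_alg.
  by rewrite -[N]addr0 -wth0; apply: vgeZ (vge_val _ _).
(* Division by c leaves b / c + th, whose valuation is at most 0; hence c carries the whole
   valuation. *)
have hc : vge v N c.
  have : vge w (- v c + N) (c^-1 *: (b%:A + c *: th)).
    by apply: vgeZ => //; rewrite -(valV hv)// vge_val.
  rewrite scalerDr (scalerA _ c) mulVf// scale1r (scalerA _ b) vgeE//.
  rewrite (vgeE _ _ c0) => /le_trans /(_ (wth _)).
  by rewrite addrC subr_le0.
split=> //; rewrite -vge_alg -(addrK (c *: th) b%:A); apply: (vgeB hw) => //.
by rewrite -[N]addr0 -wth0; apply: vgeZ (vge_val _ _).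
Qed.

(** In the basis 1, th the conjugation lowers valuations by at most a fixed amount. Applied to high
    powers of an element, a bounded loss forces the loss to be zero. *)
Lemma conj_val_package : exists th ths : L,
  [/\ s th = ths, s ths = th, (forall x, exists b c : k, x = b%:A + c *: th),
     (forall b c N, vge w N (b%:A + c *: th) = vge v N b && vge v N c) &
     involutive s /\ forall x, w (s x) = w x].
Proof.
have [th [spn hth]] := unramified_generator.
have sA (b : k) : s b%:A = b%:A by exact: rmorph_alg.
have sE b c : s (b%:A + c *: th) = b%:A + c *: s th.
  by rewrite rmorphD /= sA linearZ.
have [b [c e2]] := spn (th * th).
have sth : s th != th.
  have [a] := hs; apply: contraNneq => h.
  by have [b' [c' ->]] := spn a; rewrite sE h.
have ths : s th = c%:A - th.
  have h2 : s th * s th = b%:A + c *: s th by rewrite -[RHS]sE -e2 rmorphM.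
  apply: (quadratic_conjugate (b := b%:A) sth); first by rewrite mulr_algl.
  by rewrite mulr_algl.
have inv : involutive s.
  move=> x; have [b' [c' ->]] := spn x; rewrite sE rmorphD /= sA linearZ /=.
  by rewrite ths rmorphB /= sA ths subKr.
exists th, (s th); split=> //; split=> //.
pose C := Num.min 0 (w (s th)).
have hC N x : vge w N x -> vge w (N + C) (s x).
  have [b' [c' ->]] := spn x; rewrite hth sE => /andP[hb hc].
  apply: (vgeD hw); first by rewrite vge_alg; apply: vge_le hb; rewrite /C; lia.
  apply: vge_le (_ : _ <= N + w (s th)) _; first by rewrite /C; lia.
  exact: vgeZ (vge_val _ _).
have hle x : x != 0 -> w x <= w (s x).
  move=> x0; have sx0 : s x != 0 by rewrite fmorph_eq0.
  rewrite leNgt; apply/negP => hlt.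
  (* A strict drop at x would be multiplied by |C| + 1 on this power and exceed the permitted
     |C|. *)
  have := hC _ _ (vge_val w (x ^+ `|C|.+1)).
  rewrite rmorphXn /= vgeE ?expf_neq0// !(valX hw)//.
  by rewrite /C; nia.
move=> x; have [->|x0] := eqVneq x 0; first by rewrite rmorph0.
apply/eqP; rewrite eq_le hle// andbT -{2}(inv x) hle//.
by rewrite fmorph_eq0.
Qed.

End Quadratic.

Lemma count_eq1 (I : eqType) (P : pred I) (r : seq I) : count P r = 1%N ->
  (exists2 t, t \in r & P t) /\ {in r &, forall t t', P t -> P t' -> t = t'}.
Proof.
move=> c1; have : has P r by rewrite has_count c1.
move=> /hasP ex; split=> // t t' tr t'r Pt Pt'.
move: c1; rewrite -size_filter => c1.
have ht : t \in [seq x <- r | P x] by rewrite mem_filter Pt.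
have ht' : t' \in [seq x <- r | P x] by rewrite mem_filter Pt'.
case: ([seq x <- r | P x]) c1 ht ht' => [//|a [|//]] _.
by rewrite !inE => /eqP -> /eqP ->.
Qed.

(** In residue characteristic two (t - t')^2 and t^2 - t'^2 agree modulo 2, so squaring is injective
    on the finite residue field, hence surjective. *)
Lemma residue_squares (F : fieldType) (v : F -> int) (T : seq F) (x : F) :
  normalized_valuation v -> vge v 1 2 -> (forall t, t \in T -> vge v 0 t) ->
  (forall y, vge v 0 y -> count (fun t => vge v 1 (y - t)) T = 1%N) ->
  vge v 0 x -> exists2 a, vge v 0 a & vge v 1 (a ^+ 2 - x).
Proof.
move=> hv h2 hT hc hx.
have repr y : vge v 0 y -> exists2 t, t \in T & vge v 1 (y - t).
  by move=> hy; have [] := count_eq1 (hc _ hy).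
have reprI : {in T &, forall t t', vge v 1 (t - t') -> t = t'}.
  move=> t t' tT t'T h; have [_] := count_eq1 (hc _ (hT _ tT)).
  by apply=> //; rewrite subrr.
have uT : uniq T.
  apply: count_mem_uniq => t; have [tT|] := boolP (t \in T); last exact/count_memPn.
  have le1 : (count_mem t T <= 1)%N.
    by rewrite -(hc _ (hT _ tT)); apply: sub_count => t' /= /eqP ->; rewrite subrr.
  by apply/eqP; rewrite eqn_leq le1 /= -has_count has_pred1.
pose g t := nth 0 T (find (fun t' => vge v 1 (t ^+ 2 - t')) T).
have hg t : t \in T -> g t \in T /\ vge v 1 (t ^+ 2 - g t).
  move=> tT; have [|t' t'T h] := repr (t ^+ 2).
    by rewrite expr2 -[0]addr0; apply: vgeM => //; exact: hT.
  have hs : has (fun t' => vge v 1 (t ^+ 2 - t')) T by apply/hasP; exists t'.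
  split; first by rewrite mem_nth// -has_find.
  exact: (nth_find 0 hs).
have ug : uniq (map g T).
  rewrite map_inj_in_uniq// => t t' tT t'T gtt.
  apply: reprI => //; have [_ h1] := hg _ tT; have [_ h1'] := hg _ t'T.
  have : vge v 1 ((t - t') * (t - t')).
    rewrite (_ : _ * _ = (t ^+ 2 - g t) - (t' ^+ 2 - g t') - 2 * (t' * (t - t'))).
      apply: vgeB => //; first exact: vgeB.
      rewrite -[1]addr0; apply: vgeM => //; rewrite -[0]addr0; apply: vgeM => //.
        exact: hT.
      by apply: vgeB => //; exact: hT.
    by rewrite gtt; ring.
  apply: contraTT => ht; have ht0 := unit_neq0 ht.
  rewrite (vge_unitM hv)//; apply: val_unit => //.
  by apply: vgeB => //; exact: hT.
have gT : {subset map g T <= T} by move=> y /mapP[t tT ->]; case: (hg _ tT).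
have [|_ eqgT] := uniq_min_size ug gT; first by rewrite size_map.
have [t tT ht] := repr _ hx.
move: tT; rewrite -eqgT => /mapP[a aT ta]; exists a; first exact: hT.
have [_ ha] := hg _ aT; rewrite -ta in ha.
by apply: vge_trans ha _ => //; rewrite vgeBC.
Qed.

(** Separability of the residue extension, with [A] standing for the base field. Suppose th and ths
    are congruent. If 2 is a unit, th is congruent to half its trace. Otherwise th^2 is congruent to
    the norm of th, hence to some a^2 with a in [A], and (th - a)^2 vanishes in the residue field.
    Either way th is congruent to an element of [A]. *)
Lemma conj_separable (L : fieldType) (w : L -> int) (A : L -> Prop) (th ths : L) :
  normalized_valuation w -> vge w 0 th ->
  (forall a, A a -> ~~ vge w 1 (th - a)) ->
  A ((th + ths) / 2) ->
  (vge w 1 2 -> exists2 a, A a & vge w 0 a && vge w 1 (a ^+ 2 - th * ths)) ->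
  ~~ vge w 1 (th - ths).
Proof.
move=> hw hth hA htr hsq; apply/negP => h.
have [h2|h2] := boolP (vge w 1 2).
  have [a Aa /andP[a0 ha]] := hsq h2.
  have := hA _ Aa; apply/negP/negPn.
  have : vge w 1 ((th - a) * (th - a)).
    rewrite (_ : _ * _ = (a ^+ 2 - th * ths) + th * (th + ths) - 2 * (a * th));
      last by ring.
    have hths : vge w 1 (th + ths).
      rewrite (_ : _ + _ = 2 * th - (th - ths)); last by ring.
      by apply: vgeB => //; apply: vgeMr.
    apply: vgeB => //; first by apply: vgeD => //; apply: vgeMl.
    by apply: vgeMr => //; apply: vgeMl.
  apply: contraTT => ht; have ht0 := unit_neq0 ht.
  rewrite (vge_unitM hw)//; apply: val_unit => //.
  exact: vgeB.
have := hA _ htr; apply/negP/negPn.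
have n2 : (2 : L) != 0 by exact: unit_neq0 h2.
have v2 : w 2 = 0.
  by apply: val_unit => //; rewrite -[2]/(1 + 1); apply: vgeD => //; apply: vge1.
rewrite -(vge_unitM hw _ v2)//.
rewrite (_ : 2 * _ = th - ths)//; by field.
Qed.

(** * Construction of [eps] and [kap] *)

Section Package.
Variables (k : fieldType) (v : k -> int) (hv : normalized_valuation v).
Variables (L : fieldExtType k) (w : L -> int) (hw : normalized_valuation w).
Hypotheses (hcv : vcomplete v) (hdim : \dim {:L} = 2%N).
Hypothesis hun : extends_valuation 1 v w.
Variable s : {lrmorphism L -> L}.
Hypothesis hs : exists a : L, s a != a.
Variables (q : nat) (hq : (residue_field v #= `I_q)%card).

Lemma unramified_quadratic_package : exists T pi eps kap,
  size T = q /\ @unramified_quadratic L w s T pi eps kap.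
Proof.
have [th [ths [sth sths spn hth [inv ws]]]] :=
  conj_val_package hv hw hcv hdim hun hs.
have sA (b : k) : s b%:A = b%:A by exact: rmorph_alg.
have sE b c : s (b%:A + c *: th) = b%:A + c *: ths.
  by rewrite rmorphD /= sA linearZ /= sth.
have thn : ths != th.
  have [a] := hs; apply: contraNneq => h.
  by have [b' [c' ->]] := spn a; rewrite sE h.
have fixA x : s x = x -> exists b : k, x = b%:A.
  have [b [c ->]] := spn x; rewrite sE => /addrI/eqP.
  rewrite -subr_eq0 -scalerBr scaler_eq0 subr_eq0 (negPf thn) orbF => /eqP ->.
  by exists b; rewrite scale0r addr0.
have [T [sT T0 Tc]] := residue_representatives hv hq.
have [t t0 ht] := val_uniformizer hv.
have wth : vge w 0 th.
  by have := hth 0 1 0; rewrite scale0r add0r scale1r => ->; rewrite vge0 vge1.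
have wths : vge w 0 ths by move: wth; rewrite /vge -sth fmorph_eq0 ws.
have alg2 : (2%:R : k)%:A = 2%:R :> L by rewrite scaler_nat.
have ueps : ~~ vge w 1 (th - ths).
  apply: (@conj_separable _ _ (fun x => exists b : k, x = b%:A)) => //.
  - move=> _ [b ->]; rewrite addrC -scaleNr -[th in X in vge _ _ X]scale1r.
    have v11 : ~~ vge v 1 1 by rewrite vgeE ?oner_neq0// (val1 hv).
    by rewrite hth (negPf v11) andbF.
  - apply: fixA; rewrite fmorph_div rmorphD /= sth sths addrC.
    by rewrite -alg2 sA.
  - rewrite -alg2 (vge_alg hun) => h2.
    have [n hn] : exists n : k, th * ths = n%:A.
      by apply: fixA; rewrite rmorphM /= sth sths mulrC.
    have hn0 : vge v 0 n by rewrite -(vge_alg hun) -hn; apply: vgeMr.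
    have [a a0 ha] := residue_squares hv h2 T0 Tc hn0.
    exists a%:A; first by exists a.
    by rewrite (vge_alg hun) a0 /= hn exprZn expr1n -scalerBl (vge_alg hun).
(* The difference th - ths changes sign under conjugation, and th / (th - ths) has trace 1; the
   latter is integral because the former is a unit. *)
exists [seq a%:A | a <- T], t%:A, (th - ths), (th / (th - ths)).
have eps0 := unit_neq0 ueps.
have weps : w (th - ths) = 0 by apply: val_unit => //; apply: vgeB.
split; first by rewrite size_map.
split=> //.
- split; first exact: sA.
    by rewrite scaler_eq0 negb_or t0 oner_neq0.
  by rewrite hun// mul1r.
- by split=> //; rewrite rmorphB /= sth sths opprB.
- split; last by apply: vgeMr => //; rewrite vgeE ?invr_eq0// (valV hw)// weps oppr0.
  rewrite fmorph_div rmorphB /= sth sths -(opprB th) invrN mulrN -mulrBl.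
  by rewrite divff.
- move=> _ /mapP[a aT ->]; split; first exact: sA.
  by rewrite (vge_alg hun) T0.
- move=> x /fixA[b ->]; rewrite (vge_alg hun) => /Tc; rewrite count_map => <-.
  by apply: eq_count => a /=; rewrite -scalerBl (vge_alg hun).
Qed.

End Package.

(** * Counting residues of given norm and trace *)

Lemma count_allpairs_if (A : eqType) (B C : Type) (f : A -> B -> C) (P : pred C)
    (Q : pred A) M r1 r2 :
  (forall a, a \in r1 -> count (fun b => P (f a b)) r2 = if Q a then M else 0%N) ->
  count P [seq f a b | a <- r1, b <- r2] = (M * count Q r1)%N.
Proof.
elim: r1 => [|a r1 IH] h; first by rewrite muln0.
rewrite /= count_cat count_map IH; last by move=> b hb; apply: h; rewrite inE hb orbT.
by rewrite (eq_count (a2 := fun b => P (f a b)))// h ?mem_head// mulnDr; case: (Q a);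
  rewrite ?muln1 ?muln0.
Qed.

(** Extremal counting: a total that reaches the termwise bound forces every term to reach it. This
    will show that the norm is surjective on nonzero residues. *)
Lemma sum_const_eq (A : eqType) (r : seq A) (n : A -> nat) (M : nat) :
  (forall a, a \in r -> (n a <= M)%N) -> (\sum_(a <- r) n a = M * size r)%N ->
  forall a, a \in r -> n a = M.
Proof.
move=> hle hs a ar; apply/eqP; rewrite eqn_leq hle//= leqNgt; apply/negP => hlt.
have : (\sum_(a <- rem a r) n a <= M * size (rem a r))%N.
  rewrite -[X in (_ <= X)%N]iter_addn_0 -count_predT -big_const_seq.
  rewrite big_seq [X in (_ <= X)%N]big_seq.
  by apply: leq_sum => b /mem_rem; apply: hle.
move: hs; rewrite (perm_big _ (perm_to_rem ar)) big_cons /= size_rem//.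
have : (0 < size r)%N by case: (r) ar.
by case: (size r) => //= n0 _; rewrite mulnS; move: hlt; lia.
Qed.

(** * Trace and skew coordinates, Hilbert 90 on residues *)

Section Unramified.
Variables (L : fieldType) (v : L -> int) (s : {rmorphism L -> L}).
Variables (T : seq L) (pi eps kap : L).
Hypothesis H : @unramified_quadratic L v s T pi eps kap.

Let hv : normalized_valuation v := uq_val H.
Local Notation q := (size T).
Local Hint Resolve hv : core.

Lemma vgeS N x : vge v N (s x) = vge v N x.
Proof. by rewrite /vge fmorph_eq0 (uq_vals H). Qed.

Lemma pi_neq0 : pi != 0. Proof. by case: (uq_pi H). Qed.
Lemma eps_neq0 : eps != 0. Proof. by case: (uq_eps H). Qed.

Lemma s_pi : s pi = pi. Proof. by case: (uq_pi H). Qed.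
Lemma s_eps : s eps = - eps. Proof. by case: (uq_eps H). Qed.
Lemma s_kap : s kap = 1 - kap.
Proof. by have [<- _] := uq_kap H; rewrite addrAC subrr add0r. Qed.
Lemma vge_kap : vge v 0 kap. Proof. by case: (uq_kap H). Qed.
Lemma val_eps : v eps = 0. Proof. by case: (uq_eps H). Qed.
Lemma vge_eps : vge v 0 eps. Proof. by rewrite -val_eps vge_val. Qed.

Lemma vgeV1 x : vge v 0 x -> ~~ vge v 1 x -> vge v 0 x^-1.
Proof.
move=> h0 h1; have x0 := unit_neq0 h1.
by rewrite vgeE ?invr_eq0// (valV hv)// (val_unit h0 h1).
Qed.

(** Coefficient of [eps] in the basis [kap], [eps] over the fixed field; the coefficient of [kap] is
    the trace. *)
Definition skew_part x := (x - (x + s x) * kap) / eps.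

Lemma skew_partE x : x = (x + s x) * kap + skew_part x * eps.
Proof. by rewrite divfK ?eps_neq0// addrC subrK. Qed.

Lemma s_trace x : s (x + s x) = x + s x.
Proof. by rewrite rmorphD /= (uq_invol H) addrC. Qed.

Lemma s_skew_part x : s (skew_part x) = skew_part x.
Proof.
rewrite fmorph_div rmorphB rmorphM /= s_trace s_eps s_kap invrN mulrN -mulNr.
by congr (_ / _); ring.
Qed.

Lemma vge_skew_part N x : vge v N x -> vge v N (skew_part x).
Proof.
move=> hx; apply: vgeMr => //; last first.
  by rewrite vgeE ?invr_eq0 ?eps_neq0// (valV hv) ?eps_neq0// val_eps.
apply: vgeB => //; apply: vgeMr => //; last exact: vge_kap.
by apply: vgeD => //; rewrite vgeS.
Qed.

(** Both coordinates are obtained from x by integral operations, [eps] being a unit, so a congruence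
    in k' splits into two congruences in k. *)
Lemma vge_decomp N x :
  vge v N x = vge v N (x + s x) && vge v N (skew_part x).
Proof.
apply/idP/andP => [h|[h1 h2]].
  by rewrite vge_skew_part// (vgeD hv)// vgeS.
rewrite (skew_partE x); apply: vgeD => //; apply: vgeMr => //; first exact: vge_kap.
exact: vge_eps.
Qed.

Lemma skew_partB x y : skew_part (x - y) = skew_part x - skew_part y.
Proof. by rewrite /skew_part rmorphB -mulrBl; congr (_ / _); ring. Qed.

Lemma trace_comb a b : s a = a -> s b = b ->
  let x := a * kap + b * eps in x + s x = a.
Proof. by move=> sa sb /=; rewrite rmorphD !rmorphM /= sa sb s_kap s_eps; ring. Qed.

Lemma skew_part_comb a b : s a = a -> s b = b ->
  skew_part (a * kap + b * eps) = b.
Proof.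
move=> sa sb; rewrite /skew_part trace_comb//; rewrite addrAC subrr add0r mulfK//.
exact: eps_neq0.
Qed.

(** Representatives of the residue field of k', obtained from those of k through the integral basis
    [kap], [eps]. *)
Definition T2 : seq L := [seq a * kap + b * eps | a <- T, b <- T].

Lemma size_T2 : size T2 = (q * q)%N.
Proof. exact: size_allpairs. Qed.

Lemma T2_int x : x \in T2 -> vge v 0 x.
Proof.
move=> /allpairsP[[a b] /= [aT bT ->]].
have [_ ha] := uq_T H aT; have [_ hb] := uq_T H bT.
by apply: vgeD => //; apply: vgeMr => //; [exact: vge_kap|exact: vge_eps].
Qed.

Lemma T2_repr x : vge v 0 x -> count (fun t => vge v 1 (x - t)) T2 = 1%N.
Proof.
rewrite vge_decomp => /andP[h1 h2].
rewrite (count_allpairs_if (M := 1) (Q := fun a => vge v 1 (x + s x - a))); last first.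
  move=> a aT; have [sa ha] := uq_T H aT.
  rewrite (eq_in_count (a2 := fun b => vge v 1 (x + s x - a) &&
      vge v 1 (skew_part x - b))).
    case: ifP => _ /=; last by rewrite count_pred0.
    by apply: (uq_repr H) => //; exact: s_skew_part.
  move=> b bT /=; have [sb hb] := uq_T H bT.
  rewrite vge_decomp skew_partB skew_part_comb// rmorphB addrACA -opprD.
  by rewrite (trace_comb sa sb).
by rewrite mul1n; apply: (uq_repr H) => //; exact: s_trace.
Qed.

Lemma T_repr_inj : {in T &, forall t t', vge v 1 (t - t') -> t = t'}.
Proof.
move=> t t' tT t'T h; have [st h0] := uq_T H tT.
by have [_] := count_eq1 (uq_repr H st h0); apply=> //; rewrite subrr.
Qed.

Lemma T2_repr_inj : {in T2 &, forall t t', vge v 1 (t - t') -> t = t'}.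
Proof.
move=> t t' tT t'T h; have [_] := count_eq1 (T2_repr (T2_int tT)).
by apply=> //; rewrite subrr.
Qed.

Lemma T2_uniq : uniq T2.
Proof.
apply: count_mem_uniq => t; have [tT|] := boolP (t \in T2); last exact/count_memPn.
have le1 : (count_mem t T2 <= 1)%N.
  rewrite -(T2_repr (T2_int tT)).
  by apply: sub_count => t' /= /eqP ->; rewrite subrr.
by apply/eqP; rewrite eqn_leq le1 /= -has_count has_pred1.
Qed.

Lemma T_uniq : uniq T.
Proof.
apply: count_mem_uniq => t; have [tT|] := boolP (t \in T); last exact/count_memPn.
have [st h0] := uq_T H tT.
have le1 : (count_mem t T <= 1)%N.
  rewrite -(uq_repr H st h0).
  by apply: sub_count => t' /= /eqP ->; rewrite subrr.
by apply/eqP; rewrite eqn_leq le1 /= -has_count has_pred1.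
Qed.

Lemma vge1_mul x y : vge v 0 x -> vge v 0 y -> vge v 1 (x * y) =
  vge v 1 x || vge v 1 y.
Proof.
move=> hx hy; apply/idP/orP => [|[h|h]]; last 2 first.
- exact: vgeMr.
- exact: vgeMl.
have [h|ux] := boolP (vge v 1 x); first by left.
by rewrite (vge_unitM hv _ (val_unit hx ux) (unit_neq0 ux)); right.
Qed.

Lemma norm_congr N x y : vge v 0 x -> vge v 0 y -> vge v N (x - y) ->
  vge v N (x * s x - y * s y).
Proof.
move=> hx hy hxy.
rewrite (_ : _ - _ = (x - y) * s x + y * s (x - y)); last by rewrite rmorphB; ring.
apply: vgeD => //; first by apply: vgeMr; rewrite ?vgeS.
by apply: vgeMl; rewrite ?vgeS.
Qed.

(** Hilbert's theorem 90 for the residue fields. The classical solution of x = u s(x) is 1 + u, or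
    [eps] when u is congruent to -1. Dividing x by its trace, or by its [eps] coordinate when the
    trace vanishes, moves it to one of the q + 1 listed points. *)
Lemma hilbert90_mod u : vge v 0 u -> vge v 1 (u * s u - 1) ->
  exists2 c, c \in eps :: [seq kap + t * eps | t <- T] & vge v 1 (c - u * s c).
Proof.
move=> hu hN.
have [x [x0 x1 hx]] : exists x, [/\ vge v 0 x, ~~ vge v 1 x & vge v 1 (x - u * s x)].
  have [h|h] := boolP (vge v 1 (1 + u)).
    exists eps; split; first exact: vge_eps.
      by rewrite vgeE ?eps_neq0// val_eps.
    rewrite s_eps (_ : _ - _ = (1 + u) * eps); last by ring.
    by apply: vgeMr => //; exact: vge_eps.
  exists (1 + u); split=> //; first by apply: vgeD => //; exact: vge1.
  rewrite rmorphD rmorph1 (_ : _ - _ = - (u * s u - 1)); last by ring.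
  by rewrite vgeN.
have [hA|hA] := boolP (vge v 1 (x + s x)).
  exists eps; first by rewrite mem_head.
  have hB : ~~ vge v 1 (skew_part x).
    by apply: contraNN x1 => hB; rewrite vge_decomp hA.
  have hB0 := vge_skew_part x0.
  have sx : s x = (x + s x) * s kap + skew_part x * s eps.
    by rewrite {1}(skew_partE x) rmorphD (rmorphM s _ kap) (rmorphM s _ eps) /=
      s_trace s_skew_part.
  have e : x - u * s x = skew_part x * (eps - u * s eps) +
      (x + s x) * (kap - u * s kap).
    by rewrite {1}(skew_partE x) {2}sx; ring.
  move: hx; rewrite e.
  have hk : vge v 1 ((x + s x) * (kap - u * s kap)).
    apply: vgeMr => //; apply: vgeB => //; first exact: vge_kap.
    by apply: vgeMr => //; rewrite vgeS vge_kap.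
  rewrite (vgeDl hv _ hk).
  rewrite vge1_mul//; first by rewrite (negPf hB).
  by apply: vgeB; rewrite // ?vge_eps//; apply: vgeMr => //; rewrite vgeS vge_eps.
have hA0 : vge v 0 (x + s x) by apply: vgeD => //; rewrite vgeS.
have hB0 := vge_skew_part x0.
have sAB : s (skew_part x / (x + s x)) = skew_part x / (x + s x).
  by rewrite fmorph_div s_skew_part s_trace.
have [|[t tT ht] _] := count_eq1 (uq_repr H sAB _).
  by apply: vgeMr => //; exact: vgeV1.
exists (kap + t * eps).
  by rewrite inE; apply/orP; right; apply/mapP; exists t.
have [st t0] := uq_T H tT.
have cx : vge v 1 (x - (x + s x) * (kap + t * eps)).
  rewrite {1}(skew_partE x) (_ : _ - _ =
     (x + s x) * ((skew_part x / (x + s x) - t) * eps)).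
    by apply: vgeMl => //; apply: vgeMr => //; exact: vge_eps.
  have x2 := unit_neq0 hA; rewrite mulrBl mulrBr mulrA mulrCA divff//; ring.
have : vge v 1 ((x + s x) * (kap + t * eps - u * s (kap + t * eps))).
  rewrite (_ : _ * _ = (x - u * s x) - (x - (x + s x) * (kap + t * eps)) +
    u * s (x - (x + s x) * (kap + t * eps))).
    by apply: vgeD => //; [exact: vgeB|apply: vgeMl; rewrite ?vgeS].
  by rewrite rmorphB [s ((x + s x) * _)]rmorphM /= s_trace; ring.
rewrite vge1_mul//; first by rewrite (negPf hA).
have hc : vge v 0 (kap + t * eps).
  by apply: vgeD; rewrite // ?vge_kap//; apply: vgeMr; rewrite // vge_eps.
by apply: vgeB => //; apply: vgeMr; rewrite ?vgeS.
Qed.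

End Unramified.

(** * Fibres of the norm on residues *)

Section NormCount.
Variables (L : fieldType) (v : L -> int) (s : {rmorphism L -> L}).
Variables (T : seq L) (pi eps kap : L).
Hypothesis H : @unramified_quadratic L v s T pi eps kap.

Let hv : normalized_valuation v := uq_val H.
Local Notation q := (size T).
Local Notation T2 := (T2 T eps kap).
Local Hint Resolve hv : core.

(** One representative for each line in the residue field of k' over that of k: the q + 1 points of
    a projective line. *)
Let P1 : seq L := eps :: [seq kap + t * eps | t <- T].

Let P1_unit c : c \in P1 -> vge v 0 c /\ ~~ vge v 1 c.
Proof.
have n1 : ~~ vge v 1 1 by rewrite vgeE ?oner_neq0// (val1 hv).
rewrite inE => /orP[/eqP ->|/mapP[t tT ->]].
  by split; [exact: vge_eps H|rewrite vgeE ?(eps_neq0 H)// (val_eps H)].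
have [st t0] := uq_T H tT; split.
  by apply: vgeD; rewrite // ?(vge_kap H)//; apply: vgeMr; rewrite // (vge_eps H).
apply: contraNN n1 => h.
have := trace_comb H (rmorph1 s) st; rewrite mul1r /= => <-.
by apply: vgeD => //; rewrite (vgeS H).
Qed.

Let P1_inj : {in P1 &, forall c c', vge v 1 (c * s c' - s c * c') -> c = c'}.
Proof.
have se := s_eps H; have sk := s_kap H.
have neps : ~~ vge v 1 eps by rewrite vgeE ?(eps_neq0 H)// (val_eps H).
move=> c c'; rewrite !inE.
move=> /orP[/eqP ->|/mapP[t tT ->]] /orP[/eqP ->|/mapP[t' tT' ->]] //.
- have [st _] := uq_T H tT'.
  rewrite rmorphD rmorphM /= se sk st (_ : _ - _ = eps); last by ring.
  by rewrite (negPf neps).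
- have [st _] := uq_T H tT.
  rewrite rmorphD rmorphM /= se sk st (_ : _ - _ = - eps); last by ring.
  by rewrite vgeN// (negPf neps).
- have [st t0] := uq_T H tT; have [st' t0'] := uq_T H tT'.
  rewrite !rmorphD !rmorphM /= se sk st st' (_ : _ - _ = (t - t') * eps); last by ring.
  have h0 : vge v 0 (t - t') by exact: vgeB.
  rewrite (vge1_mul H h0 (vge_eps H)) (negPf neps) orbF.
  by move=> /(T_repr_inj H tT tT') ->.
Qed.

Let P1_uniq : uniq P1.
Proof.
rewrite /= map_inj_uniq ?(T_uniq H) ?andbT//; last first.
  by move=> t t' /addrI/(mulIf (eps_neq0 H)).
apply/negP => /mapP[t tT h]; have [st _] := uq_T H tT.
have := trace_comb H (rmorph1 s) st; rewrite mul1r /= -h (s_eps H) subrr => /eqP.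
by rewrite eq_sym oner_eq0.
Qed.

(** A nonempty fibre is a coset of the norm-one residues, which by Hilbert 90 are the classes of c /
    s(c) for c in [P1]; distinct points have distinct quotients by [P1_inj]. *)
Lemma norm_fiber a b0 : s a = a -> vge v 0 a -> ~~ vge v 1 a ->
  vge v 0 b0 -> vge v 1 (a - b0 * s b0) ->
  count (fun b => vge v 1 (a - b * s b)) T2 = q.+1.
Proof.
move=> sa a0 ua hb0 hab.
have unit_of b : vge v 0 b -> vge v 1 (a - b * s b) -> ~~ vge v 1 b.
  move=> hb hN; apply: contraNN ua => h.
  by rewrite -(subrK (b * s b) a); apply: vgeD => //; apply: vgeMr; rewrite ?(vgeS H).
have ub0 := unit_of _ hb0 hab.
have b0n := unit_neq0 ub0.
have hub c : c \in P1 -> vge v 0 (b0 * (c / s c)).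
  move=> /P1_unit[hc uc]; apply: vgeMr => //; apply: vgeMr => //.
  by apply: (vgeV1 H); rewrite (vgeS H).
have /= ex c : exists b, c \in P1 -> b \in T2 /\ vge v 1 (b0 * (c / s c) - b).
  have [cP|] := boolP (c \in P1); last by exists 0.
  by have [[b bT hb] _] := count_eq1 (T2_repr H (hub _ cP)); exists b.
pose g c := projT1 (cid (ex c)).
have hg c : c \in P1 -> g c \in T2 /\ vge v 1 (b0 * (c / s c) - g c).
  exact: (projT2 (cid (ex c))).
have ug : uniq (map g P1).
  rewrite map_inj_in_uniq ?P1_uniq// => c c' cP c'P gg; apply: P1_inj => //.
  have [hc uc] := P1_unit cP; have [hc' uc'] := P1_unit c'P.
  have [_ h1] := hg _ cP; have [_ h1'] := hg _ c'P.
  have : vge v 1 (b0 * (c / s c - c' / s c')).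
    rewrite (_ : _ * _ = (b0 * (c / s c) - g c) - (b0 * (c' / s c') - g c')).
      exact: vgeB.
    by rewrite gg; ring.
  rewrite (vge_unitM hv _ (val_unit hb0 ub0) b0n) => h2.
  have sc : s c != 0 by rewrite fmorph_eq0; exact: unit_neq0 uc.
  have sc' : s c' != 0 by rewrite fmorph_eq0; exact: unit_neq0 uc'.
  rewrite (_ : _ - _ = (c / s c - c' / s c') * (s c * s c')); last by field; rewrite sc sc'.
  by apply: vgeMr => //; apply: vgeMr; rewrite ?(vgeS H).
rewrite -size_filter; have -> : q.+1 = size (map g P1) by rewrite size_map /= size_map.
apply/esym/perm_size; apply: uniq_perm => //; first by rewrite filter_uniq// (T2_uniq H).
move=> b; rewrite mem_filter; apply/mapP/andP => [[c cP ->]|[hN bT]].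
  have [gT hgc] := hg _ cP; split=> //.
  have [hc uc] := P1_unit cP.
  have sc : s c != 0 by rewrite fmorph_eq0; exact: unit_neq0 uc.
  have c0 := unit_neq0 uc.
  apply: (vge_trans hv hab).
  have := norm_congr H (hub _ cP) (T2_int H gT) hgc.
  congr (vge v 1 (_ - _)); rewrite !rmorphM fmorphV /= (uq_invol H).
  by field; rewrite c0 sc.
have hb := T2_int H bT; have ub := unit_of _ hb hN.
have sb0 : s b0 != 0 by rewrite fmorph_eq0.
have hiN : vge v 0 (b0 * s b0)^-1.
  apply: (vgeV1 H); first by apply: vgeMr; rewrite ?(vgeS H).
  by rewrite (vge1_mul H) ?(vgeS H)// negb_or ub0.
have hu : vge v 0 (b / b0) by apply: vgeMr => //; exact: (vgeV1 H).
have hu1 : vge v 1 (b / b0 * s (b / b0) - 1).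
  rewrite fmorph_div (_ : _ - _ = ((a - b0 * s b0) - (a - b * s b)) / (b0 * s b0)).
    by apply: vgeMr => //; exact: vgeB.
  by field; rewrite sb0 b0n.
have [c cP hc] := hilbert90_mod H hu hu1.
have [hc0 uc] := P1_unit cP.
have sc : s c != 0 by rewrite fmorph_eq0; exact: unit_neq0 uc.
exists c => //; have [gT hgc] := hg _ cP.
apply: (T2_repr_inj H) => //; apply: (vge_trans hv _ hgc).
rewrite (_ : _ - _ = - ((c - b / b0 * s c) * (b0 * (s c)^-1))).
  rewrite vgeN//; apply: vgeMr => //; apply: vgeMr => //.
  by apply: (vgeV1 H); rewrite (vgeS H).
by field; rewrite sc b0n.
Qed.

Lemma count_T_unit : count (fun t => ~~ vge v 1 t) T = q.-1.
Proof.
rewrite -(count_predC (vge v 1) T).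
have -> : count (vge v 1) T = 1%N; last by rewrite add1n.
rewrite -(uq_repr H (rmorph0 s) (vge0 v 0)).
by apply: eq_count => t /=; rewrite sub0r vgeN.
Qed.

(** Each of the q - 1 fibres over nonzero residues has at most q + 1 elements, and together they
    contain the q^2 - 1 nonzero residues of k'. Hence none is empty. *)
Lemma norm_count a : s a = a -> vge v 0 a -> ~~ vge v 1 a ->
  count (fun b => vge v 1 (a - b * s b)) T2 = q.+1.
Proof.
move=> sa a0 ua.
pose n a := count (fun b => vge v 1 (a - b * s b)) T2.
pose T1 := [seq t <- T | ~~ vge v 1 t].
have T1P t : t \in T1 -> [/\ t \in T, s t = t, vge v 0 t & ~~ vge v 1 t].
  by rewrite mem_filter => /andP[ut tT]; have [st t0] := uq_T H tT.
have nle t : t \in T1 -> (n t <= q.+1)%N.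
  move=> /T1P[tT st t0 ut]; have [->//|] := posnP (n t).
  rewrite /n -has_count => /hasP[b bT hb].
  by rewrite (norm_fiber st t0 ut (T2_int H bT) hb).
have q0 : (0 < q)%N.
  have : has (fun t => vge v 1 (0 - t)) T by rewrite has_count (uq_repr H (rmorph0 s)).
  by case: (T).
have sz : size T1 = q.-1 by rewrite size_filter count_T_unit.
have szT2 : count (fun b => ~~ vge v 1 b) T2 = (q * q).-1.
  rewrite -(size_T2 T eps kap) -(count_predC (vge v 1) T2).
  have -> : count (vge v 1) T2 = 1%N; last by rewrite add1n.
  rewrite -(T2_repr H (vge0 v 0)).
  by apply: eq_count => t /=; rewrite sub0r vgeN.
(* After exchanging the sums, each unit b is counted once, for the residue of its norm, and
   non-units are not counted at all. *)
have sum_n : (\sum_(t <- T1) n t = q.+1 * size T1)%N.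
  rewrite sz (_ : (q.+1 * q.-1 = (q * q).-1)%N); last by case: (q) q0 => //= r _; lia.
  rewrite -szT2 -sum1_count [RHS]big_mkcond /=.
  under eq_bigr do rewrite /n -sum1_count big_mkcond /=.
  rewrite exchange_big /= big_seq [RHS]big_seq; apply: eq_bigr => b bT.
  have hb := T2_int H bT.
  have hbb : vge v 0 (b * s b) by apply: vgeMr; rewrite ?(vgeS H).
  have sbb : s (b * s b) = b * s b by rewrite rmorphM /= (uq_invol H) mulrC.
  rewrite -big_mkcond sum1_count count_filter.
  have [h1|h1] := boolP (vge v 1 b) => /=.
    rewrite (eq_count (a2 := pred0)) ?count_pred0// => t /=.
    apply/negP => /andP[h2]; apply/negP/negPn.
    by rewrite -(subrK (b * s b) t); apply: vgeD => //; apply: vgeMr; rewrite ?(vgeS H).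
  rewrite -(uq_repr H sbb hbb); apply: eq_count => t /=; rewrite [in RHS]vgeBC//.
  have [h2|//] := boolP (vge v 1 (t - b * s b)); rewrite /=.
  apply: contraNN h1 => ht; have : vge v 1 (b * s b).
    by rewrite -(subKr t (b * s b)); apply: vgeB.
  by rewrite (vge1_mul H) ?(vgeS H)// orbb.
have [[t tT ht] _] := count_eq1 (uq_repr H sa a0).
have tT1 : t \in T1.
  rewrite mem_filter tT andbT; apply: contraNN ua => h.
  by rewrite -(subrK t a); apply: vgeD.
rewrite -(sum_const_eq nle sum_n tT1); apply: eq_count => b /=.
by rewrite -[RHS](vgeDr hv _ ht) addrA subrK.
Qed.

End NormCount.

(** * Unipotent translations of a triple and their counts *)

Section TripleCount.
Variables (L : fieldType) (v : L -> int) (s : {rmorphism L -> L}).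
Variables (T : seq L) (pi eps kap : L).
Hypothesis H : @unramified_quadratic L v s T pi eps kap.

Let hv : normalized_valuation v := uq_val H.
Local Notation q := (size T).
Local Notation T2 := (T2 T eps kap).
Local Hint Resolve hv : core.

Definition hform (a c b : L) : L := a * s b + s a * b + c * s c.

Definition skew (t : L) : L := t * eps.
(** Solutions of ga + s(ga) = - N(be): a particular one given by the trace-one element [kap], where
    - N(be) / 2 might fail to be integral, plus a skew element. *)
Definition gam (be t : L) : L := - (be * s be) * kap + skew t.

Lemma gamP be t : s t = t -> gam be t + s (gam be t) + be * s be = 0.
Proof.
move=> st; rewrite /gam /skew rmorphD !rmorphM rmorphN !rmorphM /= (uq_invol H).
by rewrite (s_kap H) (s_eps H) st; ring.
Qed.

Lemma gam_int be t : vge v 0 be -> vge v 0 t -> vge v 0 (gam be t).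
Proof.
move=> hb ht; apply: vgeD => //; last by apply: vgeMr => //; exact: vge_eps H.
apply: vgeMr => //; last exact: vge_kap H.
by rewrite vgeN//; apply: vgeMr; rewrite ?(vgeS H).
Qed.

Lemma hform_act a c b be ga : ga + s ga + be * s be = 0 ->
  hform a (c + be * a) (b - s be * c + ga * a) = hform a c b.
Proof.
move=> h; rewrite /hform !rmorphD rmorphN !rmorphM /= (uq_invol H).
rewrite -[RHS]addr0 -(mulr0 (a * s a)) -h; ring.
Qed.

Lemma vgeXK (i N : nat) x : vge v (i + N)%:Z (pi ^+ i * x) = vge v N%:Z x.
Proof.
have p0 := pi_neq0 H; have [_ _ vp] := uq_pi H.
by rewrite -(vgeMK hv N%:Z x (expf_neq0 i p0)) (valX hv)// vp mulr1 addrC PoszD addrC.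
Qed.

Lemma vgeXpi i : vge v i%:Z (pi ^+ i).
Proof. by rewrite -[pi ^+ i]mulr1 -{1}(addn0 i) vgeXK vge1. Qed.

Lemma vge_divX (i : nat) x : vge v i%:Z x -> exists2 y, vge v 0 y & x = pi ^+ i * y.
Proof.
have p0 := expf_neq0 i (pi_neq0 H).
move=> hx; exists (x / pi ^+ i); last by rewrite mulrC divfK.
by rewrite -(vgeXK i 0) addn0 mulrC divfK.
Qed.

Lemma vge_norm (i j : nat) c : (j <= i.*2)%N -> vge v i%:Z c -> vge v j%:Z (c * s c).
Proof.
move=> ij hc; apply: vge_le (_ : _ <= i%:Z + i%:Z) _; first by lia.
by apply: vgeM; rewrite ?(vgeS H).
Qed.

Lemma vge_norm_inv (i j : nat) c : (i.*2 <= j.+1)%N -> vge v j%:Z (c * s c) -> vge v i%:Z c.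
Proof.
move=> ij; have [->//|c0] := eqVneq c 0.
rewrite !vgeE ?mulf_neq0 ?fmorph_eq0// (Defs.valM hv) ?fmorph_eq0// (uq_vals H).
by lia.
Qed.

Lemma trace_div a c b : a != 0 ->
  b / a + s (b / a) = (hform a c b - c * s c) / (a * s a).
Proof.
by move=> a0; rewrite fmorph_div /hform; field; rewrite fmorph_eq0 a0.
Qed.

Lemma norm_unit a : vge v 0 a -> ~~ vge v 1 a -> ~~ vge v 1 (a * s a).
Proof. by move=> h0 h1; rewrite (vge1_mul H) ?(vgeS H)// negb_or h1. Qed.

Lemma norm_int a : vge v 0 a -> vge v 0 (a * s a).
Proof. by move=> h0; apply: vgeMr; rewrite ?(vgeS H). Qed.

Lemma s_norm a : s (a * s a) = a * s a.
Proof. by rewrite rmorphM /= (uq_invol H) mulrC. Qed.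

(** Adding a skew multiple of a to b leaves the trace of b / a unchanged. By [trace_div] this trace
    already vanishes modulo pi^(i+1), so only the [eps] coordinate of b / a is left to cancel, and
    one residue t does it. *)
Lemma count_skew (i : nat) a c b : vge v 0 a -> ~~ vge v 1 a -> vge v i%:Z b ->
  vge v i.+1%:Z (hform a c b - c * s c) ->
  count (fun t => vge v i.+1%:Z (b + skew (pi ^+ i * t) * a)) T = 1%N.
Proof.
move=> a0 ua hb hN; have an := unit_neq0 ua.
have [y y0 hy] := vge_divX hb.
have hx : vge v 0 (y / a) by apply: vgeMr => //; exact: (vgeV1 H).
have hTr : vge v 1 (y / a + s (y / a)).
  rewrite -(vgeXK i 1) addn1.
  have -> : pi ^+ i * (y / a + s (y / a)) = b / a + s (b / a).
    rewrite hy !rmorphM /= rmorphXn /= (s_pi H); ring.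
  rewrite (trace_div c _ an); apply: vgeMr => //.
  by apply: (vgeV1 H); [exact: norm_int|exact: norm_unit].
have sx := s_skew_part H (y / a).
have snx : s (- skew_part s eps kap (y / a)) = - skew_part s eps kap (y / a).
  by rewrite rmorphN /= sx.
rewrite -(uq_repr H snx); last by rewrite vgeN//; exact: (vge_skew_part H).
apply: eq_in_count => t tT; have [st t0] := uq_T H tT.
have -> : b + skew (pi ^+ i * t) * a = pi ^+ i * (a * (y / a + t * eps)).
  by rewrite hy /skew; field.
rewrite -addn1 vgeXK (vge_unitM hv _ (val_unit a0 ua) an).
rewrite (vge_decomp H) -opprD vgeN//.
have -> : y / a + t * eps + s (y / a + t * eps) = y / a + s (y / a).
  by rewrite rmorphD (rmorphM s t) /= st (s_eps H); ring.
rewrite hTr /=; congr (vge v 1 _).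
have := skew_partB s eps kap (y / a) (0 * kap + (- t) * eps).
rewrite (skew_part_comb H) ?rmorph0 ?rmorphN ?st//.
by rewrite mul0r add0r opprK mulNr opprK => ->.
Qed.

Lemma count_T2_shift x (P : pred L) : vge v 0 x ->
  (forall y z, vge v 0 y -> vge v 0 z -> vge v 1 (y - z) -> P y = P z) ->
  count (fun b => P (x + b)) T2 = count P T2.
Proof.
move=> x0 hP.
have /= ex b : exists b', b \in T2 -> b' \in T2 /\ vge v 1 (x + b - b').
  have [bT|] := boolP (b \in T2); last by exists 0.
  have [|[b' bT' hb] _] := count_eq1 (T2_repr H (x := x + b) _); last by exists b'.
  by apply: vgeD => //; exact: (T2_int H).
pose g b := projT1 (cid (ex b)).
have hg b : b \in T2 -> g b \in T2 /\ vge v 1 (x + b - g b).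
  exact: (projT2 (cid (ex b))).
rewrite (eq_in_count (a2 := P \o g)); last first.
  move=> b bT /=; have [gT h] := hg _ bT; apply: hP => //; last exact: (T2_int H).
  by apply: vgeD => //; exact: (T2_int H).
rewrite -count_map; apply/seq.permP.
have ug : uniq (map g T2).
  rewrite map_inj_in_uniq ?(T2_uniq H)// => b b' bT bT' gg.
  have [_ h] := hg _ bT; have [_ h'] := hg _ bT'.
  apply: (T2_repr_inj H) => //.
  rewrite (_ : _ - _ = (x + b - g b) - (x + b' - g b')); last by rewrite gg; ring.
  exact: vgeB.
have gT : {subset map g T2 <= T2} by move=> y /mapP[t tT ->]; case: (hg _ tT).
have [|_ eqgT] := uniq_min_size ug gT; first by rewrite size_map.
by apply: uniq_perm => //; exact: (T2_uniq H).
Qed.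

(** The translation moves c to some c' and preserves the form. Some t can bring b into the ideal of
    pi^(2i+1) only if N(c') agrees with the form to that order, and then exactly one does, by
    [count_skew]. The scales pi^i and pi^(2i) are those of c and b. *)
Lemma count_family (i : nat) a c b : vge v 0 a -> ~~ vge v 1 a ->
  vge v i%:Z c -> vge v i.*2%:Z b ->
  count (fun h : L * L => vge v i.*2.+1%:Z (b - s h.1 * c + gam h.1 h.2 * a))
    [seq (pi ^+ i * be, pi ^+ i.*2 * t) | be <- T2, t <- T] =
  count (fun be => vge v i.*2.+1%:Z
     (hform a c b - (c + pi ^+ i * be * a) * s (c + pi ^+ i * be * a))) T2.
Proof.
move=> a0 ua hc hb.
rewrite (count_allpairs_if (M := 1) (Q := fun be => vge v i.*2.+1%:Z
     (hform a c b - (c + pi ^+ i * be * a) * s (c + pi ^+ i * be * a)))) ?mul1n//.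
move=> be beT /=; have be0 := T2_int H beT.
set c' := c + _; pose b1 := b - s (pi ^+ i * be) * c + gam (pi ^+ i * be) 0 * a.
have hbe : vge v i%:Z (pi ^+ i * be) by rewrite -{1}(addn0 i) vgeXK.
have fE t : s t = t -> hform a c' (b1 + skew t * a) = hform a c b.
  move=> st; rewrite -(hform_act a c b (gamP (pi ^+ i * be) st)) -/c' /b1.
  by congr hform; rewrite /gam {1}/skew mul0r addr0 mulrDl addrA.
have hb1 : vge v i.*2%:Z b1.
  apply: vgeD => //.
    apply: vgeB => //; apply: vge_le (_ : _ <= i%:Z + i%:Z) _; first by lia.
    by apply: vgeM; rewrite ?(vgeS H).
  apply: vgeMr => //; rewrite /gam /skew mul0r addr0.
  apply: vgeMr => //; last exact: vge_kap H.
  by rewrite vgeN//; apply: (vge_norm (i := i)).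
have be_b1 t : b - s (pi ^+ i * be) * c + gam (pi ^+ i * be) t * a = b1 + skew t * a.
  by rewrite /b1 /gam /skew; ring.
under eq_count do rewrite be_b1.
have h0 : hform a c b = hform a c' b1 by rewrite -(fE 0) ?rmorph0// /skew !mul0r addr0.
case: ifP => hQ.
  by apply: (count_skew (c := c') _ _ hb1) => //; rewrite -h0.
rewrite (eq_in_count (a2 := pred0)) ?count_pred0// => t tT /=.
have [st t0] := uq_T H tT.
apply: contraFF hQ => ht; rewrite -(fE (pi ^+ i.*2 * t)); last first.
  by rewrite rmorphM rmorphXn /= (s_pi H) st.
rewrite /hform addrK; apply: vgeD => //; first by apply: vgeMl; rewrite ?(vgeS H).
by apply: vgeMl; rewrite ?(vgeS H).
Qed.

(** Here N(c') has to vanish to order 2i+1. Norms have even valuation, so c' vanishes to order i+1,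
    and since a is a unit this fixes be modulo pi. *)
Lemma count_family_gt (i : nat) a c b : vge v 0 a -> ~~ vge v 1 a ->
  vge v i%:Z c -> vge v i.*2%:Z b -> vge v i.*2.+1%:Z (hform a c b) ->
  count (fun h : L * L => vge v i.*2.+1%:Z (b - s h.1 * c + gam h.1 h.2 * a))
    [seq (pi ^+ i * be, pi ^+ i.*2 * t) | be <- T2, t <- T] = 1%N.
Proof.
move=> a0 ua hc hb hf; rewrite count_family//.
have [y y0 hy] := vge_divX hc; have an := unit_neq0 ua.
have hx : vge v 0 (- (y / a)) by rewrite vgeN//; apply: vgeMr => //; exact: (vgeV1 H).
rewrite -(T2_repr H hx); apply: eq_count => be /=.
rewrite (vgeDr hv) // vgeN// -opprD vgeN//.
have -> : c + pi ^+ i * be * a = pi ^+ i * (a * (y / a + be)) by rewrite hy; field.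
rewrite -(vge_unitM hv (y / a + be) (val_unit a0 ua) an) -(vgeXK i 1) addn1.
by apply/idP/idP; [apply: vge_norm_inv|apply: vge_norm]; lia.
Qed.

(** After division by pi^(2i) N(a) the condition says that the shifted residue be + c / (pi^i a)
    lies in the norm fibre of a unit, which has q + 1 elements. *)
Lemma count_family_eq (i : nat) a c b : vge v 0 a -> ~~ vge v 1 a ->
  vge v i%:Z c -> vge v i.*2%:Z b -> vge v i.*2%:Z (hform a c b) ->
  ~~ vge v i.*2.+1%:Z (hform a c b) ->
  count (fun h : L * L => vge v i.*2.+1%:Z (b - s h.1 * c + gam h.1 h.2 * a))
    [seq (pi ^+ i * be, pi ^+ i.*2 * t) | be <- T2, t <- T] = q.+1.
Proof.
move=> a0 ua hc hb hf nf; rewrite count_family//.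
have [y y0 hy] := vge_divX hc; have an := unit_neq0 ua.
have [f f0 hfE] := vge_divX hf.
have uf : ~~ vge v 1 f by move: nf; rewrite hfE -addn1 vgeXK.
have sf : s f = f.
  have p0 := expf_neq0 i.*2 (pi_neq0 H).
  apply: (mulfI p0); rewrite -hfE -{1}(s_pi H) -rmorphXn -rmorphM /= -hfE /hform.
  by rewrite !rmorphD !rmorphM /= !(uq_invol H); ring.
have hx : vge v 0 (y / a) by apply: vgeMr => //; exact: (vgeV1 H).
have Na0 := norm_int a0; have uNa := norm_unit a0 ua; have Nan := unit_neq0 uNa.
pose d := f / (a * s a).
have sd : s d = d by rewrite /d fmorph_div sf s_norm.
have d0 : vge v 0 d by apply: vgeMr => //; exact: (vgeV1 H).
have ud : ~~ vge v 1 d.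
  apply: contraNN uf => h; rewrite -(divfK Nan f).
  exact: vgeMr.
rewrite -(norm_count H sd d0 ud).
rewrite -(count_T2_shift (P := fun b => vge v 1 (d - b * s b)) hx); last first.
  move=> y1 z y10 z0 hyz; rewrite -[LHS](vgeDr hv (x := y1 * s y1 - z * s z)) //.
    by congr (vge v 1 _); ring.
  exact: (norm_congr H).
apply: eq_count => be /=.
rewrite hfE -(vge_unitM hv (d - _) (val_unit Na0 uNa) Nan).
rewrite -(vgeXK i.*2 1) addn1; congr (vge v _ _); rewrite hy /d.
rewrite !rmorphD !rmorphM fmorphV rmorphXn /= (s_pi H) -addnn exprD.
by field; rewrite fmorph_eq0 an.
Qed.

(** With c of exact valuation j, the term s(be) c at scale pi^(i-j) moves b linearly modulo
    pi^(i+1), and the bound on a makes the quadratic term negligible. One residue be cancels b. *)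
Lemma count_translate (i j : nat) a c b : (j <= i)%N ->
  vge v (j.*2%:Z + 1 - i%:Z) a -> vge v j%:Z c -> ~~ vge v j.+1%:Z c ->
  vge v i%:Z b ->
  count (fun be => vge v i.+1%:Z (b - s (pi ^+ (i - j) * be) * c +
     gam (pi ^+ (i - j) * be) 0 * a)) T2 = 1%N.
Proof.
move=> ji ha hc nc hb.
have [c1 c10 hc1] := vge_divX hc; have [b1 b10 hb1] := vge_divX hb.
have uc1 : ~~ vge v 1 c1 by move: nc; rewrite hc1 -addn1 vgeXK.
have c1n := unit_neq0 uc1.
have hx : vge v 0 (s (b1 / c1)).
  by rewrite (vgeS H); apply: vgeMr => //; exact: (vgeV1 H).
rewrite -(T2_repr H hx); apply: eq_in_count => be beT /=.
rewrite (vgeDl hv); last first.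
  rewrite /gam /skew mul0r addr0.
  apply: vge_le (_ : _ <= ((i - j)%N%:Z + (i - j)%N%:Z) + (j.*2%:Z + 1 - i%:Z)) _; first by lia.
  apply: vgeM => //; apply: vgeMr => //; last exact: vge_kap H.
  have hp : vge v (i - j)%N%:Z (pi ^+ (i - j) * be).
    by rewrite -{1}(addn0 (i - j)%N) vgeXK; exact: (T2_int H).
  by rewrite vgeN//; apply: vgeM; rewrite ?(vgeS H).
rewrite -[in RHS](vgeS H) rmorphB /= (uq_invol H).
rewrite -(vge_unitM hv (b1 / c1 - s be) (val_unit c10 uc1) c1n) -(vgeXK i 1) addn1.
congr (vge v _ _); rewrite hb1 hc1 rmorphM rmorphXn /= (s_pi H).
have -> : pi ^+ i = pi ^+ (i - j) * pi ^+ j by rewrite -exprD subnK.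
by field.
Qed.

End TripleCount.

(** * Hermitian involutions and minors *)

Section ConjTranspose.
Variables (L : fieldType) (s : {rmorphism L -> L}).
Hypothesis inv : involutive s.

Definition ct (m n : nat) (A : 'M[L]_(m, n)) : 'M[L]_(n, m) := (map_mx s A)^T.

Lemma ctE m n (A : 'M[L]_(m, n)) i j : ct A i j = s (A j i).
Proof. by rewrite !mxE. Qed.

Lemma ctM m n p (A : 'M[L]_(m, n)) (B : 'M[L]_(n, p)) : ct (A *m B) = ct B *m ct A.
Proof. by rewrite /ct map_mxM trmx_mul. Qed.

Lemma ctK m n (A : 'M[L]_(m, n)) : ct (ct A) = A.
Proof. by apply/matrixP => i j; rewrite !ctE inv. Qed.

Lemma ctB m n (A B : 'M[L]_(m, n)) : ct (A - B) = ct A - ct B.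
Proof. by apply/matrixP => i j; rewrite !mxE rmorphB. Qed.

Lemma ctD m n (A B : 'M[L]_(m, n)) : ct (A + B) = ct A + ct B.
Proof. by apply/matrixP => i j; rewrite !mxE rmorphD. Qed.

Lemma ctZ m n a (A : 'M[L]_(m, n)) : ct (a *: A) = s a *: ct A.
Proof. by apply/matrixP => i j; rewrite !mxE rmorphM. Qed.

Lemma ct0 m n : ct (0 : 'M[L]_(m, n)) = 0.
Proof. by apply/matrixP => i j; rewrite !mxE rmorph0. Qed.

Lemma ct1 n : ct (1%:M : 'M[L]_n) = 1%:M.
Proof. by rewrite /ct map_mx1 trmx1. Qed.

Lemma det_ct n (A : 'M[L]_n) : \det (ct A) = s (\det A).
Proof. by rewrite /ct det_tr det_map_mx. Qed.

Lemma ct_delta m n i j : ct (delta_mx i j : 'M[L]_(m, n)) = delta_mx j i.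
Proof. by apply/matrixP => a b; rewrite !mxE rmorph_nat andbC. Qed.

Local Notation J m := (antidiag L m).

Lemma antidiagE m (i j : 'I_m) : J m i j = (rev_ord i == j)%:R.
Proof.
rewrite mxE; congr (nat_of_bool _)%:R; apply/eqP/eqP => [h|<-].
  by apply: val_inj => /=; lia.
by rewrite /=; have := ltn_ord i; lia.
Qed.

Lemma mul_antidiag m n (A : 'M[L]_(m, n)) i j : (J m *m A) i j = A (rev_ord i) j.
Proof.
rewrite mxE (bigD1 (rev_ord i))//= antidiagE eqxx mul1r big1 ?addr0// => l hl.
by rewrite antidiagE eq_sym (negPf hl) mul0r.
Qed.

Lemma antidiag_sqr m : J m *m J m = 1%:M.
Proof.
by apply/matrixP => i j; rewrite mul_antidiag antidiagE rev_ordK mxE.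
Qed.

Lemma ct_antidiag m : ct (J m) = J m.
Proof.
apply/matrixP => i j; rewrite ctE !antidiagE rmorph_nat; congr (nat_of_bool _)%:R.
by rewrite (can2_eq rev_ordK rev_ordK) eq_sym.
Qed.

Lemma mxtrace_antidiag m : \tr (J m) = (odd m)%:R.
Proof.
rewrite /mxtrace; under eq_bigr do rewrite mxE.
have [om|em] := boolP (odd m).
  have hm : (m./2 < m)%N by rewrite -{2}(odd_double_half m) om; lia.
  rewrite (bigD1 (Ordinal hm))//= big1 ?addr0.
    rewrite (_ : (_ == _)%N)//; apply/eqP.
    by rewrite -[in RHS](odd_double_half m) om /= addnn.
  move=> i hi; case: eqP => // h; case/eqP: hi; apply: val_inj => /=.
  by move: h (odd_double_half m); rewrite om; lia.
rewrite big1// => i _; case: eqP => // h; move: h (odd_double_half m) (ltn_ord i).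
by rewrite (negPf em); lia.
Qed.

Lemma unitaryG_inv m (g : 'M[L]_m) : unitaryG s g -> g *m J m *m ct g = J m.
Proof.
case=> _ h.
have h1 : (J m *m ct g *m J m) *m g = 1%:M.
  by rewrite -!mulmxA (mulmxA (ct g)) -[ct g *m J m *m g]/(conjtr s g *m J m *m g)
     h antidiag_sqr.
have h2 := mulmx1C h1.
rewrite -[LHS]mulmx1 -antidiag_sqr mulmxA.
by rewrite (_ : g *m J m *m ct g *m J m = 1%:M) ?mul1mx// -h2 !mulmxA.
Qed.

Lemma unitaryG_of m (g : 'M[L]_m) : ct g *m J m *m g = J m -> unitaryG s g.
Proof.
move=> h; split=> //.
have h1 : (J m *m ct g *m J m) *m g = 1%:M.
  by rewrite -!mulmxA (mulmxA (ct g)) h antidiag_sqr.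
by case/mulmx1_unit: h1.
Qed.

Lemma unitaryG_mul m (g h : 'M[L]_m) : unitaryG s g -> unitaryG s h ->
  unitaryG s (g *m h).
Proof.
move=> [_ hg] [_ hh]; apply: unitaryG_of.
rewrite ctM -!mulmxA (mulmxA (ct g)) (mulmxA (ct g *m _)).
by rewrite -[ct g *m J m *m g]/(conjtr s g *m J m *m g) hg mulmxA.
Qed.

Lemma idem_factor m (P : 'M[L]_m) : P *m P = P ->
  row_base P *m col_base P = 1%:M.
Proof.
move=> PP.
apply: (row_free_inj (row_base_free P)); rewrite /= mul1mx.
apply: (row_full_inj (col_base_full P)).
by rewrite -[row_base P *m _ *m _]mulmxA mulmx_base mulmxA mulmx_base.
Qed.

Lemma mxtrace_idem m (P : 'M[L]_m) : P *m P = P -> \tr P = (\rank P)%:R.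
Proof.
by move=> PP; rewrite -{1}(mulmx_base P) mxtrace_mulC idem_factor// mxtrace1.
Qed.

(** x J is an involution, so P = (1 - x J) / 2 is idempotent. The characteristic polynomial gives
    its trace, and in characteristic zero the trace gives the rank (m - tr J) / 2, which is m / 2
    rounded down. A rank factorization P = W Z then yields C = Z J ct(Z). *)
Lemma hermitian_involution m r (x : 'M[L]_m) :
  (forall n, (0 < n)%N -> n%:R != 0 :> L) -> (0 < m)%N -> m./2 = r ->
  hermX s x ->
  exists (W : 'M[L]_(m, r)) (C : 'M[L]_r),
    x = J m - 2 *: (W *m C *m ct W) /\ C *m (ct W *m J m *m W) = 1%:M.
Proof.
move=> ch0 m0 hr [ux xs cp].
have n2 : (2 : L) != 0 by exact: ch0.
have sx : ct x = x := xs.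
have xJx : x *m J m *m x = J m by rewrite -{1}sx; case: ux.
pose P := 2^-1 *: (1%:M - x *m J m).
have AA : (x *m J m) *m (x *m J m) = 1%:M by rewrite mulmxA xJx antidiag_sqr.
have PP : P *m P = P.
  have e : (1%:M - x *m J m) *m (1%:M - x *m J m) = 2 *: (1%:M - x *m J m).
    by rewrite mulmxBl mul1mx mulmxBr mulmx1 AA opprB scaler_nat mulr2n.
  by rewrite /P -scalemxAl -scalemxAr e [_ *: (2 *: _)]scalerA mulVf// scale1r.
have rP : \rank P = r.
  have hn : (\rank P)%:R = r%:R :> L.
    rewrite -mxtrace_idem// /P mxtraceZ raddfB /= mxtrace1.
    have -> : \tr (x *m J m) = \tr (J m).
      by apply: oppr_inj; rewrite -!char_poly_trace// cp.
    rewrite mxtrace_antidiag -{1}(odd_double_half m) hr natrD addrAC subrr add0r.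
    by rewrite -muln2 natrM mulrC mulfK.
  apply/eqP; move/eqP: hn; have [h|h|->//] := ltngtP (\rank P) r.
    rewrite eq_sym -subr_eq0 -natrB ?(ltnW h)//.
    by move=> h'; have := ch0 (r - \rank P)%N; rewrite subn_gt0 h h' => /(_ isT).
  rewrite -subr_eq0 -natrB ?(ltnW h)//.
  by move=> h'; have := ch0 (\rank P - r)%N; rewrite subn_gt0 h h' => /(_ isT).
have [W [Z [WZ ZW]]] : exists (W : 'M[L]_(m, r)) (Z : 'M[L]_(r, m)),
    W *m Z = P /\ Z *m W = 1%:M.
  case: r / rP {hr}; exists (col_base P), (row_base P); split; first exact: mulmx_base.
  exact: idem_factor.
have s2 : s 2^-1 = 2^-1 by rewrite fmorphV rmorph_nat.
have PJ : P *m J m = 2^-1 *: (J m - x).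
  by rewrite /P -scalemxAl mulmxBl mul1mx -mulmxA antidiag_sqr mulmx1.
have PJh : ct (P *m J m) = P *m J m by rewrite PJ ctZ s2 ctB ct_antidiag sx.
have JP : J m *m ct P = P *m J m by rewrite -[RHS]PJh ctM ct_antidiag.
exists W, (Z *m J m *m ct Z); split.
  have -> : W *m (Z *m J m *m ct Z) *m ct W = P *m J m.
    rewrite !mulmxA WZ -!mulmxA -ctM WZ JP mulmxA PP //.
  by rewrite PJ scalerA divff// scale1r subKr.
rewrite !mulmxA -(mulmxA _ (ct Z)) -ctM WZ -(mulmxA Z) JP -!mulmxA.
by rewrite (mulmxA (J m)) antidiag_sqr mul1mx -WZ -!mulmxA ZW mulmx1 ZW.
Qed.

End ConjTranspose.

Definition low_ord (m i : nat) (hi : (i <= m)%N) (a : 'I_i) : 'I_m :=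
  cast_ord (subnK hi) (rshift (m - i) a).

Lemma lower_right_minorE (L : fieldType) (m i : nat) (hi : (i <= m)%N) (y : 'M[L]_m) :
  lower_right_minor hi y = \det (mxsub (low_ord hi) (low_ord hi) y).
Proof.
congr determinant; apply/matrixP => a b; rewrite !mxE castmxE !esymK.
by congr (y _ _); apply: val_inj.
Qed.

(** * Lower right minors and the cofactor vector *)

Section Minors.
Variables (L : fieldType) (s : {rmorphism L -> L}).
Hypothesis inv : involutive s.
Variables (m r : nat) (hr : m./2 = r.+1).
Local Notation ct := (ct s).
Local Notation J := (antidiag L m).

Lemma half_le_small : (r.+1 <= m)%N.
Proof. by rewrite -hr; apply: leq_trans (leq_addl (odd m) _) _; rewrite -{2}(odd_double_half m); lia. Qed.

Let hle1 : (r.+1 <= m)%N := half_le_small.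
Let hle : (r <= m)%N := ltnW hle1.

(** With i at most half of m, the last i rows and columns avoid the antidiagonal, so J contributes
    nothing to this block. *)
Lemma mxsub_herm (i : nat) (hi : (i <= m)%N) (Y : 'M[L]_(m, r.+1)) C :
  (i <= r.+1)%N ->
  mxsub (low_ord hi) (low_ord hi) (J - 2 *: (Y *m C *m ct Y)) =
  - 2 *: (rowsub (low_ord hi) Y *m C *m ct (rowsub (low_ord hi) Y)).
Proof.
move=> ir; apply/matrixP => a b; rewrite !mxE.
have -> : ((low_ord hi a : nat) + low_ord hi b == m.-1)%N = false.
  apply/negP => /eqP /=; have := odd_double_half m; rewrite hr.
  by have := ltn_ord a; have := ltn_ord b; lia.
rewrite sub0r mulNr; congr (- (_ * _)).
apply: eq_bigr => c _; rewrite !mxE; congr (_ * _).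
by apply: eq_bigr => d _; rewrite !mxE.
Qed.

Definition bot (Y : 'M[L]_(m, r.+1)) : 'M[L]_(r, r.+1) := rowsub (low_ord hle) Y.

(* Image under Y of the cofactor vector of its last r rows: it vanishes on these rows, and
   its hermitian norm is governed by the minor of order r. *)
Definition uvec (Y : 'M[L]_(m, r.+1)) (i : 'I_m) : L :=
  \det (col_mx (row i Y) (bot Y) : 'M[L]_(r.+1)).

(** The zero row is a placeholder: cofactors along the first row depend on [B] alone. *)
Definition xi (B : 'M[L]_(r, r.+1)) : 'cV[L]_(r.+1) :=
  \col_j cofactor (col_mx (0 : 'rV[L]_(r.+1)) B : 'M[L]_(r.+1)) ord0 j.

Let ord0_lshift : ord0 = lshift r ord0 :> 'I_(1 + r).
Proof. exact: val_inj. Qed.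

Let bcol (w : 'rV[L]_(r.+1)) (B : 'M[L]_(r, r.+1)) : 'M[L]_(r.+1) := col_mx w B.

Let bcolE0 w B j : bcol w B ord0 j = w ord0 j.
Proof.
exact: etrans (congr1 (fun i => (col_mx w B) i j) ord0_lshift) (col_mxEu w B ord0 j).
Qed.

Let bcolE1 w B a j : bcol w B (lift ord0 a) j = B a j.
Proof.
have e : lift ord0 a = rshift 1 a :> 'I_(1 + r) by apply: val_inj.
exact: etrans (congr1 (fun i => (col_mx w B) i j) e) (col_mxEd w B a j).
Qed.

Lemma mul_xi (B : 'M[L]_(r, r.+1)) (w : 'rV[L]_(r.+1)) :
  (w *m xi B) ord0 ord0 = \det (col_mx w B : 'M[L]_(r.+1)).
Proof.
rewrite (expand_det_row _ ord0) mxE; apply: eq_bigr => j _; congr (_ * _).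
  by rewrite [RHS]bcolE0.
rewrite mxE /cofactor; congr (_ * \det _); apply/matrixP => a b.
by rewrite 2![LHS]mxE 2![RHS]mxE [LHS]bcolE1 [RHS]bcolE1.
Qed.

Lemma uvecE Y i : uvec Y i = (Y *m xi (bot Y)) i ord0.
Proof.
rewrite /uvec -mul_xi !mxE; apply: eq_bigr => j _; by rewrite !mxE.
Qed.

Lemma det_row_dup (B : 'M[L]_(r, r.+1)) (a : 'I_r) :
  \det (col_mx (row a B) B : 'M[L]_(r.+1)) = 0.
Proof.
apply: (determinant_alternate (i1 := ord0) (i2 := lift ord0 a)) => // j.
by rewrite [LHS]bcolE0 [RHS]bcolE1 mxE.
Qed.

Lemma mul_bot_xi B : B *m xi B = 0.
Proof.
apply/colP => a; rewrite mxE [RHS]mxE.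
rewrite -[RHS](det_row_dup B a) -mul_xi !mxE; apply: eq_bigr => j _; by rewrite !mxE.
Qed.

Lemma uvec_low Y (i : 'I_m) : (m - r <= i)%N -> uvec Y i = 0.
Proof.
move=> hi; have hir : (i - (m - r) < r)%N by have := ltn_ord i; lia.
rewrite uvecE -[RHS](_ : (bot Y *m xi (bot Y)) (Ordinal hir) ord0 = 0); last first.
  by rewrite mul_bot_xi mxE.
rewrite !mxE; apply: eq_bigr => j _; rewrite !mxE; congr (Y _ _ * _).
by apply: val_inj => /=; lia.
Qed.

(** Row b sits just above the rows of [bot], so the last r + 1 rows of Y form the matrix whose
    determinant is [uvec Y b]. *)
Lemma minor_last (Y : 'M[L]_(m, r.+1)) C (b : 'I_m) : b = (m - r.+1)%N :> nat ->
  lower_right_minor hle1 (J - 2 *: (Y *m C *m ct Y)) =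
  (- 2) ^+ r.+1 * \det C * (uvec Y b * s (uvec Y b)).
Proof.
move=> hb; rewrite lower_right_minorE mxsub_herm// detZ !det_mulmx det_ct.
have -> : \det (rowsub (low_ord hle1) Y) = uvec Y b.
  congr determinant; apply/matrixP => a c; rewrite mxE.
  case: (unliftP ord0 a) => [a'|] ->.
    rewrite [RHS]bcolE1 mxE; congr (Y _ _); apply: val_inj.
    by rewrite /= /bump /=; have := hle1; lia.
  rewrite [RHS]bcolE0 mxE; congr (Y _ _).
  by apply: val_inj; rewrite /= hb addn0.
by ring.
Qed.

Let mul_row1 (c : 'M[L]_1) (w : 'rV[L]_(r.+1)) : c != 0 -> c *m w = 0 -> w = 0.
Proof.
rewrite {1 2}[c]mx11_scalar mul_scalar_mx => c0 /eqP.
by rewrite scaler_eq0 => /orP[/eqP h|/eqP //]; rewrite h raddf0 eqxx in c0.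
Qed.

(** Border B by the row ze = ct(xi) M, which is orthogonal to B for the form C. The Gram matrix of
    the bordered square matrix T is then block triangular with determinant eta det(B C ct(B)); it
    also equals det T det C s(det T), and det T = eta. *)
Lemma det_bordered (B : 'M[L]_(r, r.+1)) (C M : 'M[L]_(r.+1)) :
  ct M = M -> M *m C = 1%:M -> \det (B *m C *m ct B) != 0 ->
  let eta := (ct (xi B) *m M *m xi B) ord0 ord0 in
  eta != 0 /\ eta * \det C = \det (B *m C *m ct B).
Proof.
move=> hM hMC hQ eta; pose ze := ct (xi B) *m M.
have zeC : ze *m C = ct (xi B) by rewrite -mulmxA hMC mulmx1.
have zeCB : ze *m C *m ct B = 0 by rewrite zeC -ctM mul_bot_xi ct0.
have hC : ct C = C.
  have CM := mulmx1C hMC.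
  have h : ct C *m M = 1%:M by rewrite -{1}hM -ctM hMC ct1.
  by rewrite -[LHS]mulmx1 -hMC mulmxA h mul1mx.
have etaE : ze *m xi B = eta%:M by rewrite [LHS]mx11_scalar.
have seta : s eta = eta.
  rewrite -[LHS]/(s _) -ctE !ctM ctK// hM mulmxA; done.
have inj1 (c1 : 'rV[L]_r) : c1 *m (B *m C *m ct B) = 0 -> c1 = 0.
  move=> h; apply/eqP; apply: contraNT hQ => c1n; apply/eqP/eqP/det0P.
  by exists c1.
have detT : \det (col_mx ze B : 'M[L]_(r.+1)) = eta by rewrite -mul_xi.
have eta0 : eta != 0.
  (* If eta = 0 the rows of the bordered matrix are dependent. Nondegeneracy on B kills the
     coefficients of B, so ze = 0 and xi vanishes. Then every square matrix with B below is
     singular, and the same argument contradicts this for a nonzero row w orthogonal to B. *)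
  apply/eqP => e0; have xi0 : xi B = 0.
    have /det0P[c cn0] : \det (col_mx ze B : 'M[L]_(r.+1)) == 0 by rewrite detT e0.
    rewrite -[c](@hsubmxK _ 1 1 r) => hc; move: hc cn0.
    set c0 := lsubmx _; set c1 := rsubmx _.
    rewrite (@mul_row_col _ 1 1 r) => hc cn0.
    have c10 : c1 = 0.
      apply: inj1; rewrite !mulmxA.
      have : (c0 *m ze + c1 *m B) *m C *m ct B = 0 by rewrite hc !mul0mx.
      by rewrite !mulmxDl -2!mulmxA (mulmxA ze) zeCB mulmx0 add0r.
    have c0n : c0 != 0 
      by apply: contraNneq cn0 => c00;
        rewrite -[c](@hsubmxK _ 1 1 r) -/c0 -/c1 c00 c10 row_mx0.
    have ze0 : ze = 0 by apply: (mul_row1 c0n); rewrite -hc c10 mul0mx addr0.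
    by rewrite -[xi B](ctK inv) -zeC ze0 mul0mx ct0.
  have [w wn0 hw] : exists2 w : 'rV[L]_(r.+1), w != 0 & w *m (C *m ct B) = 0.
    have : kermx (C *m ct B) != 0.
      rewrite -mxrank_eq0 mxrank_ker -lt0n subn_gt0 ltnS.
      exact: rank_leq_col.
    move=> /rowV0Pn[w /sub_kermxP hw wn0]; by exists w.
  have : \det (col_mx w B : 'M[L]_(r.+1)) == 0 by rewrite -mul_xi xi0 mulmx0 mxE.
  move=> /det0P[c cn0]; rewrite -[c](@hsubmxK _ 1 1 r) => hc; move: hc cn0.
  set c0 := lsubmx _; set c1 := rsubmx _.
  rewrite (@mul_row_col _ 1 1 r) => hc cn0.
  have c10 : c1 = 0.
    apply: inj1; have : (c0 *m w + c1 *m B) *m (C *m ct B) = 0 by rewrite hc !mul0mx.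
    by rewrite mulmxDl -mulmxA hw mulmx0 add0r !mulmxA.
  have c0n : c0 != 0 
      by apply: contraNneq cn0 => c00;
        rewrite -[c](@hsubmxK _ 1 1 r) -/c0 -/c1 c00 c10 row_mx0.
  by case/eqP: wn0; apply: (mul_row1 c0n); rewrite -hc c10 mul0mx addr0.
split=> //; apply: (mulfI eta0).
have : \det ((col_mx ze B : 'M[L]_(r.+1)) *m C *m ct (col_mx ze B : 'M[L]_(r.+1))) =
    eta * \det (B *m C *m ct B).
  have -> : ct (col_mx ze B : 'M[L]_(r.+1)) = row_mx (ct ze) (ct B) :> 'M[L]_(r.+1, 1 + r).
    exact: etrans (congr1 trmx (map_col_mx s ze B)) (tr_col_mx _ _).
  have -> : (col_mx ze B : 'M[L]_(r.+1)) *m C *m row_mx (ct ze) (ct B) =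
     block_mx (ze *m C *m ct ze) 0 (B *m C *m ct ze) (B *m C *m ct B) :> 'M[L]_(1 + r).
    have e1 := congr1 (fun A => A *m row_mx (ct ze) (ct B)) (mul_col_mx ze B C).
    have e2 := mul_col_row (ze *m C) (B *m C) (ct ze) (ct B).
    by rewrite zeCB in e2; exact: etrans e1 e2.
  rewrite [LHS](det_lblock (ze *m C *m ct ze) (B *m C *m ct ze) (B *m C *m ct B)).
  congr (_ * _); rewrite det_mx11 zeC -ctM etaE /ct.
  by rewrite map_scalar_mx tr_scalar_mx seta mxE eqxx.
by rewrite !det_mulmx det_ct detT seta => <-; ring.
Qed.

End Minors.

(** * Elementary elements of K *)

Section MiddleBlock.
Variables (L : fieldType) (v : L -> int) (s : {rmorphism L -> L}).
Hypotheses (hv : normalized_valuation v) (inv : involutive s).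
Hypothesis vs : forall N x, vge v N (s x) = vge v N x.
Variables (m r : nat) (hr : m./2 = r.+1).
Local Notation ct := (ct s).
Local Notation J := (antidiag L m).
Local Notation K := (integralK s v (m := m)).

Let m_eq : m = (odd m + r.+1.*2)%N.
Proof. by rewrite -hr odd_double_half. Qed.

Let ltA : (r < m)%N. Proof. by rewrite m_eq; lia. Qed.
Let ltB : (m - r.+1 < m)%N. Proof. by rewrite m_eq; lia. Qed.
Let ltC : (r.+1 < m)%N. Proof. by rewrite m_eq; lia. Qed.

(** Positions of a, b and c. Reversal exchanges [ia] and [ib], and it fixes [ic] for odd m. For even
    m the index [ic] coincides with [ib], and [uc] is set to 0. *)
Definition ia : 'I_m := Ordinal ltA.
Definition ib : 'I_m := Ordinal ltB.
Definition ic : 'I_m := Ordinal ltC.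

Lemma rev_ia : rev_ord ia = ib. Proof. exact: val_inj. Qed.
Lemma rev_ib : rev_ord ib = ia. Proof. by rewrite -rev_ia rev_ordK. Qed.
Lemma rev_ic : odd m -> rev_ord ic = ic.
Proof. by move=> om; apply: val_inj => /=; move: m_eq; rewrite om; lia. Qed.
Lemma ia_neq_ib : ia != ib.
Proof. by apply/eqP => /(congr1 val) /=; have := m_eq; lia. Qed.
Lemma ic_neq_ia : ic != ia.
Proof. by apply/eqP => /(congr1 val) /=; lia. Qed.
Lemma ic_neq_ib : odd m -> ic != ib.
Proof. by move=> om; apply/eqP => /(congr1 val) /=; move: m_eq; rewrite om; lia. Qed.

Lemma integralK_mul (g h : 'M[L]_m) : K g -> K h -> K (g *m h).
Proof.
move=> [ug ig] [uh ih]; split; first exact: unitaryG_mul.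
by move=> i j; rewrite mxE; apply: vge_sum => // l _; apply: vgeMr.
Qed.

Lemma mulmx_antidiag n (A : 'M[L]_(n, m)) i j : (A *m J) i j = A i (rev_ord j).
Proof.
rewrite mxE (bigD1 (rev_ord j))//= antidiagE rev_ordK eqxx mulr1 big1 ?addr0// => l hl.
by rewrite antidiagE (can2_eq rev_ordK rev_ordK) (negPf hl) mulr0.
Qed.

Lemma integralK_inv (g : 'M[L]_m) : K g -> exists2 g', K g' & g' *m g = 1%:M /\ g *m g' = 1%:M.
Proof.
move=> [ug ig]; have [_ h] := ug; have h' := unitaryG_inv ug.
have h1 : (J *m ct g *m J) *m g = 1%:M.
  by rewrite -!mulmxA (mulmxA (ct g)) -[ct g *m J *m g]/(conjtr s g *m J *m g)
     h antidiag_sqr.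
exists (J *m ct g *m J); last by split=> //; exact: mulmx1C.
split.
  apply: unitaryG_of; rewrite !ctM ct_antidiag ctK//.
  have -> : J *m (g *m J) *m J *m (J *m ct g *m J) =
      J *m (g *m (J *m J) *m J *m ct g) *m J by rewrite !mulmxA.
  by rewrite antidiag_sqr mulmx1 h' antidiag_sqr mul1mx.
by move=> i j; rewrite mulmx_antidiag mul_antidiag ctE vs.
Qed.

Implicit Type Y : 'M[L]_(m, r.+1).

Definition ua Y := uvec hr Y ia.
Definition ub Y := uvec hr Y ib.
Definition uc Y := if odd m then uvec hr Y ic else 0.

(** The vector vanishes on its last r coordinates, so the antidiagonal form pairs each outer
    coordinate with a zero and only the middle block is left. *)
Lemma form_uvec Y :
  (ct (xi (bot hr Y)) *m (ct Y *m J *m Y) *m xi (bot hr Y)) ord0 ord0 =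
  hform s (ua Y) (uc Y) (ub Y).
Proof.
have -> : ct (xi (bot hr Y)) *m (ct Y *m J *m Y) *m xi (bot hr Y) =
  ct (Y *m xi (bot hr Y)) *m (J *m (Y *m xi (bot hr Y))) by rewrite ctM !mulmxA.
rewrite mxE; under eq_bigr do rewrite ctE mul_antidiag -!uvecE.
rewrite (bigD1 ia)//= (bigD1 ib) ?(eq_sym ib) ?ia_neq_ib//= rev_ia rev_ib.
rewrite -/(ua Y) -/(ub Y) addrA /hform [s (ua Y) * ub Y + _]addrC [s (ub Y) * _]mulrC.
congr (_ + _); rewrite /uc.
have zero (i : 'I_m) : (i < r)%N || (m - r <= i)%N -> s (uvec hr Y i) * uvec hr Y (rev_ord i) = 0.
  move=> /orP[h|h]; last by rewrite (uvec_low hr Y h) rmorph0 mul0r.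
  by rewrite [X in _ * X](uvec_low hr Y) ?mulr0//=; lia.
case: ifPn => om.
  rewrite (bigD1 ic) ?ic_neq_ia ?ic_neq_ib//= rev_ic// big1 ?addr0 1?mulrC//.
  move=> i /andP[/andP[ha hb] hc]; apply: zero.
  move: ha hb hc; rewrite -!val_eqE /=; have := m_eq; rewrite om; lia.
rewrite mul0r big1// => i /andP[ha hb]; apply: zero.
by move: ha hb; rewrite -!val_eqE /=; have := m_eq; rewrite (negPf om); lia.
Qed.

(** Such an h leaves the last r rows of Y unchanged, hence also their cofactor vector, so it acts
    linearly on the image of that vector. *)
Lemma bot_fixed (h : 'M[L]_m) Y :
  (forall i j : 'I_m, (m - r <= i)%N -> h i j = (i == j)%:R) ->
  forall (i : 'I_m), uvec hr (h *m Y) i = \sum_j h i j * uvec hr Y j.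
Proof.
move=> hh i.
have -> : uvec hr (h *m Y) i = (h *m (Y *m xi (bot hr Y))) i ord0.
  rewrite uvecE mulmxA; congr ((_ *m xi _) _ _).
  apply/matrixP => a j; rewrite !mxE (bigD1 (low_ord (ltnW (half_le_small hr)) a))//=.
  rewrite hh ?leq_addr// eqxx mul1r big1 ?addr0// => l hl.
  by rewrite hh ?leq_addr// eq_sym (negPf hl) mul0r.
by rewrite mxE; apply: eq_bigr => j _; rewrite uvecE.
Qed.

Lemma rowsub_fixed (h : 'M[L]_m) Y (i : nat) (hi : (i <= m)%N) : (i <= r)%N ->
  (forall i j : 'I_m, (m - r <= i)%N -> h i j = (i == j)%:R) ->
  rowsub (low_ord hi) (h *m Y) = rowsub (low_ord hi) Y.
Proof.
move=> ir hh; apply/matrixP => a j; rewrite !mxE (bigD1 (low_ord hi a))//=.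
have ha : (m - r <= low_ord hi a)%N by rewrite /=; lia.
rewrite hh// eqxx mul1r big1 ?addr0// => l hl.
by rewrite hh// eq_sym (negPf hl) mul0r.
Qed.

Definition middle_action (h : 'M[L]_m) (fa fc fb : L -> L -> L -> L) : Prop :=
  [/\ K h, forall Y, [/\ ua (h *m Y) = fa (ua Y) (uc Y) (ub Y),
        uc (h *m Y) = fc (ua Y) (uc Y) (ub Y) & ub (h *m Y) = fb (ua Y) (uc Y) (ub Y)] &
     forall Y i (hi : (i <= m)%N), (i <= r)%N ->
       rowsub (low_ord hi) (h *m Y) = rowsub (low_ord hi) Y].

Lemma exists_swap : exists h, middle_action h (fun _ _ b => b) (fun _ c _ => c)
  (fun a _ _ => a).
Proof.
pose h : 'M[L]_m := \matrix_(i, j) (tperm ia ib i == j)%:R.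
have hfix (i j : 'I_m) : (m - r <= i)%N -> h i j = (i == j)%:R.
  move=> hi; rewrite mxE tpermD//.
    by rewrite -val_eqE /=; have := m_eq; lia.
  by rewrite -val_eqE /=; have := m_eq; lia.
have hmul n (A : 'M[L]_(m, n)) i j : (h *m A) i j = A (tperm ia ib i) j.
  rewrite mxE (bigD1 (tperm ia ib i))//= mxE eqxx mul1r big1 ?addr0// => l hl.
  by rewrite mxE eq_sym (negPf hl) mul0r.
have hct : ct h = h.
  apply/matrixP => i j; rewrite ctE !mxE rmorph_nat.
  by rewrite (can2_eq (tpermK ia ib) (tpermK ia ib)) eq_sym.
have revt i : rev_ord (tperm ia ib i) = tperm ia ib (rev_ord i).
  case: tpermP => [->|->|hA hB]; rewrite ?rev_ia ?rev_ib ?tpermL ?tpermR//.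
  rewrite tpermD//; first by rewrite -rev_ib (inj_eq rev_ord_inj) eq_sym; apply/eqP.
  by rewrite -rev_ia (inj_eq rev_ord_inj) eq_sym; apply/eqP.
exists h; split; last 2 first.
- move=> Y; have hu := bot_fixed Y hfix.
  have hu' i : uvec hr (h *m Y) i = uvec hr Y (tperm ia ib i).
    rewrite hu (bigD1 (tperm ia ib i))//= mxE eqxx mul1r big1 ?addr0// => l hl.
    by rewrite mxE eq_sym (negPf hl) mul0r.
  split; rewrite /ua /ub /uc ?hu' ?tpermL ?tpermR//.
  case: ifPn => // om; rewrite tpermD// eq_sym; [exact: ic_neq_ia|exact: ic_neq_ib].
- by move=> Y i hi ir; exact: rowsub_fixed.
split.
  apply: unitaryG_of; rewrite hct; apply/matrixP => i j.
  rewrite -mulmxA hmul mul_antidiag mxE antidiagE revt.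
  by rewrite tpermK.
by move=> i j; rewrite mxE; case: eqP => _; rewrite ?vge1.
Qed.

(** A unipotent 1 + X supported on the middle block. In the unitarity relation all terms cancel
    except at position (ia, ia), where the condition on ga appears. For even m there is no middle
    coordinate to move, hence be = 0. *)
Lemma exists_translation be ga : (~~ odd m -> be = 0) ->
  ga + s ga + be * s be = 0 -> vge v 0 be -> vge v 0 ga ->
  exists h, middle_action h (fun a _ _ => a) (fun a c _ => c + be * a)
    (fun a c b => b - s be * c + ga * a).
Proof.
move=> hbe hga be0 ga0.
pose D i j : 'M[L]_m := delta_mx i j.
pose X := be *: D ic ia - s be *: D ib ic + ga *: D ib ia.
pose h : 'M[L]_m := 1%:M + X.
have XE i j : X i j = be * ((i == ic) && (j == ia))%:R -
    s be * ((i == ib) && (j == ic))%:R + ga * ((i == ib) && (j == ia))%:R.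
  by rewrite !mxE.
have be_odd : odd m \/ be = 0.
  by case: (boolP (odd m)) => [|/hbe]; [left|right].
have hfix (i j : 'I_m) : (m - r <= i)%N -> h i j = (i == j)%:R.
  move=> hi; rewrite mxE XE.
  have -> : (i == ib) = false.
    by apply/eqP => /(congr1 val) /= e; have := m_eq; lia.
  rewrite /= !mulr0 subr0 addr0; case: be_odd => [om|->]; last by rewrite mul0r addr0 !mxE.
  have -> : (i == ic) = false.
    by apply/eqP => /(congr1 val) /= e; have := m_eq; rewrite om; lia.
  by rewrite mulr0 addr0 !mxE.
have JD i j : J *m D i j = D (rev_ord i) j.
  by apply/matrixP => a b; rewrite mul_antidiag !mxE (can2_eq rev_ordK rev_ordK).
have uni : unitaryG s h.
  apply: unitaryG_of.
  have sbe0 : s be * be = be * s be by rewrite mulrC.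
  have ctX : ct X = s be *: D ia ic - be *: D ic ib + s ga *: D ia ib.
    by rewrite /X !(ctB, ctD, ctZ, ct_delta) inv.
  have JX : J *m X = be *: D (rev_ord ic) ia - s be *: D ia ic + ga *: D ia ia.
    by rewrite /X mulmxDr mulmxBr -!scalemxAr !JD rev_ib.
  have XJ : ct X *m J = ct (J *m X) by rewrite ctM ct_antidiag.
  suff e : J *m X + ct (J *m X) + ct X *m (J *m X) = 0.
    rewrite /h ctD ct1 [(_ + _) *m J]mulmxDl mul1mx mulmxDl.
    rewrite (mulmxDr J 1%:M X) (mulmxDr (ct X *m J) 1%:M X) !mulmx1.
    by rewrite -(mulmxA (ct X)) XJ -[RHS]addr0 -e !addrA.
  rewrite JX ctX !(ctB, ctD, ctZ, ct_delta) inv.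
  case: be_odd => [om|b0].
    rewrite rev_ic// !(mulmxDl, mulmxDr, mulmxBl, mulmxBr, mulNmx, mulmxN).
    rewrite -!scalemxAl -!scalemxAr !mul_delta_mx_cond !eqxx.
    have ba : (ib == ia) = false by rewrite eq_sym (negPf ia_neq_ib).
    have bc : (ib == ic) = false by rewrite eq_sym (negPf (ic_neq_ib om)).
    rewrite (negPf ic_neq_ia) ba bc.
    rewrite !mulr1n !mulr0n.
    apply/matrixP => i j; rewrite !mxE.
    apply: (etrans _ (mul0r ((i == ia) && (j == ia))%:R)); rewrite -[in RHS]hga.
    by ring.
  move: hga; rewrite b0 rmorph0 mul0r addr0 => hga0.
  rewrite !scale0r !subr0 !add0r.
  rewrite -!scalemxAl -!scalemxAr !mul_delta_mx_cond.
  rewrite (eq_sym ib) (negPf ia_neq_ib) mulr0n !scaler0 addr0 -scalerDl hga0.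
  by rewrite scale0r.
exists h; split.
- split=> // i j; rewrite mxE XE; apply: vgeD => //.
    by rewrite mxE; case: eqP => _; rewrite ?vge1.
  have nat_int (b : bool) : vge v 0 b%:R by case: b; rewrite ?vge1.
  apply: vgeD => //; last by apply: vgeMr.
  by apply: vgeB => //; apply: vgeMr => //; rewrite vs.
- move=> Y; have hu := bot_fixed Y hfix.
  have hu' i : uvec hr (h *m Y) i = uvec hr Y i + be * (i == ic)%:R * uvec hr Y ia
      - s be * (i == ib)%:R * uvec hr Y ic + ga * (i == ib)%:R * uvec hr Y ia.
    have sum1 (f : 'I_m -> L) (i0 : 'I_m) : \sum_j (j == i0)%:R * f j = f i0.
      rewrite (bigD1 i0)//= eqxx mul1r big1 ?addr0// => j hj.
      by rewrite (negPf hj) mul0r.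
    rewrite hu; transitivity (\sum_j ((j == i)%:R * uvec hr Y j
        + be * (i == ic)%:R * ((j == ia)%:R * uvec hr Y j)
        - s be * (i == ib)%:R * ((j == ic)%:R * uvec hr Y j)
        + ga * (i == ib)%:R * ((j == ia)%:R * uvec hr Y j))).
      apply: eq_bigr => j _; rewrite mxE XE mxE -!mulnb !natrM (eq_sym i j); ring.
    by rewrite !(big_split, sumrN) /= -!mulr_sumr !sum1.
  have nab := ia_neq_ib; have nca := ic_neq_ia.
  have ubE : ub (h *m Y) = ub Y - s be * uvec hr Y ic + ga * ua Y.
    rewrite /ub hu' eqxx !mulr1.
    have -> : be * (ib == ic)%:R = 0.
      case: be_odd => [om|->]; last by rewrite mul0r.
      by rewrite eq_sym (negPf (ic_neq_ib om)) mulr0.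
    by rewrite mul0r addr0.
  split.
  + by rewrite /ua hu' (negPf nab) eq_sym (negPf nca) !mulr0 !mul0r subr0 !addr0.
  + rewrite /uc; case: ifPn => om; last by rewrite hbe// mul0r addr0.
    by rewrite hu' eqxx (negPf (ic_neq_ib om)) mulr1 !mulr0 !mul0r subr0 addr0.
  + rewrite ubE /uc; case: ifPn => // om.
    by rewrite hbe// rmorph0 !mul0r.
- by move=> Y i hi ir; exact: rowsub_fixed.
Qed.

End MiddleBlock.

(** * Integration over K *)

Section BoundedIntegral.
Context d (T : measurableType d) (R : realType).
Variable mu : {measure set T -> \bar R}.

Lemma integrable_bounded (D : set T) (f : T -> R) (B : R) :
  measurable D -> (mu D < +oo)%E -> measurable_fun D f ->
  (forall x, D x -> `|f x| <= B) -> mu.-integrable D (EFin \o f).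
Proof.
move=> mD fD mf hB; apply: measurable_bounded_integrable => //.
exists B; split; first exact: num_real.
by move=> y By x Dx /=; apply: le_trans (hB x Dx) (ltW By).
Qed.

Lemma Rintegral_le_bound (D : set T) (f : T -> R) (B : R) :
  measurable D -> (mu D < +oo)%E -> measurable_fun D f ->
  (forall x, D x -> `|f x| <= B) -> `|\int[mu]_(x in D) f x| <= B * fine (mu D).
Proof.
move=> mD fD mf hB; have If := integrable_bounded mD fD mf hB.
apply: le_trans (le_normr_Rintegral mD If) _.
rewrite -Rintegral_cst//; apply: le_Rintegral => //.
- apply: (@integrable_bounded _ _ B) => //; first exact: measurableT_comp.
  by move=> x Dx; rewrite normr_id; exact: hB.
- by apply: (@integrable_bounded _ _ `|B|) => //.
Qed.

(** Used for functions of valuations, whose values form a countable key: measurability reduces to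
    that of the fibres of the key. *)
Lemma measurable_fun_key (I : countType) d' (U : measurableType d') (key : T -> I)
    (D : set T) (f : T -> U) (h : I -> U) :
  (forall i, measurable (D `&` [set x | key x = i])) ->
  (forall x, D x -> f x = h (key x)) -> measurable_fun D f.
Proof.
move=> mk fh mD Y mY.
have -> : D `&` f @^-1` Y =
    \bigcup_(i : I) (if `[< Y (h i) >] then D `&` [set x | key x = i] else set0).
  apply/seteqP; split=> x /=.
    move=> [Dx Yx]; exists (key x) => //.
    by rewrite -fh// ifT//; exact/asboolP.
  move=> [i _]; case: ifPn => // /asboolP Yi [Dx ki]; split=> //.
  by rewrite fh// ki.
apply: countable_bigcupT_measurable; first exact: countableP.
by move=> i; case: ifP.
Qed.

Lemma Rintegral_strata (I : countType) (key : T -> I) (D : set T) (f g : T -> R) (B : R) :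
  measurable D -> (mu D < +oo)%E -> measurable_fun D f -> measurable_fun D g ->
  (forall x, D x -> `|f x| <= B) -> (forall x, D x -> `|g x| <= B) ->
  (forall i, measurable (D `&` [set x | key x = i])) ->
  (forall i, \int[mu]_(x in D `&` [set x | key x = i]) f x =
             \int[mu]_(x in D `&` [set x | key x = i]) g x) ->
  \int[mu]_(x in D) f x = \int[mu]_(x in D) g x.
Proof.
move=> mD fD mf mg hf hg mk hi.
(* Fibres are enumerated through [unpickle]; the test on [pickle] retains a single code for each
   fibre, which makes the sets disjoint. *)
pose F (n : nat) : set T :=
  if (unpickle n : option I) is Some i then
    if pickle i == n then D `&` [set x | key x = i] else set0 else set0.
have mF n : measurable (F n).
  by rewrite /F; case: unpickle => // i; case: ifP.
have FD : \bigcup_n F n = D.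
  apply/seteqP; split=> x.
    by move=> [n _]; rewrite /F; case: unpickle => // i; case: ifP => // _ [].
  move=> Dx; exists (pickle (key x)) => //; rewrite /F pickleK eqxx//.
have tF : trivIset [set: nat] F.
  apply/trivIsetP => n1 n2 _ _ n12; apply/seteqP; split=> // x [].
  rewrite /F; case: unpickle => // i1; case: eqP => // e1 [_ /= k1].
  case: unpickle => // i2; case: eqP => // e2 [_ /= k2].
  by case/eqP: n12; rewrite -e1 -e2 -k1 -k2.
have fE (h : T -> R) : mu.-integrable D (EFin \o h) -> forall n,
    (\int[mu]_(x in F n) (h x)%:E)%E = (\int[mu]_(x in F n) h x)%:E.
  move=> Ih n; rewrite /Rintegral fineK//; apply: integrable_fin_num => //.
  apply: integrableS Ih => //; rewrite -FD; exact: bigcup_sup.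
have If := integrable_bounded mD fD mf hf.
have Ig := integrable_bounded mD fD mg hg.
congr fine; rewrite -FD !integral_bigcup//; try by rewrite FD.
apply: eq_eseriesr => n _; rewrite !fE//; congr EFin.
rewrite /F; case: unpickle => [i|]; last by rewrite !Rintegral_set0.
by case: ifP => _; rewrite ?Rintegral_set0// hi.
Qed.

End BoundedIntegral.

(** * Continuity and Borel sets of matrices *)

Section Continuity.
Variables (L : fieldType) (v : L -> int) (s : {rmorphism L -> L}).
Hypothesis hv : normalized_valuation v.
Hypothesis vs : forall N x, vge v N (s x) = vge v N x.
Variable m : nat.
Implicit Types f : 'M[L]_m -> L.

Definition vcont f := forall N (g0 : 'M[L]_m), exists M, forall g : 'M[L]_m,
  (forall i j, vge v M (g i j - g0 i j)) -> vge v N (f g - f g0).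

Lemma vcont_cst c : vcont (fun=> c).
Proof. by move=> N g0; exists 0 => g _; rewrite subrr. Qed.

Lemma vcont_entry i j : vcont (fun g : 'M[L]_m => g i j).
Proof. by move=> N g0; exists N => g. Qed.

Let vcont2 f1 f2 N1 N2 (g0 : 'M[L]_m) : vcont f1 -> vcont f2 -> exists M, forall g : 'M[L]_m,
  (forall i j, vge v M (g i j - g0 i j)) ->
  vge v N1 (f1 g - f1 g0) /\ vge v N2 (f2 g - f2 g0).
Proof.
move=> h1 h2; have [M1 H1] := h1 N1 g0; have [M2 H2] := h2 N2 g0.
exists (Num.max M1 M2) => g hg; split; [apply: H1|apply: H2] => i j;
  by apply: vge_le (hg i j); rewrite le_max lexx ?orbT.
Qed.

Lemma vcontD f1 f2 : vcont f1 -> vcont f2 -> vcont (fun g => f1 g + f2 g).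
Proof.
move=> h1 h2 N g0; have [M hM] := vcont2 N N g0 h1 h2; exists M => g /hM[k1 k2].
by rewrite opprD addrACA; apply: vgeD.
Qed.

Lemma vcontM f1 f2 : vcont f1 -> vcont f2 -> vcont (fun g => f1 g * f2 g).
Proof.
move=> h1 h2 N g0.
pose P := (`|N| + `|v (f1 g0)| + `|v (f2 g0)|)%N.
have [M hM] := vcont2 P%:Z P%:Z g0 h1 h2; exists M => g /hM[k1 k2].
rewrite (_ : _ - _ = (f1 g - f1 g0) * (f2 g - f2 g0) + (f1 g - f1 g0) * f2 g0 +
   f1 g0 * (f2 g - f2 g0)); last by ring.
apply: vgeD => //; [apply: vgeD => //|].
- by apply: vge_le (vgeM hv k1 k2); rewrite /P; lia.
- by apply: vge_le (vgeM hv k1 (vge_val v (f2 g0))); rewrite /P; lia.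
- by apply: vge_le (vgeM hv (vge_val v (f1 g0)) k2); rewrite /P; lia.
Qed.

Lemma vcontS f : vcont f -> vcont (fun g => s (f g)).
Proof.
by move=> h N g0; have [M hM] := h N g0; exists M => g /hM; rewrite -rmorphB vs.
Qed.

Lemma vcont_sum (I : Type) (r : seq I) (P : pred I) (F : I -> 'M[L]_m -> L) :
  (forall i, vcont (F i)) -> vcont (fun g => \sum_(i <- r | P i) F i g).
Proof.
move=> h; elim: r => [|i r IH] N g0.
  by exists 0 => g _; rewrite !big_nil subrr.
have [Pi|nPi] := boolP (P i); last first.
  have [M hM] := IH N g0; exists M => g /hM; by rewrite !big_cons (negPf nPi).
have [M hM] := vcontD (h i) IH N g0; exists M => g /hM; by rewrite !big_cons Pi.
Qed.

Lemma vcont_prod (I : Type) (r : seq I) (F : I -> 'M[L]_m -> L) :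
  (forall i, vcont (F i)) -> vcont (fun g => \prod_(i <- r) F i g).
Proof.
move=> h; elim: r => [|i r IH] N g0.
  by exists 0 => g _; rewrite !big_nil subrr.
have [M hM] := vcontM (h i) IH N g0; exists M => g /hM; by rewrite !big_cons.
Qed.

Definition vcont_mx (a b : nat) (F : 'M[L]_m -> 'M[L]_(a, b)) :=
  forall i j, vcont (fun g => F g i j).

Lemma vcont_ext f1 f2 : f1 =1 f2 -> vcont f1 -> vcont f2.
Proof.
by move=> e h N g0; have [M hM] := h N g0; exists M => g /hM; rewrite !e.
Qed.

Lemma vcont_mulmx (a b c : nat) (F : 'M[L]_m -> 'M[L]_(a, b)) (G : 'M[L]_m -> 'M[L]_(b, c)) :
  vcont_mx F -> vcont_mx G -> vcont_mx (fun g => F g *m G g).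
Proof.
move=> hF hG i j; apply: (vcont_ext (f1 := fun g => \sum_l F g i l * G g l j)).
  by move=> g; rewrite mxE.
by apply: vcont_sum => l; apply: vcontM.
Qed.

Lemma vcont_ct (a b : nat) (F : 'M[L]_m -> 'M[L]_(a, b)) :
  vcont_mx F -> vcont_mx (fun g => ct s (F g)).
Proof.
move=> hF i j; apply: (vcont_ext (f1 := fun g => s (F g j i))).
  by move=> g; rewrite ctE.
exact: vcontS.
Qed.

Lemma vcont_det (a : nat) (F : 'M[L]_m -> 'M[L]_a) :
  vcont_mx F -> vcont (fun g => \det (F g)).
Proof.
move=> hF; apply: vcont_sum => p; apply: vcontM; first exact: vcont_cst.
by apply: vcont_prod => i; exact: hF.
Qed.

Lemma vcont_id : vcont_mx id. Proof. by move=> i j; exact: vcont_entry. Qed.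

Lemma vcont_cstmx a b (A : 'M[L]_(a, b)) : vcont_mx (fun=> A).
Proof. by move=> i j; exact: vcont_cst. Qed.

Lemma measurable_vge f N : vcont f ->
  measurable ([set g | vge v N (f g)] : set (borel_mx v m)).
Proof.
move=> hf; apply: sub_sigma_algebra => g0 /= h0; have [M hM] := hf N g0.
exists M => g /hM; by rewrite (vgeDl hv)// vgeN.
Qed.

Lemma measurable_fun_mull (h : 'M[L]_m) :
  measurable_fun setT ((fun g : borel_mx v m => h *m (g : 'M[L]_m)) : _ -> borel_mx v m).
Proof.
pose f : borel_mx v m -> borel_mx v m := fun g => h *m (g : 'M[L]_m).
apply: (@measurability _ _ (borel_mx v m) (borel_mx v m) setT f (@mx_open L v m)) => //.
move=> _ [U oU <-]; rewrite setTI; apply: sub_sigma_algebra => g0 /= h0.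
have [N hN] := oU _ h0.
have /fin_all_exists[M hM] : forall ij : 'I_m * 'I_m, exists M, forall g : 'M[L]_m,
    (forall i j, vge v M (g i j - g0 i j)) ->
    vge v N ((h *m g) ij.1 ij.2 - (h *m g0) ij.1 ij.2).
  by move=> ij; apply: (vcont_mulmx (vcont_cstmx h) vcont_id).
exists (\sum_ij `|M ij|%N)%:Z => g hg; apply: hN => i j.
apply: (hM (i, j)) => i' j'; apply: vge_le (hg i' j').
have : (`|M (i, j)| <= \sum_ij `|M ij|)%N by rewrite (bigD1 (i, j))//= leq_addr.
lia.
Qed.

Lemma measurable_eq0 f : vcont f ->
  measurable ([set g | f g = 0] : set (borel_mx v m)).
Proof.
move=> hf.
have -> : [set g | f g = 0] = \bigcap_(N : nat) [set g : borel_mx v m | vge v N%:Z (f g)].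
  apply/seteqP; split=> g /=; first by move=> f0 N _ /=; rewrite f0.
  by move=> h; apply: (vge_all0 (v := v)) => N; exact: h.
by apply: bigcap_measurable => // N _; exact: measurable_vge.
Qed.

Lemma measurable_val f N : vcont f ->
  measurable ([set g | f g != 0 /\ v (f g) = N] : set (borel_mx v m)).
Proof.
move=> hf.
have -> : [set g | f g != 0 /\ v (f g) = N] =
  [set g : borel_mx v m | vge v N (f g)] `\` [set g : borel_mx v m | vge v (N + 1) (f g)].
  apply/seteqP; split=> g /=.
    by move=> [f0 fN]; rewrite !vgeE// fN lexx; split=> //; apply/negP; lia.
  by move=> [h1 /negP h2]; exact: val_exact.
by apply: measurableD; exact: measurable_vge.
Qed.

Lemma measurable_integralK (inv : involutive s) :
  measurable (integralK s v : set (borel_mx v m)).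
Proof.
have -> : (integralK s v : set (borel_mx v m)) =
  \bigcap_(ij : 'I_m * 'I_m) ([set g | (ct s g *m antidiag L m *m g) ij.1 ij.2
     - antidiag L m ij.1 ij.2 = 0] `&` [set g : borel_mx v m | vge v 0 ((g : 'M[L]_m) ij.1 ij.2)]).
  apply/seteqP; split=> g /=.
    by move=> [[_ ug] ig] [i j] _ /=; split; [rewrite -[ct s g]/(conjtr s g) ug subrr|exact: ig].
  move=> h; split; last by move=> i j; have [] := h (i, j) I.
  apply: unitaryG_of; apply/matrixP => i j; have [/= h1 _] := h (i, j) I.
  by apply/eqP; rewrite -subr_eq0; apply/eqP.
apply: fin_bigcap_measurable => //.
move=> [i j] _ /=; apply: measurableI.
  apply: measurable_eq0; apply: vcontD; last exact: vcont_cst.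
  apply: vcont_mulmx; last exact: vcont_id.
  by apply: vcont_mulmx; [exact/vcont_ct/vcont_id|exact: vcont_cstmx].
by apply: measurable_vge; exact: vcont_entry.
Qed.

End Continuity.

(** * Averaging over translations by elements of K *)

Section Averaging.
Variables (R : realType) (L : fieldType) (v : L -> int) (s : {rmorphism L -> L}).
Hypothesis hv : normalized_valuation v.
Hypothesis vs : forall N x, vge v N (s x) = vge v N x.
Hypothesis inv : involutive s.
Variable m : nat.
Variable mu : {measure set (borel_mx v m) -> \bar R}.
Local Notation K := (integralK s v (m := m)).
Hypothesis hmu : is_haar K mu.

Lemma mu_sub_lty (A : set (borel_mx v m)) : measurable A -> A `<=` K -> (mu A < +oo)%E.
Proof.
move=> mA AK; apply: (@le_lt_trans _ _ (mu K)); last by rewrite (proj1 hmu) ltry.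
by apply: le_measure; rewrite ?inE//; exact: measurable_integralK.
Qed.

(** Invariance is assumed for images under elements of K; a preimage under h is the image under its
    inverse, which also lies in K. *)
Lemma haar_preimage (h : 'M[L]_m) (B : set (borel_mx v m)) : K h -> measurable B ->
  B `<=` K -> mu [set g | B (h *m (g : 'M[L]_m))] = mu B.
Proof.
move=> Kh mB BK; have [h' Kh' [h'h hh']] := integralK_inv inv vs Kh.
rewrite -(proj2 hmu h' B Kh' mB BK); congr (mu _); apply/seteqP; split=> g /=.
  by move=> Bg; exists (h *m g) => //; rewrite mulmxA h'h mul1mx.
by move=> [b Bb <-]; rewrite mulmxA hh' mul1mx.
Qed.

(* Double counting of the pairs (h, g) with h g in B, by translation invariance. *)
Lemma averaging (hs : seq 'M[L]_m) (A B : set (borel_mx v m)) (M : nat) :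
  (forall h, h \in hs -> K h) -> measurable A -> measurable B ->
  A `<=` K -> B `<=` K ->
  (forall h g, h \in hs -> K g -> B (h *m g) -> A g) ->
  (forall g, A g -> count (fun h => `[< B (h *m g) >]) hs = M) ->
  (size hs)%:R * fine (mu B) = M%:R * fine (mu A).
Proof.
move=> hK mA mB AK BK hBA hc.
pose pre (h : 'M[L]_m) : set (borel_mx v m) := [set g | B (h *m (g : 'M[L]_m))].
have mpre h : measurable (pre h).
  by rewrite -[pre h]setTI; exact: (measurable_fun_mull hv h measurableT mB).
have sumE : (\sum_(h <- hs) mu (pre h) = M%:R%:E * mu A)%E.
  transitivity (\sum_(h <- hs) \int[mu]_g (\1_(pre h) g)%:E)%E.
    by apply: eq_bigr => h _; rewrite integral_indic// setIT.
  rewrite -ge0_integral_sum//; last first.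
    by move=> h; apply/measurable_EFinP; exact: measurable_indic.
  transitivity (\int[mu]_g (M%:R%:E * (\1_A g)%:E))%E; last first.
    by rewrite ge0_integralZl_EFin//= ?integral_indic ?setIT//;
      apply/measurable_EFinP; exact: measurable_indic.
  apply: eq_integral => g _; rewrite -EFinM sumEFin; congr EFin.
  have [gA|gA] := boolP (g \in A).
    rewrite indicE gA mulr1 -(hc g); last exact: set_mem.
    rewrite -sum1_count [in RHS]big_mkcond natr_sum; apply: eq_bigr => h _.
    rewrite indicE; case: asboolP => /= hB; first by rewrite mem_set.
    by rewrite memNset.
  rewrite indicE (negPf gA) mulr0 big_seq big1// => h hh.
  rewrite indicE memNset//= => hB; case/negP: gA; apply/mem_set.
  apply: (hBA h) => //.
  have [h' Kh' [h'h hh']] := integralK_inv inv vs (hK _ hh).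
  have := integralK_mul hv Kh' (BK _ hB).
  by rewrite mulmxA h'h mul1mx.
have fA := mu_sub_lty mA AK; have fB := mu_sub_lty mB BK.
have numA : mu A \is a fin_num by rewrite ge0_fin_numE.
have numB : mu B \is a fin_num by rewrite ge0_fin_numE.
move: sumE; rewrite big_seq (eq_bigr (fun=> mu B)); last first.
  by move=> h hh; apply: haar_preimage => //; exact: hK.
rewrite -big_seq -(fineK numA) -(fineK numB) -EFinM sumEFin => -[] <-.
by rewrite big_const_seq count_predT iter_addr_0 mulr_natl.
Qed.

End Averaging.

(** * Distribution of the last minor *)

Section TailSums.
Variables (R : realType) (Q t : R) (p : nat -> R) (l : nat).
Hypotheses (Q1 : 1 <= Q) (t0 : 0 < t) (t1 : t < 1).
Hypothesis p0 : forall i, 0 <= p i <= p 0.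

(** Abel summation: t^n = 1 + (t - 1) (1 + t + ... + t^(n-1)). With p i the mass where the valuation
    is at least i, the integral of t^n is p 0 + (t - 1) [partial] J up to an error t^J p 0. *)
Let partial J := \sum_(i < J) p i.+1 * t ^+ i.

Lemma geometric_eq0 (x C : R) (J0 : nat) :
  (forall J, (J0 <= J)%N -> `|x| <= C * t ^+ J) -> x = 0.
Proof.
move=> h; apply/eqP; rewrite -normr_le0; apply/ler_addgt0Pr => e e0; rewrite add0r.
have C0 : 0 < `|C| + 1 by rewrite ltr_wpDl.
have tcv : (fun J => t ^+ J) @ \oo --> (0 : R).
  by apply: cvg_expr; rewrite ger0_norm// ltW.
have /cvgrPdist_lt/(_ (e / (`|C| + 1)) (divr_gt0 e0 C0))[J1 _ hJ] := tcv.
have := hJ (maxn J0 J1) (leq_maxr _ _).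
have tn J : 0 <= t ^+ J by rewrite exprn_ge0// ltW.
rewrite /= sub0r normrN ger0_norm// ltr_pdivlMr// => /ltW hJ1.
apply: le_trans (h (maxn J0 J1) (leq_maxl _ _)) _; apply: le_trans hJ1.
rewrite mulrC ler_wpM2l//.
by apply: le_trans (ler_norm C) _; rewrite lerDl.
Qed.

Let Q0 : 0 < Q. Proof. exact: lt_le_trans ltr01 Q1. Qed.

Section Even.
Let U := t / Q.
Hypothesis p1 : (0 < l)%N -> (Q + 1) * p 1 = p 0.
Hypothesis pS : forall i, (0 < i < l)%N -> Q * p i.+1 = p i.
Hypothesis pl : forall i, (l < i)%N -> p i = 0.

Let pU i : (i < l)%N -> (Q + 1) * (p i.+1 * t ^+ i) = U ^+ i * p 0.
Proof.
elim: i => [|i IH] il; first by rewrite !expr0 mulr1 mul1r p1.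
have {}IH := IH (ltnW il).
have h := pS (i := i.+1) il.
have -> : p i.+2 * t ^+ i.+1 = U * (p i.+1 * t ^+ i).
  by rewrite -h /U exprS; field; rewrite gt_eqF.
by rewrite mulrCA IH exprS mulrA.
Qed.

(** Masses vanish beyond l, so the partial sums become stationary and the error bound forces
    equality; up to l the terms are geometric of ratio U. *)
Lemma tail_sum_even X :
  (forall J, `|X - (p 0 + (t - 1) * partial J)| <= t ^+ J * p 0) ->
  (Q + 1) * (1 - U) * X = ((Q - U) + (1 - Q * U) * U ^+ l) * p 0.
Proof.
move=> hX.
have hl J : (l <= J)%N -> partial J = partial l.
  move=> lJ; rewrite /partial -(subnKC lJ) big_split_ord /= [X in _ + X]big1 ?addr0//.
  by move=> i _; rewrite pl ?mul0r//; lia.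
have part n : (n <= l)%N -> (Q + 1) * (1 - U) * partial n = (1 - U ^+ n) * p 0.
  elim: n => [|n IH] nl; first by rewrite /partial big_ord0 mulr0 expr0 subrr mul0r.
  rewrite /partial big_ord_recr /= mulrDr IH ?(ltnW nl)//.
  by rewrite (mulrC (Q + 1) (1 - U)) -(mulrA (1 - U)) pU// exprS; ring.
have XE : X = p 0 + (t - 1) * partial l.
  apply/eqP; rewrite -subr_eq0; apply/eqP; apply: (geometric_eq0 (C := p 0) (J0 := l)) => J lJ.
  by rewrite -(hl J lJ) [leRHS]mulrC; exact: hX.
have tU : t = Q * U by rewrite /U mulrC divfK// gt_eqF.
rewrite XE mulrDr mulrCA part// {1}tU; ring.
Qed.

End Even.

Section Odd.
Let S := t / Q ^+ 2.
Hypothesis p1 : (0 < l)%N -> (Q ^+ 3 + 1) * p 1 = p 0.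
Hypothesis pS : forall i, (0 < i < l)%N -> (if odd i then Q else Q ^+ 3) * p i.+1 = p i.
Hypothesis plo : odd l -> forall i, (l < i)%N -> p i = 0.
Hypothesis ple : ~~ odd l -> (0 < l)%N -> Q ^+ 3 * p l.+1 = (Q + 1) * p l.
Hypothesis pl0 : l = 0%N -> (Q ^+ 2 - Q + 1) * p 1 = p 0.
Hypothesis pt : ~~ odd l -> forall i, (l < i)%N -> Q ^+ 2 * p i.+1 = p i.

Let tS : t = Q ^+ 2 * S.
Proof. by rewrite /S mulrC divfK// expf_neq0// gt_eqF. Qed.

Let Qn : Q != 0. Proof. by rewrite gt_eqF. Qed.

(** Consecutive terms have ratios Q S and S / Q in alternation, so two steps together contribute
    S^2. *)
Let pSi i : (i < l)%N -> (Q ^+ 3 + 1) * (p i.+1 * t ^+ i) =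
  (if odd i then Q * S ^+ i else S ^+ i) * p 0.
Proof.
elim: i => [|i IH] il; first by rewrite !expr0 mulr1 mul1r p1.
have {}IH := IH (ltnW il).
have h := pS (i := i.+1) il.
rewrite /= in h *; move: h IH; case: (odd i) => /= h IH.
  have -> : p i.+2 * t ^+ i.+1 = S / Q * (p i.+1 * t ^+ i).
    by rewrite -h [t ^+ i.+1]exprS [X in X * t ^+ i]tS; field.
  by rewrite mulrCA IH exprS; field.
have -> : p i.+2 * t ^+ i.+1 = S * Q * (p i.+1 * t ^+ i).
  by rewrite -h [t ^+ i.+1]exprS [X in X * t ^+ i]tS; field.
by rewrite mulrCA IH exprS; ring.
Qed.

Let part n : (n <= l)%N -> (Q ^+ 3 + 1) * (1 - S ^+ 2) * partial n =
  ((1 + Q * S) - S ^+ n * (if odd n then Q + S else 1 + Q * S)) * p 0.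
Proof.
elim: n => [|n IH] nl; first by rewrite /partial big_ord0 mulr0 expr0 mul1r subrr mul0r.
rewrite /partial big_ord_recr /= mulrDr IH ?(ltnW nl)//.
rewrite (mulrC (Q ^+ 3 + 1) (1 - S ^+ 2)) -(mulrA (1 - S ^+ 2)) pSi// [S ^+ n.+1]exprS.
by case: (odd n) => /=; ring.
Qed.

(** For odd l the sum stops at l. For even l the masses beyond l decay by Q^2 at each step, which
    leaves a geometric tail of ratio S. The sign that separates the two cases is absorbed in (-
    S)^l. *)
Lemma tail_sum_odd X :
  (forall J, `|X - (p 0 + (t - 1) * partial J)| <= t ^+ J * p 0) ->
  (Q ^+ 3 + 1) * (1 - S ^+ 2) * X =
  (Q + S) * (Q ^+ 2 - S + (Q ^+ 2 * S - 1) * (- S) ^+ l) * p 0.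
Proof.
move=> hX.
have [ol|el] := boolP (odd l).
  have hl J : (l <= J)%N -> partial J = partial l.
    move=> lJ; rewrite /partial -(subnKC lJ) big_split_ord /= [X in _ + X]big1 ?addr0//.
    by move=> i _; rewrite (plo ol) ?mul0r//; lia.
  have XE : X = p 0 + (t - 1) * partial l.
    apply/eqP; rewrite -subr_eq0; apply/eqP; apply: (geometric_eq0 (C := p 0) (J0 := l)) => J lJ.
    by rewrite -(hl J lJ) [leRHS]mulrC; exact: hX.
  rewrite XE mulrDr mulrCA part// ol exprNn -signr_odd ol expr1 {1}tS; ring.
have base : (Q ^+ 3 + 1) * (p l.+1 * t ^+ l) = (Q + 1) * S ^+ l * p 0.
  have [l0|l0] := posnP l.
    rewrite l0 !expr0 !mulr1 -(pl0 l0); ring.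
  have := pSi (i := l.-1); rewrite prednK// leqnn => /(_ isT).
  have -> : odd l.-1 by move: el; rewrite -{1}(prednK l0) /= negbK.
  move=> h; have hle := ple el l0.
  have -> : p l.+1 * t ^+ l = (Q + 1) * S / Q * (p l * t ^+ l.-1).
    rewrite -{2}(prednK l0) exprS {1}tS.
    apply: (mulfI (expf_neq0 3 Qn)).
    transitivity ((Q ^+ 3 * p l.+1) * (Q ^+ 2 * S * t ^+ l.-1)); first by ring.
    by rewrite hle; field.
  rewrite mulrCA h -{2}(prednK l0) exprS; by field.
(* The second term is the closed form of the geometric tail from position l + n on, so the left side
   does not depend on n. *)
have inv_n n : (Q ^+ 3 + 1) * (1 - S ^+ 2) * partial (l + n) +
   (Q ^+ 3 + 1) * (1 + S) * (p (l + n).+1 * t ^+ (l + n)) =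
   ((1 + Q * S) * (1 - S ^+ l) + (Q + 1) * (1 + S) * S ^+ l) * p 0.
  elim: n => [|n IH].
    rewrite addn0 part// (negPf el) (mulrC (Q ^+ 3 + 1) (1 + S)) -(mulrA (1 + S)) base.
    ring.
  rewrite -IH addnS /partial big_ord_recr /=.
  have hp := pt el (i := (l + n).+1); rewrite ltnS leq_addr in hp.
  have -> : p (l + n).+2 * t ^+ (l + n).+1 = S * (p (l + n).+1 * t ^+ (l + n)).
    rewrite -(hp isT) exprS {1}tS; ring.
  ring.
apply/eqP; rewrite -subr_eq0; apply/eqP.
pose A := (Q ^+ 3 + 1) * (1 - S ^+ 2).
apply: (geometric_eq0 (C := (`|A| + `|(t - 1) * ((Q ^+ 3 + 1) * (1 + S))|) * p 0) (J0 := l)) => J lJ.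
have [n Jn] : exists n, J = (l + n)%N by exists (J - l)%N; rewrite subnKC.
have h := inv_n n; rewrite -Jn in h.
have -> : (Q ^+ 3 + 1) * (1 - S ^+ 2) * X -
    (Q + S) * (Q ^+ 2 - S + (Q ^+ 2 * S - 1) * (- S) ^+ l) * p 0 =
   A * (X - (p 0 + (t - 1) * partial J)) - (t - 1) * ((Q ^+ 3 + 1) * (1 + S)) * (p J.+1 * t ^+ J).
  have hA : A * partial J = ((1 + Q * S) * (1 - S ^+ l) + (Q + 1) * (1 + S) * S ^+ l) * p 0
     - (Q ^+ 3 + 1) * (1 + S) * (p J.+1 * t ^+ J) by rewrite -h addrK.
  rewrite (mulrBr A X) (mulrDr A) (mulrCA A (t - 1)) hA exprNn -signr_odd (negPf el) expr0 mul1r.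
  rewrite [in t - 1]tS /A; ring.
apply: le_trans (ler_normB _ _) _.
rewrite (mulrDl `|A|) (mulrDl (`|A| * p 0)); apply: lerD.
  by rewrite normrM -mulrA ler_wpM2l// [leRHS]mulrC; exact: hX.
have [pJ0 pJ] := andP (p0 J.+1).
rewrite normrM [X in _ * X]normrM (ger0_norm pJ0).
by rewrite (ger0_norm (exprn_ge0 _ (ltW t0))) mulrA ler_wpM2r ?exprn_ge0 ?(ltW t0)// ler_wpM2l.
Qed.

End Odd.
End TailSums.

(** * Integrals of powers of a valuation *)

Section PowerIntegral.
Variables (R : realType) (L : fieldType) (v : L -> int) (hv : normalized_valuation v).
Variable m : nat.
Variable mu : {measure set (borel_mx v m) -> \bar R}.
Variables (I : set (borel_mx v m)) (phi : 'M[L]_m -> L).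
Hypotheses (mI : measurable I) (fI : (mu I < +oo)%E) (cphi : vcont v phi).
Hypothesis phi0 : forall g, I g -> vge v 0 (phi g).
Variable t : R.
Hypotheses (t0 : 0 < t) (t1 : t < 1).

Definition vpow (x : L) : R := if x == 0 then 0 else t ^ v x.

Let B i : set (borel_mx v m) := [set g | vge v i%:Z (phi g)].
Let mB i : measurable (B i). Proof. exact: measurable_vge. Qed.

(** Truncated Abel sum: on I it is t to the power min(J, v (phi g)), a zero of phi counting as
    infinite valuation. *)
Let trunc J (g : borel_mx v m) : R := 1 + (t - 1) * \sum_(i < J) \1_(B i.+1) g * t ^+ i.

Let truncS J g : trunc J.+1 g = trunc J g + (t - 1) * t ^+ J * \1_(B J.+1) g.
Proof. by rewrite /trunc big_ord_recr /=; ring. Qed.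

Let truncE J g : I g ->
  trunc J g = if vge v J%:Z (phi g) then t ^+ J else t ^ v (phi g).
Proof.
move=> Ig; elim: J => [|J IH].
  by rewrite phi0// /trunc big_ord0 mulr0 addr0.
rewrite truncS IH indicE; case: (boolP (vge v J.+1%:Z (phi g))) => h1.
  rewrite mem_set// mulr1 ifT; first by rewrite exprS; ring.
  by apply: vge_le h1; lia.
rewrite memNset ?mulr0 ?addr0; last exact/negP.
case: ifP => // h0; have h1' : ~~ vge v (J%:Z + 1) (phi g) by rewrite -PoszD addn1.
by have [_ ->] := val_exact h0 h1'.
Qed.

Let mtrunc J : measurable_fun I (trunc J).
Proof.
elim: J => [|J IH].
  have -> : trunc 0 = cst 1; last exact: measurable_cst.
  by apply/funext => g; rewrite /trunc big_ord0 mulr0 addr0.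
have -> : trunc J.+1 = trunc J \+ (fun g => (t - 1) * t ^+ J * \1_(B J.+1) g).
  by apply/funext => g; rewrite truncS.
apply: measurable_funD => //; apply: measurable_funM; first exact: measurable_cst.
exact: measurable_indic.
Qed.

Let bound_trunc J g : I g -> `|trunc J g| <= 1.
Proof.
move=> Ig; rewrite truncE//; case: ifP => h.
  by rewrite ger0_norm ?exprn_ge0 ?exprn_ile1 ?ltW.
have [e|n0] := eqVneq (phi g) 0; first by rewrite e vge0 in h.
have := phi0 Ig; rewrite vgeE// => v0.
have -> : v (phi g) = `|v (phi g)|%N :> int by rewrite gez0_abs.
by rewrite -exprnP ger0_norm ?exprn_ge0 ?exprn_ile1 ?ltW.
Qed.

Let itrunc J : mu.-integrable I (EFin \o trunc J).
Proof. exact: (integrable_bounded mI fI (mtrunc J) (@bound_trunc J)). Qed.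

Let iindic J : mu.-integrable I (EFin \o (\1_(B J) : _ -> R)).
Proof.
apply: (integrable_bounded (B := 1) mI fI); first exact: measurable_indic.
by move=> g _; rewrite indicE; case: (g \in _); rewrite ?normr1 ?normr0.
Qed.

Let Rtrunc J : \int[mu]_(g in I) trunc J g =
  fine (mu (I `&` B 0)) + (t - 1) * \sum_(i < J) fine (mu (I `&` B i.+1)) * t ^+ i.
Proof.
have IB0 : I `&` B 0 = I.
  by apply/seteqP; split=> g /=; [case|move=> Ig; split=> //; exact: phi0].
elim: J => [|J IH].
  rewrite big_ord0 mulr0 addr0 IB0 -[RHS]mul1r -Rintegral_cst//.
  by apply: eq_Rintegral => g _; rewrite /trunc big_ord0 mulr0 addr0.
transitivity (\int[mu]_(g in I) (trunc J g + (t - 1) * t ^+ J * \1_(B J.+1) g)).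
  by apply: eq_Rintegral => g _; rewrite truncS.
have iz : mu.-integrable I (EFin \o (fun g => (t - 1) * t ^+ J * \1_(B J.+1) g)).
  apply: (integrable_bounded (B := `|(t - 1) * t ^+ J|) mI fI).
    by apply: measurable_funM; [exact: measurable_cst|exact: measurable_indic].
  move=> g _; rewrite normrM indicE; case: (g \in _); rewrite ?normr1 ?mulr1//.
  by rewrite normr0 mulr0.
rewrite RintegralD// IH RintegralZl// big_ord_recr /= /Rintegral integral_indic//.
by rewrite [_ `&` I]setIC; ring.
Qed.

Lemma measurable_vpow : measurable_fun I (vpow \o phi : borel_mx v m -> R).
Proof.
pose key (g : borel_mx v m) := (phi g == 0, v (phi g)).
apply: (measurable_fun_key (key := key) (h := fun b => if b.1 then 0 else t ^ b.2)) => //.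
move=> [b n]; apply: measurableI => //; case: b.
  have [nz|nz] := eqVneq n (v 0).
    rewrite (_ : [set _ | _] = [set g : borel_mx v m | phi g = 0]); first exact: measurable_eq0.
    apply/seteqP; split=> g /=; first by case=> /eqP.
    by move=> e; rewrite /key e eqxx nz.
  rewrite (_ : [set _ | _] = set0)//; apply/seteqP; split=> // g [/eqP e h].
  by case/eqP: nz; rewrite -h e.
rewrite (_ : [set _ | _] = [set g : borel_mx v m | phi g != 0 /\ v (phi g) = n]).
  exact: measurable_val.
by apply/seteqP; split=> g /=; [case=> -> ->|case=> /negPf e1 e2; rewrite /key e1 e2].
Qed.

Lemma vpow_le1 x : vge v 0 x -> `|vpow x| <= 1.
Proof.
rewrite /vpow; case: eqVneq => [_ _|x0]; first by rewrite normr0.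
rewrite vgeE// => v0; have -> : v x = `|v x|%N :> int by rewrite gez0_abs.
by rewrite -exprnP ger0_norm ?exprn_ge0 ?exprn_ile1 ?ltW.
Qed.

(** The power and its truncation differ only where the valuation is at least J, and there by at most
    t^J. *)
Lemma power_integral_approx J :
  `|\int[mu]_(g in I) vpow (phi g) -
    (fine (mu (I `&` B 0)) + (t - 1) * \sum_(i < J) fine (mu (I `&` B i.+1)) * t ^+ i)|
  <= t ^+ J * fine (mu (I `&` B 0)).
Proof.
have IB0 : I `&` B 0 = I.
  by apply/seteqP; split=> g /=; [case|move=> Ig; split=> //; exact: phi0].
have ip : mu.-integrable I (EFin \o (vpow \o phi)).
  apply: (integrable_bounded (B := 1) mI fI measurable_vpow) => g Ig.
  exact/vpow_le1/phi0.
have tn i : 0 <= t ^+ i by rewrite exprn_ge0// ltW.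
rewrite -Rtrunc -RintegralB// IB0; apply: Rintegral_le_bound => //.
  by apply: measurable_funB => //; exact: measurable_vpow.
move=> g Ig; rewrite truncE// /vpow.
have [e|n0] := eqVneq (phi g) 0.
  by rewrite e vge0 sub0r normrN ger0_norm.
case: ifP => h; last by rewrite subrr normr0.
have hJ : J%:Z <= v (phi g) by rewrite vgeE in h.
have -> : v (phi g) = (J + `|(v (phi g) - J%:Z)%R|%N)%N :> int.
  by rewrite PoszD gez0_abs ?subr_ge0// addrC subrK.
rewrite -exprnP exprD -[X in _ - X]mulr1 -mulrBr normrM ger0_norm//.
rewrite ler_piMr// distrC ger0_norm; last first.
  by rewrite subr_ge0; exact: exprn_ile1 (ltW t0) (ltW t1).
by rewrite lerBlDr lerDl.
Qed.

End PowerIntegral.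

(** * Primitive triples whose norm has given valuation *)

Section Triples.
Variables (L : fieldType) (v : L -> int) (s : {rmorphism L -> L}).
Variables (T : seq L) (pi eps kap : L).
Hypothesis H : @unramified_quadratic L v s T pi eps kap.

Let hv : normalized_valuation v := uq_val H.
Local Hint Resolve hv : core.

Definition normal_triple (l : nat) (a c b : L) :=
  [/\ vge v 0 a, vge v 0 c, vge v 0 b, ~~ [&& vge v 1 a, vge v 1 c & vge v 1 b] &
      vge v l%:Z (hform s a c b) /\ ~~ vge v l.+1%:Z (hform s a c b)].

Lemma vge_trace (i : nat) a b : vge v 0 a -> vge v i%:Z b ->
  vge v i%:Z (a * s b + s a * b).
Proof. by move=> ha hb; apply: vgeD => //; apply: vgeMl; rewrite ?(vgeS H). Qed.

Lemma hform_norm a c b : c * s c = hform s a c b - (a * s b + s a * b).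
Proof. by rewrite /hform [RHS]addrC addKr. Qed.

(** Modulo pi^i the norm of c is congruent to the form; norms have even valuation, which allows i /
    2 to be rounded up. *)
Lemma normal_triple_c l (i j : nat) a c b : normal_triple l a c b -> vge v i%:Z b ->
  (i <= l)%N -> (j.*2 <= i.+1)%N -> vge v j%:Z c.
Proof.
move=> [a0 c0 b0 _ [hl _]] hb il ji; apply: (vge_norm_inv H ji).
rewrite (hform_norm a c b); apply: vgeB => //; first by apply: vge_le hl; lia.
exact: vge_trace.
Qed.

Lemma normal_triple_a l a c b : normal_triple l a c b -> vge v 1 b ->
  (0 < l)%N || (c == 0) -> ~~ vge v 1 a.
Proof.
move=> ht hb hl; have [_ _ _ hp _] := ht; apply: contraNN hp => ->.
rewrite hb andbT /=; case/orP: hl => [l0|/eqP ->]; last exact: vge0.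
exact: (normal_triple_c ht hb).
Qed.

Lemma normal_triple_even l (i : nat) a b : normal_triple l a 0 b -> vge v i%:Z b ->
  (i <= l)%N.
Proof.
move=> [a0 _ _ _ [_ hl]] hb; rewrite leqNgt; apply: contraNN hl => li.
apply: (vge_le (N := i%:Z)); first by lia.
by rewrite /hform mul0r addr0; exact: vge_trace.
Qed.

(** Once v(b) exceeds l, the valuation l of the form is that of N(c), hence even. *)
Lemma normal_triple_exact l (i : nat) a c b : normal_triple l a c b -> vge v i%:Z b ->
  (l < i)%N -> [/\ ~~ odd l, vge v l./2%:Z c & ~~ vge v l./2.+1%:Z c].
Proof.
move=> ht hb li; have [a0 c0 b0 _ [hl nl]] := ht.
have hb1 : vge v l.+1%:Z b by apply: vge_le hb; lia.
have nN : ~~ vge v l.+1%:Z (c * s c).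
  by rewrite (hform_norm a c b) (vgeDl hv)// vgeN//; exact: vge_trace.
have el : ~~ odd l.
  apply: contraNN nN => ol; apply: (vge_norm H (i := l./2.+1)).
    by have := odd_double_half l; rewrite ol; lia.
  apply: (normal_triple_c ht (i := l)) => //; first by apply: vge_le hb1; lia.
  by have := odd_double_half l; rewrite ol; lia.
split=> //.
  apply: (normal_triple_c ht (i := l)) => //; first by apply: vge_le hb1; lia.
  by have := odd_double_half l; lia.
apply: contraNN nN => hc; apply: (vge_norm H _ hc).
by have := odd_double_half l; rewrite (negPf el); lia.
Qed.

End Triples.

(** Algebra for l = 0, where x and y are the masses of the parts of {v(b) >= 1} with a a non-unit
    and a unit. It rests on Q^3 + 1 = (Q + 1)(Q^2 - Q + 1); the factor Q + 1 is cancelled by the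
    caller. *)
Lemma unit_form_mass (R : comNzRingType) (Q p0 p1 x y : R) :
  Q ^+ 3 * y = (Q + 1) * (p0 - p1) -> Q ^+ 2 * x = p1 -> p1 = x + y ->
  (Q + 1) * ((Q ^+ 2 - Q + 1) * p1) = (Q + 1) * p0.
Proof.
move=> h1 h2 h3.
have e : Q ^+ 3 * p1 = Q * (Q ^+ 2 * x) + Q ^+ 3 * y by rewrite h3; ring.
rewrite h2 h1 in e.
rewrite (_ : _ * _ = Q ^+ 3 * p1 + p1); last by ring.
by rewrite e; ring.
Qed.

(** * Distribution of the valuation of b on a stratum *)

Section Distribution.
Variables (R : realType) (L : fieldType) (v : L -> int) (s : {rmorphism L -> L}).
Variables (T : seq L) (pi eps kap : L).
Hypothesis H : @unramified_quadratic L v s T pi eps kap.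
Let hv : normalized_valuation v := uq_val H.
Let inv : involutive s := uq_invol H.
Let vs := vgeS H.
Local Hint Resolve hv : core.
Local Notation q := (size T).
Local Notation T2 := (T2 T eps kap).

Variable m : nat.
Variable mu : {measure set (borel_mx v m) -> \bar R}.
Local Notation K := (integralK s v (m := m)).
Hypothesis hmu : is_haar K mu.

Variables (wa wc wb : 'M[L]_m -> L).
Hypotheses (cwa : vcont v wa) (cwc : vcont v wc) (cwb : vcont v wb).
Variables (I : set (borel_mx v m)) (l : nat).
Hypotheses (mI : measurable I) (IK : I `<=` K).
Hypothesis hI : forall g, I g -> normal_triple v s l (wa g) (wc g) (wb g).
Hypothesis c_even : ~~ odd m -> forall g, wc g = 0.
Hypothesis transl : forall be ga, (~~ odd m -> be = 0) ->
  ga + s ga + be * s be = 0 -> vge v 0 be -> vge v 0 ga ->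
  exists2 h, K h & forall g, [/\ wa (h *m g) = wa g, wc (h *m g) = wc g + be * wa g,
    wb (h *m g) = wb g - s be * wc g + ga * wa g & K g -> (I (h *m g) <-> I g)].
Hypothesis swap : exists2 h, K h & forall g, [/\ wa (h *m g) = wb g,
    wc (h *m g) = wc g, wb (h *m g) = wa g & K g -> (I (h *m g) <-> I g)].

Implicit Types P : L -> L -> L -> bool.

Let event P : set (borel_mx v m) := I `&` [set g | P (wa g) (wc g) (wb g)].
Let prob P : R := fine (mu (event P)).
Let mP P := measurable ([set g | P (wa g) (wc g) (wb g)] : set (borel_mx v m)).

Let mevent P : mP P -> measurable (event P). Proof. exact: measurableI. Qed.

Let mP_b N : mP (fun _ _ b => vge v N b). Proof. exact: measurable_vge. Qed.
Let mP_a N : mP (fun a _ _ => vge v N a). Proof. exact: measurable_vge. Qed.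
Let mP_and P Q : mP P -> mP Q -> mP (fun a c b => P a c b && Q a c b).
Proof.
move=> hP hQ; have := measurableI _ _ hP hQ.
rewrite (_ : _ `&` _ = [set g | P (wa g) (wc g) (wb g) && Q (wa g) (wc g) (wb g)])//.
by apply/seteqP; split=> g /= /andP.
Qed.
Let mP_not P : mP P -> mP (fun a c b => ~~ P a c b).
Proof.
move=> hP; have := measurableC hP.
rewrite (_ : ~` _ = [set g | ~~ P (wa g) (wc g) (wb g)])//.
by apply/seteqP; split=> g /= /negP.
Qed.

Let prob_ext P Q : (forall a c b, (~~ odd m -> c = 0) -> normal_triple v s l a c b ->
   P a c b = Q a c b) -> prob P = prob Q.
Proof.
move=> h; congr (fine (mu _)); apply/seteqP; split=> g /= [Ig Pg]; split=> //=.
  by rewrite -h//; [move=> /c_even|exact: hI].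
by rewrite h//; [move=> /c_even|exact: hI].
Qed.

Let prob_split P Q : mP P -> mP Q ->
  prob P = prob (fun a c b => P a c b && Q a c b) + prob (fun a c b => P a c b && ~~ Q a c b).
Proof.
move=> hP hQ; rewrite /prob -fineD; last 2 first.
- rewrite ge0_fin_numE//; apply: (mu_sub_lty hv vs inv hmu).
    by apply: mevent; exact: mP_and.
  by move=> g [/IK].
- rewrite ge0_fin_numE//; apply: (mu_sub_lty hv vs inv hmu).
    by apply: mevent; apply: mP_and => //; exact: mP_not.
  by move=> g [/IK].
rewrite -measureU; last 3 first.
- by apply: mevent; exact: mP_and.
- by apply: mevent; apply: mP_and => //; exact: mP_not.
- by apply/seteqP; split=> // g [[_ /andP[_ h]] [_ /andP[_ /negP]]].
congr (fine (mu _)); apply/seteqP; split=> g /=.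
  by move=> [Ig Pg]; case: (boolP (Q (wa g) (wc g) (wb g))) => hq;
    [left|right]; split=> //; apply/andP.
by move=> [[Ig /andP[]]|[Ig /andP[]]].
Qed.

Let prob_swap P : mP P -> mP (fun a c b => P b c a) ->
  prob (fun a c b => P b c a) = prob P.
Proof.
move=> hP hP'; have [h Kh hh] := swap.
congr fine; rewrite -(haar_preimage vs inv hmu Kh (mevent hP)); last by move=> g [/IK].
have [h' Kh' [h'h hh']] := integralK_inv inv vs Kh.
congr (mu _); apply/seteqP; split=> g /=; rewrite /event /=; have [-> -> -> hg] := hh g.
  by move=> [Ig Pg]; split=> //; apply/hg => //; exact: IK.
move=> [Ig Pg]; split=> //; apply/hg => //.
by have := integralK_mul hv Kh' (IK Ig); rewrite mulmxA h'h mul1mx.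
Qed.

Definition translation_pair (p : L * L) := [/\ ~~ odd m -> p.1 = 0,
  p.2 + s p.2 + p.1 * s p.1 = 0, vge v 0 p.1 & vge v 0 p.2].

(** Double counting over the translations in [S]: landing in Q forces the start to lie in P, and
    each start in P has M landings in Q. Both ends are normal triples because translations preserve
    the stratum. *)
Let prob_step (S : seq (L * L)) P Q M : mP P -> mP Q ->
  (forall p, p \in S -> translation_pair p) ->
  (forall a c b p, p \in S -> normal_triple v s l a c b ->
     normal_triple v s l a (c + p.1 * a) (b - s p.1 * c + p.2 * a) ->
     Q a (c + p.1 * a) (b - s p.1 * c + p.2 * a) -> P a c b) ->
  (forall a c b, (~~ odd m -> c = 0) -> normal_triple v s l a c b -> P a c b ->
     count (fun p => Q a (c + p.1 * a) (b - s p.1 * c + p.2 * a)) S = M) ->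
  (size S)%:R * prob Q = M%:R * prob P.
Proof.
move=> hP hQ hS hQP hc.
have /= ex p : exists h, p \in S -> K h /\ forall g, [/\ wa (h *m g) = wa g,
    wc (h *m g) = wc g + p.1 * wa g,
    wb (h *m g) = wb g - s p.1 * wc g + p.2 * wa g & K g -> (I (h *m g) <-> I g)].
  have [pS|] := boolP (p \in S); last by exists 0.
  have [h1 h2 h3 h4] := hS _ pS; have [h Kh hh] := transl h1 h2 h3 h4.
  by exists h.
pose hf p := projT1 (cid (ex p)).
have hfP p : p \in S -> _ := projT2 (cid (ex p)).
have -> : size S = size (map hf S) by rewrite size_map.
apply: (averaging hv vs inv hmu); rewrite ?size_map.
- by move=> h /mapP[p pS ->]; case: (hfP p pS).
- exact: mevent.
- exact: mevent.
- by move=> g [/IK].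
- by move=> g [/IK].
- move=> _ g /mapP[p pS ->] Kg; rewrite /event /=.
  have [_ /(_ g)[ea ec eb /(_ Kg) eI]] := hfP p pS.
  rewrite -/(hf p) in ea ec eb eI *; rewrite ea ec eb.
  move=> [Ihg Qhg]; have Ig := eI.1 Ihg; split=> //.
  apply: hQP Qhg => //; first exact: hI.
  by have := hI Ihg; rewrite ea ec eb.
- move=> g [Ig Pg]; rewrite count_map -(hc (wa g) (wc g) (wb g))//; last exact: hI.
    apply: eq_in_count => p pS /=.
    have [_ /(_ g)[ea ec eb /(_ (IK Ig)) eI]] := hfP p pS.
    rewrite -/(hf p) in ea ec eb eI *; rewrite /event /= ea ec eb.
    by apply/asboolP/idP => [[]//|h]; split=> //; exact/eI.
  by move=> /c_even.
Qed.

Let prob_step1 N (S : seq (L * L)) P Q : size S = N -> mP P -> mP Q ->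
  (forall p, p \in S -> translation_pair p) ->
  (forall a c b p, p \in S -> normal_triple v s l a c b ->
     normal_triple v s l a (c + p.1 * a) (b - s p.1 * c + p.2 * a) ->
     Q a (c + p.1 * a) (b - s p.1 * c + p.2 * a) -> P a c b) ->
  (forall a c b, (~~ odd m -> c = 0) -> normal_triple v s l a c b -> P a c b ->
     count (fun p => Q a (c + p.1 * a) (b - s p.1 * c + p.2 * a)) S = 1%N) ->
  N%:R * prob Q = prob P.
Proof. by move=> <- hP hQ h1 h2 h3; rewrite (prob_step hP hQ h1 h2 h3) mul1r. Qed.

Let prob_false P : (forall a c b, (~~ odd m -> c = 0) -> normal_triple v s l a c b ->
   P a c b = false) -> prob P = 0.
Proof.
move=> h; rewrite (prob_ext (Q := fun _ _ _ => false))// /prob.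
rewrite (_ : event _ = set0) ?measure0//.
by apply/seteqP; split=> // g [].
Qed.

Definition tail_mass (i : nat) : R := fine (mu (I `&` [set g | vge v i%:Z (wb g)])).
Local Notation p := tail_mass.

Let pE i : p i = prob (fun _ _ b => vge v i%:Z b). Proof. by []. Qed.

Lemma tail_mass0 : p 0 = fine (mu I).
Proof.
congr (fine (mu _)); apply/seteqP; split=> g /=; first by case.
by move=> Ig; split=> //; have [] := hI Ig.
Qed.

Let prob_unit_a : prob (fun a _ _ => ~~ vge v 1 a) = p 0 - p 1.
Proof.
have -> := prob_swap (P := fun _ _ b => ~~ vge v 1 b) (mP_not (mP_b 1)) (mP_not (mP_a 1)).
rewrite !pE (prob_split (mP_b 0) (mP_b 1)).
rewrite (prob_ext (P := fun _ _ b => vge v 0 b && vge v 1 b) (Q := fun _ _ b => vge v 1 b)).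
  by rewrite addrAC subrr add0r; apply: prob_ext => a c b _ [_ _ -> _ _].
by move=> a c b _ [_ _ -> _ _].
Qed.

Let prob_unit_b i : (0 < i)%N -> (0 < l)%N || ~~ odd m ->
  prob (fun a _ b => ~~ vge v 1 a && vge v i%:Z b) = p i.
Proof.
move=> i0 hl; rewrite pE; apply: prob_ext => a c b hc ht; apply: andb_idl => hb.
have hb1 : vge v 1 b by apply: (vge_le _ hb); lia.
apply: (normal_triple_a H ht hb1).
by case/orP: hl => [->//|/hc ->]; rewrite eqxx orbT.
Qed.

Let mP_ab i : mP (fun a _ b => ~~ vge v 1 a && vge v i%:Z b).
Proof. exact: (mP_and (mP_not (mP_a 1)) (mP_b i)). Qed.

Let skew_fixed (i : nat) t : t \in T -> s (pi ^+ i * t) = pi ^+ i * t.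
Proof.
by move=> tT; have [st _] := uq_T H tT; rewrite rmorphM rmorphXn /= (s_pi H) st.
Qed.

Let T_int (i : nat) t : t \in T -> vge v 0 (pi ^+ i * t).
Proof.
move=> tT; have [_ t0] := uq_T H tT; apply: vgeMr => //.
by apply: vge_le (vgeXpi H i); lia.
Qed.

Let T2_int' (i : nat) t : t \in T2 -> vge v 0 (pi ^+ i * t).
Proof.
move=> tT; apply: vgeMr => //; last exact: (T2_int H).
by apply: vge_le (vgeXpi H i); lia.
Qed.

(** Either c = 0, or i is odd and c gains a half step by [normal_triple_c]; in both cases N(c)
    vanishes modulo pi^(i+1), and one skew translation in q raises the valuation of b. *)
Lemma step_skew i : (i < l)%N -> odd i || ~~ odd m ->
  q%:R * prob (fun a _ b => ~~ vge v 1 a && vge v i.+1%:Z b) =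
  prob (fun a _ b => ~~ vge v 1 a && vge v i%:Z b).
Proof.
move=> il io.
pose S := [seq (0 : L, skew eps (pi ^+ i * t)) | t <- T].
have szS : size S = q by rewrite size_map.
apply: (prob_step1 szS (mP_ab i) (mP_ab i.+1)).
- move=> _ /mapP[t tT ->]; split=> //=.
    have := gamP H 0 (skew_fixed i tT); rewrite /gam.
    by rewrite !mul0r oppr0 mul0r add0r addr0.
  apply: vgeMr => //; last exact: vge_eps H.
  exact: T_int.
- move=> a c b _ /mapP[t tT ->] /= [a0 _ _ _ _] _.
  rewrite rmorph0 mul0r subr0 => /andP[-> hb] /=.
  have hs : vge v i%:Z (skew eps (pi ^+ i * t) * a).
    apply: vgeMr => //; apply: vgeMr => //; last exact: vge_eps H.
    have [_ t0] := uq_T H tT; apply: vgeMr => //; exact: vgeXpi H i.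
  by rewrite -(vgeDl hv _ hs); apply: vge_le hb; lia.
- move=> a c b hc ht /andP[ua hb]; have [a0 c0 b0 hp [hl _]] := ht.
  have hN : vge v i.+1%:Z (hform s a c b - c * s c).
    apply: vgeB => //; first by apply: vge_le hl; lia.
    case/orP: io => [oi|/hc ->]; last by rewrite mul0r vge0.
    have hj := odd_double_half i.
    apply: (vge_norm H (i := i./2.+1)); first by rewrite oi in hj; lia.
    apply: (normal_triple_c H ht hb); first by lia.
    by rewrite oi in hj; lia.
  rewrite -(count_skew H a0 ua hb hN) count_map; apply: eq_count => t /=.
  by rewrite rmorph0 mul0r subr0 ua.
Qed.

Let family i := [seq (h.1, gam s eps kap h.1 h.2) |
  h <- [seq (pi ^+ i * be, pi ^+ i.*2 * t) | be <- T2, t <- T]].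

Let size_family i : size (family i) = (q ^ 3)%N.
Proof. by rewrite size_map size_allpairs (size_T2 T eps kap) !expnS expn0 muln1 mulnA. Qed.

Let family_pair i p : odd m -> p \in family i -> translation_pair p.
Proof.
move=> om /mapP[h /allpairsP[[be t] /= [beT tT ->]] ->] /=.
split=> //=; first by rewrite om.
- exact: (gamP H _ (skew_fixed _ tT)).
- exact: T2_int'.
- by apply: (gam_int H); [exact: T2_int'|exact: T_int].
Qed.

(** From valuation 2i to 2i+1 the coordinate c has to move as well, hence q^3 translations.
    Conversely, a landing with v(b') > 2i has its middle coordinate divisible by pi^i, so the start
    has v(b) >= 2i. *)
Let step_family i M : odd m -> (i.*2 <= l)%N ->
  (forall a c b, normal_triple v s l a c b -> ~~ vge v 1 a -> vge v i.*2%:Z b ->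
    count (fun h : L * L => vge v i.*2.+1%:Z (b - s h.1 * c + gam s eps kap h.1 h.2 * a))
      [seq (pi ^+ i * be, pi ^+ i.*2 * t) | be <- T2, t <- T] = M) ->
  (q ^ 3)%N%:R * prob (fun a _ b => ~~ vge v 1 a && vge v i.*2.+1%:Z b) =
  M%:R * prob (fun a _ b => ~~ vge v 1 a && vge v i.*2%:Z b).
Proof.
move=> om il hM; rewrite -(size_family i).
apply: (prob_step (mP_ab i.*2) (mP_ab i.*2.+1)).
- by move=> p; exact: family_pair.
- move=> a c b _ /mapP[h /allpairsP[[be t] /= [beT tT ->]] ->] /= [a0 _ _ _ _] ht'.
  move=> /andP[-> hb'] /=; move: ht' hb'.
  set be' := pi ^+ i * be; set ga := gam _ _ _ _ _ => ht' hb'.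
  have hb1 : vge v i.*2%:Z (b - s be' * c + ga * a) by apply: vge_le hb'; lia.
  have hc' : vge v i%:Z (c + be' * a) by apply: (normal_triple_c H ht' hb1).
  have hbe : vge v i%:Z be' by rewrite -{1}(addn0 i) (vgeXK H); exact: (T2_int H).
  have hc : vge v i%:Z c by rewrite -(vgeDl hv _ (vgeMr hv hbe a0)).
  have hga : vge v i.*2%:Z ga.
    apply: vgeD => //.
      apply: vgeMr => //; last exact: vge_kap H.
      by rewrite vgeN//; apply: (vge_norm H (i := i)).
    apply: vgeMr => //; last exact: vge_eps H.
    by rewrite -{1}(addn0 i.*2) (vgeXK H); have [] := uq_T H tT.
  rewrite -(vgeDl hv b (y := - (s be' * c) + ga * a)) ?addrA//.
  apply: vgeD => //; last exact: vgeMr.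
  rewrite vgeN//; apply: vge_le (_ : _ <= i%:Z + i%:Z) _; first by lia.
  by apply: vgeM; rewrite ?vs.
- move=> a c b _ ht /andP[ua hb]; rewrite -(hM _ _ _ ht ua hb) count_map.
  by apply: eq_count => h /=; rewrite ua.
Qed.

Lemma step_family_lt i : odd m -> (i.*2 < l)%N ->
  (q ^ 3)%N%:R * prob (fun a _ b => ~~ vge v 1 a && vge v i.*2.+1%:Z b) =
  prob (fun a _ b => ~~ vge v 1 a && vge v i.*2%:Z b).
Proof.
move=> om il; rewrite -[RHS]mul1r; apply: (step_family (M := 1)) => //; first exact: ltnW.
move=> a c b ht ua hb; have [a0 _ _ _ [hl _]] := ht.
apply: (count_family_gt H) => //; last by apply: vge_le hl; lia.
by apply: (normal_triple_c H ht hb) => //; exact: ltnW.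
Qed.

Lemma step_family_eq i : odd m -> l = i.*2 ->
  (q ^ 3)%N%:R * prob (fun a _ b => ~~ vge v 1 a && vge v i.*2.+1%:Z b) =
  q.+1%:R * prob (fun a _ b => ~~ vge v 1 a && vge v i.*2%:Z b).
Proof.
move=> om il; apply: step_family => //; first by rewrite il.
move=> a c b ht ua hb; have [a0 _ _ _ [hl nl]] := ht; rewrite il in hl nl.
apply: (count_family_eq H) => //.
by apply: (normal_triple_c H ht hb) => //; rewrite il.
Qed.

(** Beyond l the valuation of c is exactly l / 2, so moving c by pi^(i - l/2) be shifts b linearly
    through q^2 residues. *)
Lemma step_translate i : odd m -> ~~ odd l -> (l < i)%N ->
  (q ^ 2)%N%:R * p i.+1 = p i.
Proof.
move=> om el li.
pose j := l./2; have jl : l = j.*2 by have := odd_double_half l; rewrite (negPf el).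
pose S := [seq (pi ^+ (i - j) * be, gam s eps kap (pi ^+ (i - j) * be) 0) | be <- T2].
have szS : size S = (q ^ 2)%N by rewrite size_map (size_T2 T eps kap) mulnn.
apply: (prob_step1 szS (mP_b i) (mP_b i.+1)).
- move=> _ /mapP[be beT ->]; split=> //=; first by rewrite om.
  + by apply: (gamP H); rewrite rmorph0.
  + exact: T2_int'.
  + by apply: (gam_int H) => //; exact: T2_int'.
- move=> a c b _ /mapP[be beT ->] /= [a0 _ _ _ _] ht' hb'; move: ht' hb'.
  set be' := _ * be; set ga := gam _ _ _ _ _ => ht' hb'.
  have [_ hc' _] := normal_triple_exact H ht' hb' (leqW li : (l < i.+1)%N).
  have hbe : vge v (i - j)%N%:Z be'.
    by rewrite -{1}(addn0 (i - j)%N) (vgeXK H); exact: (T2_int H).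
  have hNbe : vge v i%:Z (be' * s be').
    by apply: (vge_norm H _ hbe); rewrite /j; have := odd_double_half l; lia.
  have hga : vge v i%:Z ga.
    rewrite /ga /gam /skew mul0r addr0; apply: vgeMr => //; last exact: vge_kap H.
    by rewrite vgeN.
  rewrite (_ : b = (b - s be' * c + ga * a) + s be' * (c + be' * a) - be' * s be' * a - ga * a);
    last by ring.
  apply: vgeB => //; last exact: vgeMr.
  apply: vgeB => //; last exact: vgeMr.
  apply: vgeD => //; first by apply: vge_le hb'; lia.
  apply: vge_le (_ : _ <= (i - j)%N%:Z + j%:Z) _.
    by rewrite /j; have := odd_double_half l; lia.
  by apply: vgeM; rewrite ?vs.
- move=> a c b _ ht hb; have [_ hc nc] := normal_triple_exact H ht hb li.
  have [a0 _ _ _ _] := ht.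
  rewrite count_map /=.
  apply: (count_translate H _ _ hc nc hb); first by rewrite -/j; lia.
  by apply: vge_le a0; rewrite -/j; lia.
Qed.

(** With l = 0 and a a non-unit, the norm being a unit forces c to be one. The q^2 translations keep
    a, and exactly one makes b a non-unit. The swap identifies the mass of non-unit a with [p 1]. *)
Lemma step_unit_form : odd m -> l = 0%N ->
  (q ^ 2)%N%:R * prob (fun a _ b => vge v 1 a && vge v 1 b) = p 1.
Proof.
move=> om l0.
have hb1 a c b : normal_triple v s l a c b -> vge v 1 a -> ~~ vge v 1 c.
  rewrite l0 => -[a0 c0 b0 _ [_ nl]] ha; apply: contraNN nl => hc.
  apply: vgeD => //; last by apply: vgeMr; rewrite ?vs.
  by apply: vgeD => //; apply: vgeMr; rewrite ?vs.
have -> : p 1 = prob (fun a _ _ => vge v 1 a).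
  exact: esym (prob_swap (mP_b 1) (mP_a 1)).
pose S := [seq (pi ^+ (0 - 0) * be, gam s eps kap (pi ^+ (0 - 0) * be) 0) | be <- T2].
have szS : size S = (q ^ 2)%N by rewrite size_map (size_T2 T eps kap) mulnn.
apply: (prob_step1 szS (mP_a 1) (mP_and (mP_a 1) (mP_b 1))).
- move=> _ /mapP[be beT ->]; split=> //=; first by rewrite om.
  + by apply: (gamP H); rewrite rmorph0.
  + exact: T2_int'.
  + by apply: (gam_int H) => //; exact: T2_int'.
- by move=> a c b p _ _ _ /andP[].
- move=> a c b _ ht ha; have [a0 c0 b0 _ _] := ht.
  have ha' : vge v (0.*2%:Z + 1 - 0%:Z) a by exact: ha.
  rewrite count_map -(count_translate H (leqnn 0) ha' c0 (hb1 _ _ _ ht ha) b0)//.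
  by apply: eq_count => be /=; rewrite ha.
Qed.

(** The first step starts from unit a, of mass p 0 - p 1 by the swap, whence q + 1 in place of q:
    the number of isotropic lines of the residual hermitian plane. *)
Lemma mass_even : ~~ odd m ->
  [/\ (0 < l)%N -> q.+1%:R * p 1 = p 0,
      forall i, (0 < i < l)%N -> q%:R * p i.+1 = p i &
      forall i, (l < i)%N -> p i = 0].
Proof.
move=> em; split.
- move=> l0; have := step_skew l0 (introT orP (or_intror em)).
  rewrite prob_unit_b ?em ?orbT// (prob_ext (Q := fun a _ _ => ~~ vge v 1 a)).
    by rewrite prob_unit_a => h; rewrite -natr1 mulrDl mul1r h subrK.
  by move=> a c b _ [_ _ -> _ _]; rewrite andbT.
- move=> i /andP[i0 il]; rewrite -!prob_unit_b ?em ?orbT//.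
  by apply: step_skew => //; rewrite em orbT.
- move=> i li; rewrite pE; apply: prob_false => a c b /(_ em) -> ht.
  by apply/negP => /(normal_triple_even H ht); lia.
Qed.

(** Below l, odd steps use one skew parameter and even steps all q^3 translations; at i = l even the
    norm fibre contributes q + 1, and past l only be is left. For l > 0 the first step gives q^3 + 1
    for the same reason as with even m. *)
Lemma mass_odd : odd m ->
  [/\ (0 < l)%N -> (q ^ 3).+1%:R * p 1 = p 0,
      forall i, (0 < i < l)%N -> (if odd i then q else q ^ 3)%N%:R * p i.+1 = p i,
      odd l -> forall i, (l < i)%N -> p i = 0,
      ~~ odd l -> (0 < l)%N -> (q ^ 3)%:R * p l.+1 = q.+1%:R * p l &
      l = 0%N -> (q ^ 2 - q + 1)%:R * p 1 = p 0] /\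
  (~~ odd l -> forall i, (l < i)%N -> (q ^ 2)%N%:R * p i.+1 = p i).
Proof.
move=> om; have unit0 : prob (fun a _ b => ~~ vge v 1 a && vge v 0 b) = p 0 - p 1.
  rewrite -prob_unit_a; apply: prob_ext => a c b _ [_ _ -> _ _].
  by rewrite andbT.
split; last by move=> el i li; exact: step_translate.
split.
- move=> l0; have := step_family_lt (i := 0) om l0.
  rewrite prob_unit_b ?l0// unit0 => h.
  by rewrite -natr1 mulrDl mul1r h subrK.
- move=> i /andP[i0 il]; have l0 : (0 < l)%N by apply: leq_trans il.
  rewrite -!prob_unit_b ?l0//; case: ifPn => oi.
    by apply: step_skew => //; rewrite oi.
  have := odd_double_half i; rewrite (negPf oi) add0n => hi.
  by rewrite -{1 2}hi; apply: step_family_lt; rewrite ?hi.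
- move=> ol i li; rewrite pE; apply: prob_false => a c b _ ht.
  by apply/negP => hb; have [] := normal_triple_exact H ht hb li; rewrite ol.
- move=> el l0; have := odd_double_half l; rewrite (negPf el) add0n => hl.
  rewrite -!prob_unit_b ?l0//.
  by have := step_family_eq om (esym hl); rewrite hl.
- move=> l0.
  have h1 : (q ^ 3)%N%:R * prob (fun a _ b => ~~ vge v 1 a && vge v 1 b) =
      q.+1%:R * (p 0 - p 1).
    by rewrite -unit0; exact: (step_family_eq (i := 0)).
  have h2 := step_unit_form om l0.
  have h3 : p 1 = prob (fun a _ b => vge v 1 a && vge v 1 b) +
      prob (fun a _ b => ~~ vge v 1 a && vge v 1 b).
    rewrite pE (prob_split (mP_b 1) (mP_a 1)).
    by congr (_ + _); apply: prob_ext => a c b _ _; rewrite andbC.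
  have q0 : (0 < q)%N.
    have : has (fun t => vge v 1 (0 - t)) T by rewrite has_count (uq_repr H (rmorph0 s)).
    by case: (T).
  move: h1 h2 h3; set y := prob (fun a _ b => _ && _); set x := prob _.
  rewrite natrD natrB; last by rewrite expnS leq_pmulr// expn_gt0 q0.
  rewrite !natrX -natr1 => h1 h2 h3.
  have qn : q%:R + 1 != 0 :> R by rewrite natr1 pnatr_eq0.
  apply: (mulfI qn); move: h1 h2 h3; set Q := q%:R; move=> h1 h2 h3.
  exact: unit_form_mass h1 h2 h3.
Qed.

Let fI : (mu I < +oo)%E. Proof. exact: (mu_sub_lty hv vs inv hmu mI IK). Qed.

Let wb_int g : I g -> vge v 0 (wb g). Proof. by move=> /hI[]. Qed.

Let p_bound i : 0 <= p i <= p 0.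
Proof.
rewrite fine_ge0//= fine_le//.
- rewrite ge0_fin_numE//; apply: (mu_sub_lty hv vs inv hmu); first exact: mevent (mP_b i).
  by move=> g [/IK].
- rewrite ge0_fin_numE//; apply: (mu_sub_lty hv vs inv hmu); first exact: mevent (mP_b 0).
  by move=> g [/IK].
apply: le_measure; rewrite ?inE.
- exact: mevent (mP_b i).
- exact: mevent (mP_b 0).
by move=> g [Ig _]; split=> //; exact: wb_int.
Qed.

Let q_gt0 : (0 < q)%N.
Proof.
have : has (fun t => vge v 1 (0 - t)) T by rewrite has_count (uq_repr H (rmorph0 s)).
by case: (T).
Qed.

Lemma stratum_integral_even (t : R) : ~~ odd m -> 0 < t -> t < 1 ->
  (q%:R + 1) * (1 - t / q%:R) * \int[mu]_(g in I) vpow v t (wb g) =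
  ((q%:R - t / q%:R) + (1 - q%:R * (t / q%:R)) * (t / q%:R) ^+ l) * fine (mu I).
Proof.
move=> em t0 t1; have [h1 h2 h3] := mass_even em.
rewrite -tail_mass0; apply: tail_sum_even => //; first by rewrite ler1n.
- by move=> l0; rewrite natr1; exact: h1.
- exact: (power_integral_approx hv mI fI cwb wb_int t0 t1).
Qed.

Lemma stratum_integral_odd (t : R) : odd m -> 0 < t -> t < 1 ->
  (q%:R ^+ 3 + 1) * (1 - (t / q%:R ^+ 2) ^+ 2) * \int[mu]_(g in I) vpow v t (wb g) =
  (q%:R + t / q%:R ^+ 2) * (q%:R ^+ 2 - t / q%:R ^+ 2 +
    (q%:R ^+ 2 * (t / q%:R ^+ 2) - 1) * (- (t / q%:R ^+ 2)) ^+ l) * fine (mu I).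
Proof.
move=> om t0 t1; have [[h1 h2 h3 h4 h5] h6] := mass_odd om.
rewrite -tail_mass0; apply: tail_sum_odd => //; first by rewrite ler1n.
- by move=> l0; rewrite -natrX natr1; exact: h1.
- move=> i il; rewrite -(h2 i il) -natrX; by case: ifP.
- by move=> el l0; rewrite -natrX h4// natr1.
- move=> l0; rewrite -(h5 l0) natrD natrB ?natrX//.
  by rewrite expnS leq_pmulr// expn_gt0 q_gt0.
- by move=> el i li; rewrite -natrX; exact: h6.
- exact: (power_integral_approx hv mI fI cwb wb_int t0 t1).
Qed.

End Distribution.

Lemma exprz_le_of_ge (R : realType) (x : R) (n N : int) : 0 < x -> x <= 1 -> N <= n ->
  x ^ n <= x ^ N.
Proof.
move=> x0 x1 Nn; have xn : x != 0 by rewrite gt_eqF.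
have x0' := ltW x0.
rewrite -(subrK N n) expfzDr// -[leRHS]mul1r ler_wpM2r ?exprz_ge0//.
have -> : n - N = `|(n - N)%R|%N :> int by rewrite gez0_abs// subr_ge0.
by rewrite -exprnP exprn_ile1.
Qed.

Lemma lower_right_minor_irr (L : fieldType) (m i j : nat) (hi : (i <= m)%N)
    (hj : (j <= m)%N) (y : 'M[L]_m) : i = j ->
  lower_right_minor hi y = lower_right_minor hj y.
Proof. by move=> e; case: j / e hj => hj; rewrite (bool_irrelevance hi hj). Qed.

(** * Content of a triple *)

Section Content.
Variables (L : fieldType) (v : L -> int).

Definition vall N (a c b : L) := [&& vge v N a, vge v N c & vge v N b].

(* The minimum of the valuations; junk when a = c = b = 0. *)
Definition content (a c b : L) : int :=
  xget 0 [set n | vall n a c b && ~~ vall (n + 1) a c b].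

Lemma vall_le M N a c b : M <= N -> vall N a c b -> vall M a c b.
Proof. by move=> MN /and3P[h1 h2 h3]; apply/and3P; split; apply: vge_le MN _. Qed.

Lemma content_unique n a c b : vall n a c b -> ~~ vall (n + 1) a c b ->
  content a c b = n.
Proof.
move=> h1 h2; apply: xget_unique => /=; first by rewrite h1.
move=> k /andP[k1 k2]; apply/eqP; rewrite eq_le; apply/andP; split.
  rewrite leNgt; apply: contraNN h2 => nk; apply: vall_le k1; lia.
rewrite leNgt; apply: contraNN k2 => nk; apply: vall_le h1; lia.
Qed.

Lemma contentP a c b : (a != 0) || (c != 0) || (b != 0) ->
  vall (content a c b) a c b /\ ~~ vall (content a c b + 1) a c b.
Proof.
move=> nz.
have [n [h1 h2]] : exists n, vall n a c b /\ ~~ vall (n + 1) a c b.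
  pose N : int := - (`|v a| + `|v c| + `|v b|)%N%:Z.
  have hN : vall N a c b.
    by apply/and3P; split; apply: vge_le (vge_val v _); rewrite /N; lia.
  pose P k := ~~ vall (N + k.+1%:Z) a c b.
  have exP : exists k, P k.
    exists (2 * (`|v a| + `|v c| + `|v b|))%N; rewrite /P /vall !negb_and.
    case/orP: nz => [/orP[]|] h; rewrite (vgeE v _ h) /N.
    - by apply/orP; left; lia.
    - by apply/orP; right; apply/orP; left; lia.
    - by apply/orP; right; apply/orP; right; lia.
  case: (ex_minnP exP) => k Pk kmin; exists (N + k%:Z); split; last first.
    by move: Pk; rewrite /P -addrA -PoszD addn1.
  case: k Pk kmin => [|k] Pk kmin; first by rewrite addr0.
  by apply/negPn/negP => h; have := kmin k h; rewrite ltnn.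
by rewrite (content_unique h1 h2).
Qed.

End Content.

(** * Bounds on determinants and products *)

Section Bounds.
Variables (L : fieldType) (v : L -> int).
Hypothesis hv : normalized_valuation v.

Lemma vge_sign n (b : bool) : n <= 0 -> vge v n ((-1) ^+ b).
Proof.
move=> n0; apply: vge_le (n0) _; case: b; rewrite ?expr0 ?expr1 ?vgeN//; exact: vge1.
Qed.

Lemma vge_det n N (A : 'M[L]_n) : (forall i j, vge v N (A i j)) ->
  vge v (n%:Z * N) (\det A).
Proof.
move=> hA; apply: vge_sum => // p _; rewrite -[n%:Z * N]add0r; apply: vgeM => //.
  exact: vge_sign.
have e : size (index_enum 'I_n) = n by rewrite -sum1_size big_const_ord iter_addn_0 mul1n.
by rewrite -{1}e; exact: vge_prod.
Qed.

Lemma mx_bound m n (A : 'M[L]_(m, n)) : exists N : nat, forall i j, vge v (- N%:Z) (A i j).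
Proof.
exists (\sum_(ij : 'I_m * 'I_n) `|v (A ij.1 ij.2)|)%N => i j.
apply: vge_le (vge_val v _).
have : (`|v (A i j)| <= \sum_(ij : 'I_m * 'I_n) `|v (A ij.1 ij.2)|)%N.
  by rewrite (bigD1 (i, j))//= leq_addr.
lia.
Qed.

Lemma vge_mulmx (m n p : nat) (M N : int) (A : 'M[L]_(m, n)) (B : 'M[L]_(n, p)) :
  (forall i j, vge v M (A i j)) -> (forall i j, vge v N (B i j)) ->
  forall i j, vge v (M + N) ((A *m B) i j).
Proof. by move=> hA hB i j; rewrite mxE; apply: vge_sum => // l _; apply: vgeM. Qed.

End Bounds.

Lemma normrXz (F : numFieldType) (x : F) (n : int) : `|x ^ n| = `|x| ^ n.
Proof. by case: n => n; rewrite ?NegzE -?exprnN -?exprnP ?normfV normrX. Qed.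

(** * Strata *)

Lemma size_T_gt0 (L : fieldType) (v : L -> int) (s : {rmorphism L -> L})
    (T : seq L) (pi eps kap : L) :
  @unramified_quadratic L v s T pi eps kap -> (0 < size T)%N.
Proof.
move=> H; have : has (fun t => vge v 1 (0 - t)) T by rewrite has_count (uq_repr H (rmorph0 s)).
by case: (T).
Qed.

Section Strata.
Variables (R : realType) (L : fieldType) (v : L -> int) (s : {rmorphism L -> L}).
Variables (T : seq L) (pi eps kap : L).
Hypothesis H : @unramified_quadratic L v s T pi eps kap.
Let hv : normalized_valuation v := uq_val H.
Let inv : involutive s := uq_invol H.
Let vs := vgeS H.
Local Hint Resolve hv : core.
Hypothesis two_neq0 : (2 : L) != 0.

Variables (m r : nat) (hr : m./2 = r.+1).
Variable mu : {measure set (borel_mx v m) -> \bar R}.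
Local Notation K := (integralK s v (m := m)).
Hypothesis hmu : is_haar K mu.
Local Notation J := (antidiag L m).
Local Notation ct := (ct s).

Variables (x : 'M[L]_m) (W : 'M[L]_(m, r.+1)) (C : 'M[L]_(r.+1)).
Hypothesis xE : x = J - 2 *: (W *m C *m ct W).
Hypothesis CW : C *m (ct W *m J *m W) = 1%:M.

Variable il : 'I_(m./2).
Hypothesis hil : il = r :> nat.

Implicit Type g : 'M[L]_m.

Let Y g := g *m W.
Let hle1 : (r.+1 <= m)%N := half_le_small hr.
Let hle : (r <= m)%N := ltnW hle1.

Definition du g (i : 'I_(m./2)) : L := dmin i (herm_act s g x).
(** The minor d_(n-1), defined for n = 1 as well, where it is the empty determinant 1. *)
Definition dD g : L := lower_right_minor hle (herm_act s g x).
Let a_ g := ua hr (Y g).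
Let c_ g := uc hr (Y g).
Let b_ g := ub hr (Y g).

Let herm_actE g : K g -> herm_act s g x = J - 2 *: (Y g *m C *m ct (Y g)).
Proof.
move=> [ug _]; rewrite /herm_act xE mulmxBr mulmxBl -[conjtr s g]/(ct g) (unitaryG_inv ug).
by rewrite -scalemxAr -scalemxAl /Y ctM !mulmxA.
Qed.

Let c1 : L := (- 2) ^+ r.+1 * \det C.
Let c2 : L := (- 2) ^+ r * \det C.

Let detC : \det C != 0.
Proof.
apply/eqP => h; have := congr1 (fun A => \det A) CW.
by rewrite det_mulmx h mul0r det1 => /esym/eqP; rewrite oner_eq0.
Qed.

Let c1_neq0 : c1 != 0.
Proof. by rewrite mulf_neq0// expf_neq0// oppr_eq0. Qed.
Let c2_neq0 : c2 != 0.
Proof. by rewrite mulf_neq0// expf_neq0// oppr_eq0. Qed.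

(** Source of e in the functional equation: the constants of the last two minors differ by the
    factor -2. *)
Let vc1 : v c1 = v c2 + v 2.
Proof.
have n2 : (-2 : L) != 0 by rewrite oppr_eq0.
by rewrite /c1 exprS -mulrA -/c2 (Defs.valM hv n2 c2_neq0) (valN hv) addrC.
Qed.

Let du_last g : K g -> du g il = c1 * (b_ g * s (b_ g)).
Proof.
move=> Kg; rewrite /du /dmin (lower_right_minor_irr _ hle1) ?hil// herm_actE//.
exact: (minor_last s hr (Y g) C (b := ib hr)).
Qed.

Let ctM_ g : K g -> ct (Y g) *m J *m Y g = ct W *m J *m W.
Proof.
move=> [[_ ug] _]; rewrite /Y ctM -!mulmxA (mulmxA (ct g)) (mulmxA (ct g *m _)).
by rewrite -[ct g *m J *m g]/(conjtr s g *m J *m g) ug.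
Qed.

Let dD_form g : K g -> dD g != 0 ->
  hform s (a_ g) (c_ g) (b_ g) != 0 /\ dD g = c2 * hform s (a_ g) (c_ g) (b_ g).
Proof.
move=> Kg; rewrite /dD herm_actE// lower_right_minorE mxsub_herm// detZ => hD.
have hQ : \det (bot hr (Y g) *m C *m ct (bot hr (Y g))) != 0.
  by apply: contraNneq hD => e; rewrite /bot in e; rewrite e mulr0.
have hM : ct (ct W *m J *m W) = ct W *m J *m W.
  by rewrite !ctM ctK// ct_antidiag mulmxA.
have [e1 e2] := det_bordered inv hM (mulmx1C CW) hQ.
rewrite -(ctM_ Kg) form_uvec in e1 e2; split=> //.
by rewrite /c2 -mulrA (mulrC (\det C)) -/(bot hr (Y g)) e2.
Qed.

Let dD_neq0 g : (forall i, i != il -> du g i != 0) -> dD g != 0.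
Proof.
move=> h; have [r0|r0] := posnP r.
  rewrite /dD lower_right_minorE; move: (low_ord hle); rewrite r0 => f.
  by rewrite det_mx00 oner_neq0.
have ltr : (r.-1 < m./2)%N by rewrite hr; lia.
have := h (Ordinal ltr); rewrite /du /dmin (lower_right_minor_irr _ hle) /=; last lia.
by apply; rewrite -val_eqE /= hil; lia.
Qed.

Let dD_cases g : r = 0%N /\ dD g = 1 \/
  exists2 i : 'I_(m./2), i != il & i.+1 = r /\ dD g = du g i.
Proof.
have [r0|r0] := posnP r.
  left; split=> //; rewrite /dD lower_right_minorE; move: (low_ord hle); rewrite r0 => f.
  by rewrite det_mx00.
right; have ltr : (r.-1 < m./2)%N by rewrite hr; lia.
exists (Ordinal ltr); first by rewrite -val_eqE /= hil; lia.
split; first by rewrite /=; lia.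
by rewrite /du /dmin (lower_right_minor_irr _ hle) /=; last lia.
Qed.

Let cY : vcont_mx v Y.
Proof. by apply: vcont_mulmx => //; [exact: vcont_id|exact: vcont_cstmx]. Qed.

Let c_herm : vcont_mx v (fun g => herm_act s g x).
Proof.
apply: vcont_mulmx => //; last by apply: (vcont_ct vs); exact: vcont_id.
by apply: vcont_mulmx => //; [exact: vcont_id|exact: vcont_cstmx].
Qed.

Let c_minor (i : nat) (hi : (i <= m)%N) :
  vcont v (fun g => lower_right_minor hi (herm_act s g x)).
Proof.
apply: (vcont_ext (f1 := fun g => \det (mxsub (low_ord hi) (low_ord hi) (herm_act s g x)))).
  by move=> g; rewrite lower_right_minorE.
apply: vcont_det => // a b; apply: (vcont_ext _ (c_herm (low_ord hi a) (low_ord hi b))) => g.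
by rewrite [RHS]mxE.
Qed.

Let c_du i : vcont v (fun g => du g i). Proof. exact: c_minor. Qed.
Let c_dD : vcont v dD. Proof. exact: c_minor. Qed.

Let c_uvec i : vcont v (fun g => uvec hr (Y g) i).
Proof.
apply: vcont_det => // a b.
have [e|[a' e]] : (forall g, (col_mx (row i (Y g)) (bot hr (Y g)) : 'M[L]_(r.+1)) a b = Y g i b) \/
  exists a', forall g, (col_mx (row i (Y g)) (bot hr (Y g)) : 'M[L]_(r.+1)) a b = Y g a' b.
  rewrite -(splitK (a : 'I_(1 + r))); case: (fintype.split (a : 'I_(1 + r))) => a' /=.
    by left=> g; rewrite [LHS]col_mxEu mxE.
  by right; exists (low_ord (ltnW (half_le_small hr)) a') => g; rewrite [LHS]col_mxEd mxE.
- by apply: vcont_ext (cY i b) => g; rewrite e.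
- by apply: vcont_ext (cY a' b) => g; rewrite e.
Qed.

Let c_a : vcont v a_. Proof. exact: c_uvec. Qed.
Let c_b : vcont v b_. Proof. exact: c_uvec. Qed.
Let c_c : vcont v c_.
Proof.
rewrite /c_ /uc; case: (odd m); last exact: vcont_cst.
exact: c_uvec.
Qed.

(** Elements of K have integral entries, so the denominators are controlled by those of x and W. *)
Lemma exists_bound : exists N : nat, forall g, K g ->
  [/\ forall i, vge v (- N%:Z) (du g i), vge v (- N%:Z) (dD g) &
      vall v (- N%:Z) (a_ g) (c_ g) (b_ g)].
Proof.
have [Nx hx] := mx_bound v x; have [NW hW] := mx_bound v W.
exists (m * Nx + m * NW)%N => g [_ ig].
have hh : forall i j, vge v (- Nx%:Z) (herm_act s g x i j).
  move=> i j; rewrite -[- _]addr0; apply: vge_mulmx => //; last first.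
    by move=> i' j'; rewrite ctE vs.
  by move=> i' j'; rewrite -[- _]add0r; apply: vge_mulmx.
have hm i (hi : (i <= m)%N) : vge v (- (m * Nx + m * NW)%N%:Z) (lower_right_minor hi (herm_act s g x)).
  rewrite lower_right_minorE; apply: (vge_le (N := i%:Z * - Nx%:Z)); first by nia.
  by apply: vge_det => // a b; rewrite mxE.
have hY i j : vge v (- NW%:Z) (Y g i j).
  by rewrite -[- _]add0r; apply: vge_mulmx.
have hu i : vge v (- (m * Nx + m * NW)%N%:Z) (uvec hr (Y g) i).
  apply: (vge_le (N := r.+1%:Z * - NW%:Z)); first by have := hle1; nia.
  apply: vge_det => // a b.
  rewrite -(splitK (a : 'I_(1 + r))); case: (fintype.split (a : 'I_(1 + r))) => a' /=.
    by rewrite [X in vge v _ X]col_mxEu mxE.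
  by rewrite [X in vge v _ X]col_mxEd mxE.
split; [by move=> i; exact: hm|exact: hm|].
apply/and3P; split; [exact: hu| |exact: hu].
by rewrite /c_ /uc; case: (odd m); [exact: hu|exact: vge0].
Qed.

(** The part of K where the variables other than the last have well-defined exponents; on the rest
    of K the integrand is 0. *)
Definition regular g := [/\ K g, forall i, i != il -> du g i != 0 & dD g != 0].

(** Data preserved by the middle translations and the swap. The entry at [il] is frozen to 0 so that
    the last minor remains free on a stratum. *)
Definition stratum_key g : {ffun 'I_(m./2) -> int} * int * int :=
  ([ffun i => if i == il then 0 else v (du g i)], content v (a_ g) (c_ g) (b_ g), v (dD g)).

Definition stratum k : set (borel_mx v m) :=
  regular `&` [set g | stratum_key g = k].

Lemma measurable_regular : measurable (regular : set (borel_mx v m)).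
Proof.
have -> : (regular : set (borel_mx v m)) = K `&`
   (\bigcap_(i : 'I_(m./2)) (if i == il then setT else ~` [set g : borel_mx v m | du g i = 0])) `&`
   ~` [set g : borel_mx v m | dD g = 0].
  apply/seteqP; split=> g.
    move=> [Kg hd hD]; split; last by move=> /= e; rewrite e eqxx in hD.
    split=> // i _; case: eqP => //= /eqP ni e; by have := hd _ ni; rewrite e eqxx.
  move=> [[Kg hd] hD]; split=> //; last by apply/eqP.
  move=> i ni; have := hd i I; rewrite (negPf ni) /= => /eqP; done.
apply: measurableI; first apply: measurableI.
- exact: measurable_integralK.
- apply: fin_bigcap_measurable => // i _; case: ifP => // _.
  by apply: measurableC; exact: measurable_eq0.
- by apply: measurableC; exact: measurable_eq0.
Qed.

Let abc_neq0 g : regular g -> (a_ g != 0) || (c_ g != 0) || (b_ g != 0).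
Proof.
move=> [Kg _ hD]; have [+ _] := dD_form Kg hD; apply: contraNT.
rewrite !negb_or !negbK => /andP[/andP[/eqP -> /eqP ->] /eqP ->].
by rewrite /hform !rmorph0 !mulr0 !addr0.
Qed.

Let measurable_vall N :
  measurable ([set g | vall v N (a_ g) (c_ g) (b_ g)] : set (borel_mx v m)).
Proof.
have -> : ([set g | vall v N (a_ g) (c_ g) (b_ g)] : set (borel_mx v m)) =
  [set g | vge v N (a_ g)] `&` [set g | vge v N (c_ g)] `&` [set g | vge v N (b_ g)].
  by apply/seteqP; split=> g /=; [move=> /and3P[]|move=> [[h1 h2] h3]; apply/and3P].
by apply: measurableI; [apply: measurableI|]; apply: measurable_vge.
Qed.

Lemma measurable_stratum k : measurable (stratum k).
Proof.
case: k => [[a n] d].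
have -> : stratum (a, n, d) = regular `&`
   (\bigcap_(i : 'I_(m./2)) (if i == il then (if a i == 0 then setT else set0)
      else [set g : borel_mx v m | du g i != 0 /\ v (du g i) = a i])) `&`
   ([set g : borel_mx v m | vall v n (a_ g) (c_ g) (b_ g)] `\`
    [set g : borel_mx v m | vall v (n + 1) (a_ g) (c_ g) (b_ g)]) `&`
   [set g : borel_mx v m | dD g != 0 /\ v (dD g) = d].
  apply/seteqP; split=> g.
    move=> [rg [ea en ed]]; have [Kg hd hD] := rg.
    have [h1 h2] := contentP v (abc_neq0 rg).
    split; last by split.
    split; last by rewrite -en; split=> //; exact/negP.
    split=> // i _; have := congr1 (fun f : {ffun _} => f i) ea.
    rewrite ffunE; case: eqP => [_ <-|/eqP ni e]; first by rewrite eqxx.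
    by split=> //; exact: hd.
  move=> [[[rg ha] [h1 /negP h2]] [_ hd]]; split=> //=; rewrite /stratum_key hd.
  rewrite (content_unique h1 h2); congr (_, _, _); apply/ffunP => i; rewrite ffunE.
  by have := ha i I; case: eqP => _; [case: eqP|case].
apply: measurableI; [apply: measurableI; [apply: measurableI|]|].
- exact: measurable_regular.
- apply: fin_bigcap_measurable => // i _; case: ifP => _; first by case: ifP.
  exact: measurable_val.
- exact: measurableD.
- exact: measurable_val.
Qed.

Let wa k g := pi ^ (- k) * a_ g.
Let wc k g := pi ^ (- k) * c_ g.
Let wb k g := pi ^ (- k) * b_ g.

Let vge_scale_pi k N y : vge v N (pi ^ (- k) * y) = vge v (N + k) y.
Proof.
have p0 := pi_neq0 H; have [_ _ vp] := uq_pi H.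
rewrite -(vgeMK hv (N + k) y (expfz_neq0 (- k) p0)) (valXz hv)// vp mulr1.
by rewrite addrK.
Qed.

(* The valuation of the hermitian norm of the vector (a, c, b) made primitive. *)
Definition defect (k : {ffun 'I_(m./2) -> int} * int * int) : nat :=
  `|(k.2 - v c2 - 2 * k.1.2)%R|%N.

(** d_(n-1) is c2 times the norm of (a, c, b), and dividing the vector by pi^n, n its content,
    subtracts 2 n from the valuation of the norm. The result is nonnegative, so the absolute value
    in [defect] changes nothing on a nonempty stratum. *)
Let stratum_defect k g : stratum k g -> (defect k)%:Z = k.2 - v c2 - 2 * k.1.2 /\
  normal_triple v s (defect k) (wa k.1.2 g) (wc k.1.2 g) (wb k.1.2 g).
Proof.
move=> [rg]; case: k => [[a n] d] [ea en ed] /=; have [Kg hd hD] := rg.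
have [h1 h2] := contentP v (abc_neq0 rg); rewrite en in h1 h2.
have p0 := pi_neq0 H; have [_ _ vp] := uq_pi H.
have spn (k : int) : s (pi ^ k) = pi ^ k.
  by case: k => i; rewrite ?NegzE -?exprnN -?exprnP ?fmorphV rmorphXn /= (s_pi H).
have [e0 eD] := dD_form Kg hD.
have hf : hform s (wa n g) (wc n g) (wb n g) =
   pi ^ (- (2 * n)) * hform s (a_ g) (c_ g) (b_ g).
  rewrite /wa /wc /wb /hform !rmorphM /= !spn (_ : - (2 * n) = - n + - n); last by ring.
  by rewrite expfzDr//; ring.
have vD : v (hform s (a_ g) (c_ g) (b_ g)) = d - v c2.
  by rewrite -ed eD (Defs.valM hv)// addrAC subrr add0r.
have n0 : vall v 0 (wa n g) (wc n g) (wb n g).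
  by move: h1; rewrite /vall /wa /wc /wb !vge_scale_pi !add0r.
have hf0 : hform s (wa n g) (wc n g) (wb n g) != 0.
  by rewrite hf mulf_neq0// expfz_neq0.
have vf : v (hform s (wa n g) (wc n g) (wb n g)) = d - v c2 - 2 * n.
  by rewrite hf (Defs.valM hv) ?expfz_neq0// (valXz hv)// vp mulr1 vD addrC.
have [i1 i2 i3] := and3P n0.
have vf0 : 0 <= d - v c2 - 2 * n.
  rewrite -vf -(vgeE v _ hf0) /hform.
  by apply: vgeD => //; [apply: vgeD => //|]; apply: vgeMr; rewrite ?vs.
have dE : (defect (a, n, d))%:Z = d - v c2 - 2 * n by rewrite /defect /= gez0_abs.
split=> //; split=> //.
  move: h2; rewrite /vall /wa /wc /wb !vge_scale_pi => h2.
  by rewrite [1 + n]addrC.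
rewrite !vgeE// vf dE lexx; split=> //.
by rewrite -addn1 PoszD dE -ltNge ltrDl.
Qed.

Let vall_translate N be ga a c b : vge v 0 be -> vge v 0 ga ->
  vall v N a (c + be * a) (b - s be * c + ga * a) = vall v N a c b.
Proof.
move=> hb hg; rewrite /vall; have [ha|//] := boolP (vge v N a) => /=.
rewrite (vgeDl hv); last exact: vgeMl.
have [hc|//] := boolP (vge v N c) => /=.
rewrite (vgeDl hv); last exact: vgeMl.
by rewrite (vgeDl hv)// vgeN//; apply: vgeMl; rewrite ?vs.
Qed.

Let content_ext a c b a' c' b' :
  (forall N, vall v N a' c' b' = vall v N a c b) -> content v a' c' b' = content v a c b.
Proof. by move=> h; congr (xget _ _); apply/funext => n; rewrite /= !h. Qed.

(** The minors of order below n only see the last r rows of Y, which h fixes, and the content only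
    depends on [vall]. *)
Let stratum_invariant k h g (fa fc fb : L -> L -> L -> L) :
  middle_action v s hr h fa fc fb ->
  (forall N a c b, vall v N (fa a c b) (fc a c b) (fb a c b) = vall v N a c b) ->
  K g -> (stratum k (h *m g) <-> stratum k g).
Proof.
move=> [Kh hY hrow] hvall Kg.
have Khg : K (h *m g) by exact: integralK_mul.
have Yhg : Y (h *m g) = h *m Y g by rewrite /Y mulmxA.
have hmin i (hi : (i <= m)%N) : (i <= r)%N ->
    lower_right_minor hi (herm_act s (h *m g) x) = lower_right_minor hi (herm_act s g x).
  move=> ir; rewrite !herm_actE// !lower_right_minorE !mxsub_herm ?(leqW ir)//.
  by rewrite Yhg hrow.
have hdu i : i != il -> du (h *m g) i = du g i.
  move=> ni; apply: hmin; have := ltn_ord i; rewrite [X in (_ < X)%N]hr ltnS leq_eqVlt.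
  by case/orP => // /eqP e; case/eqP: ni; apply: val_inj; rewrite /= hil.
have hdD : dD (h *m g) = dD g by exact: hmin.
have hkey : stratum_key (h *m g) = stratum_key g.
  rewrite /stratum_key hdD; congr (_, _, _).
    by apply/ffunP => i; rewrite !ffunE; case: eqP => // /eqP ni; rewrite hdu.
  rewrite /a_ /b_ /c_ Yhg; have [-> -> ->] := hY (Y g); exact: content_ext.
rewrite /stratum /= hkey; split=> -[[_ h1 h2] h3]; split=> //; split=> //.
- by move=> i ni; rewrite -hdu// h1.
- by rewrite -hdD.
- by move=> i ni; rewrite hdu// h1.
- by rewrite hdD.
Qed.

Let cw k (f : 'M[L]_m -> L) : vcont v f -> vcont v (fun g => pi ^ (- k) * f g).
Proof. by move=> hf; apply: vcontM => //; exact: vcont_cst. Qed.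

Let stratum_sub k : stratum k `<=` K. Proof. by move=> g [[]]. Qed.

Let stratum_c_even k : ~~ odd m -> forall g, wc k g = 0.
Proof. by move=> em g; rewrite /wc /c_ /uc (negPf em) mulr0. Qed.

Let stratum_transl k be ga : (~~ odd m -> be = 0) ->
  ga + s ga + be * s be = 0 -> vge v 0 be -> vge v 0 ga ->
  exists2 h, K h & forall g, [/\ wa k.1.2 (h *m g) = wa k.1.2 g,
    wc k.1.2 (h *m g) = wc k.1.2 g + be * wa k.1.2 g,
    wb k.1.2 (h *m g) = wb k.1.2 g - s be * wc k.1.2 g + ga * wa k.1.2 g &
    K g -> (stratum k (h *m g) <-> stratum k g)].
Proof.
move=> h1 h2 h3 h4; have [h hh] := exists_translation hv inv vs hr h1 h2 h3 h4.
have [Kh hY _] := hh; exists h => // g.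
rewrite /wa /wb /wc /a_ /b_ /c_ (_ : Y (h *m g) = h *m Y g); last by rewrite /Y mulmxA.
have [-> -> ->] := hY (Y g); split; [by []|by ring|by ring|].
by apply: (stratum_invariant _ hh) => N a c b; exact: vall_translate.
Qed.

Let stratum_swap k : exists2 h, K h & forall g, [/\ wa k.1.2 (h *m g) = wb k.1.2 g,
    wc k.1.2 (h *m g) = wc k.1.2 g, wb k.1.2 (h *m g) = wa k.1.2 g &
    K g -> (stratum k (h *m g) <-> stratum k g)].
Proof.
have [h hh] := exists_swap s hv hr.
have [Kh hY _] := hh; exists h => // g.
rewrite /wa /wb /wc /a_ /b_ /c_ (_ : Y (h *m g) = h *m Y g); last by rewrite /Y mulmxA.
have [-> -> ->] := hY (Y g); split=> //.
apply: (stratum_invariant _ hh) => N a c b.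
by rewrite /vall; do 3 case: (vge _ _ _).
Qed.

Let fin_regular : (mu regular < +oo)%E.
Proof. by apply: (mu_sub_lty hv vs inv hmu measurable_regular) => g []. Qed.

Implicit Type X : 'I_(m./2) -> R.

Definition mono X g : R := \prod_(i | i != il) X i ^ v (du g i).

Definition integrand X g : R :=
  if [exists i, du g i == 0] then 0 else \prod_i X i ^ v (du g i).

(* Multiplies the variable attached to the minor [dD], i.e. to d_(n-1), if there is one. *)
Definition rescale (c : R) X (i : 'I_(m./2)) : R := if i.+1 == r then X i * c else X i.

(** The variable just before [il] carries the exponent v(dD); for n = 1 there is none, and dD = 1
    has valuation 0. *)
Lemma mono_rescale c X g : c != 0 -> (forall i, X i != 0) -> regular g ->
  mono (rescale c X) g = mono X g * c ^ v (dD g).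
Proof.
move=> c0 X0 _; have [[r0 ->]|[i0 ni [ir ->]]] := dD_cases g.
  rewrite (val1 hv) expr0z mulr1; apply: eq_bigr => i _.
  by rewrite /rescale r0.
rewrite /mono (bigD1 i0)//= [in RHS](bigD1 i0)//= /rescale ir eqxx.
rewrite expfzMl// -!mulrA; congr (_ * _); rewrite mulrC; congr (_ * _).
apply: eq_bigr => i /andP[_ nii]; rewrite -ir eqSS; case: eqP => // e.
by case/eqP: nii; exact: val_inj.
Qed.

Lemma mono_bound : exists N : int, forall X, (forall i, i != il -> X i != 0 /\ `|X i| <= 1) ->
  forall g, regular g -> `|mono X g| <= \prod_(i | i != il) `|X i| ^ N.
Proof.
have [N hN] := exists_bound; exists (- N%:Z) => X hX g [Kg hd _].
have [hdu _ _] := hN g Kg.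
rewrite normr_prod; apply: ler_prod => i ni; rewrite normr_ge0 /=.
have [X0 X1] := hX i ni; rewrite normrXz; apply: exprz_le_of_ge => //; first by rewrite normr_gt0.
by rewrite -(vgeE v _ (hd i ni)).
Qed.

Let mono_key X g : mono X g = \prod_(i | i != il) X i ^ (stratum_key g).1.1 i.
Proof. by apply: eq_bigr => i ni; rewrite ffunE (negPf ni). Qed.

Lemma measurable_mono X : measurable_fun (regular : set (borel_mx v m)) (mono X : borel_mx v m -> R).
Proof.
apply: (@measurable_fun_key _ (borel_mx v m) _ _ _ stratum_key _ _
  (fun k => \prod_(i | i != il) X i ^ k.1.1 i)); first exact: measurable_stratum.
by move=> g _; exact: mono_key.
Qed.

Let integrandE X g : X il != 0 -> regular g ->
  integrand X g = mono X g * (X il ^ v c1 * vpow v (X il ^+ 2) (b_ g)).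
Proof.
move=> t0 [Kg hd _]; rewrite /integrand /vpow.
have [e|n0] := eqVneq (b_ g) 0.
  rewrite !mulr0 ifT//; apply/existsP; exists il.
  by rewrite du_last// e mul0r mulr0.
have nb : b_ g * s (b_ g) != 0 by rewrite mulf_neq0// fmorph_eq0.
rewrite ifF; last first.
  apply/negbTE; rewrite negb_exists; apply/forallP => i.
  have [->|ni] := eqVneq i il; last exact: hd.
  by rewrite du_last// mulf_neq0.
rewrite (bigD1 il)//= mulrC; congr (_ * _); rewrite du_last// (Defs.valM hv)//.
rewrite (Defs.valM hv) ?fmorph_eq0// (uq_vals H) expfzDr//; congr (_ * _).
by rewrite expfzDr// expr2 expfzMl.
Qed.

(* The integrand after the last minor has been integrated out; the distribution of its
   valuation on a stratum, hence [clos], only depends on the defect. *)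
Definition weight (clos : nat -> R) X g : R :=
  mono X g * X il ^ (v (dD g) - (defect (stratum_key g))%:Z + v 2) *
  clos (defect (stratum_key g)).

Let weight_key clos X g : regular g -> weight clos X g =
  (\prod_(i | i != il) X i ^ (stratum_key g).1.1 i) *
    X il ^ (v c1 + 2 * (stratum_key g).1.2) * clos (defect (stratum_key g)).
Proof.
move=> rg; have sg : stratum (stratum_key g) g by [].
rewrite /weight mono_key; congr (_ * X il ^ _ * _).
by have [-> _] := stratum_defect sg; rewrite vc1 /=; ring.
Qed.

Lemma measurable_weight clos X :
  measurable_fun (regular : set (borel_mx v m)) (weight clos X : borel_mx v m -> R).
Proof.
apply: (@measurable_fun_key _ (borel_mx v m) _ _ _ stratum_key _ _
  (fun k => (\prod_(i | i != il) X i ^ k.1.1 i) * X il ^ (v c1 + 2 * k.1.2) *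
    clos (defect k))); first exact: measurable_stratum.
by move=> g; exact: weight_key.
Qed.

Let content_ge N g : regular g -> vall v (- N%:Z) (a_ g) (c_ g) (b_ g) ->
  - N%:Z <= (stratum_key g).1.2.
Proof.
move=> rg hN; have [_ h2] := contentP v (abc_neq0 rg).
by rewrite leNgt; apply: contraNN h2 => hlt; apply: vall_le hN; rewrite /= in hlt; lia.
Qed.

(** The first exponent is v c1 plus twice the content, and contents are bounded below on K. For the
    same reason l is at most v(dD) up to a constant, which gives the second bound; smallness of the
    variable of d_(n-1) will compensate the term 2 v(dD). *)
Lemma weight_exponents : exists N : nat, forall g, regular g ->
  let l := (defect (stratum_key g))%:Z in
  - N%:Z <= v (dD g) - l + v 2 /\ v (dD g) + l + v 2 <= 2 * v (dD g) + N%:Z.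
Proof.
have [N hN] := exists_bound; exists (`|v c2| + `|v 2| + 2 * N)%N => g rg l.
have [Kg _ _] := rg; have [_ _ hb] := hN g Kg.
have sg : stratum (stratum_key g) g by [].
have [lE _] := stratum_defect sg; 
have arith (d n l' e u : int) : l' = d - u - 2 * n -> - N%:Z <= n ->
    - (`|u| + `|e| + 2 * N)%N%:Z <= d - l' + e /\ d + l' + e <= 2 * d + (`|u| + `|e| + 2 * N)%N%:Z.
  by lia.
by apply: (arith _ (stratum_key g).1.2) => //; exact: content_ge.
Qed.

(** [cst] clears the denominator of the closed form. On one stratum everything but the power of the
    normalized b is constant, so the hypothesis there gives the identity; uniform bounds allow
    summation over the countably many strata. *)
Lemma Rintegral_integrand X (cst Bc : R) (clos : nat -> R) :
  (forall i, i != il -> X i != 0 /\ `|X i| <= 1) -> 0 < X il -> X il < 1 ->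
  (forall l, `|clos l| <= Bc) ->
  (forall k, cst * \int[mu]_(g in stratum k) vpow v (X il ^+ 2) (wb k.1.2 g) =
     clos (defect k) * fine (mu (stratum k))) ->
  cst * \int[mu]_(g in (K : set (borel_mx v m))) integrand X g =
  \int[mu]_(g in (regular : set (borel_mx v m))) weight clos X g.
Proof.
move=> hX t0 t1 hB hs.
have tn0 : X il != 0 by rewrite gt_eqF.
have tt0 : 0 < X il ^+ 2 by rewrite exprn_gt0.
have tt1 : X il ^+ 2 < 1 by rewrite exprn_ilt1 ?ltW.
have [N hN] := exists_bound; have [N' hN'] := mono_bound.
pose B1 := \prod_(i | i != il) `|X i| ^ N'.
have B1_ge0 : 0 <= B1 by apply: prodr_ge0 => i _; rewrite exprz_ge0.
have hB1 g : regular g -> `|mono X g| <= B1 by exact: hN'.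
pose F g := mono X g * (X il ^ v c1 * vpow v (X il ^+ 2) (b_ g)).
have mF : measurable_fun (regular : set (borel_mx v m)) (F : borel_mx v m -> R).
  apply: measurable_funM; first exact: measurable_mono.
  apply: measurable_funM; first exact: measurable_cst.
  exact: (measurable_vpow hv measurable_regular c_b).
pose B2 := X il ^ v c1 * (X il ^+ 2) ^ (- N%:Z).
have B2_ge0 : 0 <= B2 by rewrite mulr_ge0// exprz_ge0// ltW.
have bF g : regular g -> `|F g| <= B1 * B2.
  move=> rg; have [Kg _ _] := rg; have [_ _ /and3P[_ _ hb]] := hN g Kg.
  rewrite /F normrM ler_pM//; first exact: hB1.
  rewrite normrM ger0_norm ?exprz_ge0 ?(ltW t0)// ler_wpM2l ?exprz_ge0 ?(ltW t0)//.
  rewrite /vpow; case: eqVneq => [_|b0]; first by rewrite normr0 exprz_ge0// ltW.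
  rewrite ger0_norm ?exprz_ge0 ?(ltW tt0)//; apply: exprz_le_of_ge => //; first exact: ltW.
  by rewrite -(vgeE v _ b0).
have iF : mu.-integrable (regular : set (borel_mx v m)) (EFin \o (F : borel_mx v m -> R)).
  exact: (integrable_bounded measurable_regular fin_regular mF bF).
(* A point of K outside [regular] has a vanishing minor, and there the integrand is 0 by
   convention. *)
have -> : \int[mu]_(g in (K : set (borel_mx v m))) integrand X g =
    \int[mu]_(g in (regular : set (borel_mx v m))) F g.
  rewrite Rintegral_mkcond [RHS]Rintegral_mkcond; apply: eq_Rintegral => g _.
  rewrite !patchE; case: ifPn => hK; case: ifPn => hr'.
  - by rewrite integrandE//; exact: set_mem.
  - rewrite /integrand; case: ifP => // /negbT; rewrite negb_exists => /forallP hd.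
    case/negP: hr'; apply/mem_set; split; first exact: set_mem.
      by move=> i _; exact: hd.
    by apply: dD_neq0 => i _; exact: hd.
  - by case/negP: hK; apply/mem_set; have [] := set_mem hr'.
  - by [].
rewrite -RintegralZl//; last exact: measurable_regular.
pose B3 := B1 * X il ^ (v c1 - 2 * N%:Z) * Bc.
have bW g : regular g -> `|weight clos X g| <= B3.
  move=> rg; have [Kg _ _] := rg; have [_ _ hb] := hN g Kg.
  rewrite weight_key// -mono_key !normrM ler_pM ?mulr_ge0//.
  rewrite ler_pM//; first exact: hB1.
  rewrite ger0_norm ?exprz_ge0 ?(ltW t0)//; apply: exprz_le_of_ge => //; first exact: ltW.
  by rewrite lerD2l -mulrN ler_pM2l//; exact: content_ge.
have bcF g : regular g -> `|cst * F g| <= `|cst| * (B1 * B2).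
  by move=> rg; rewrite normrM ler_wpM2l// bF.
pose B := Num.max (`|cst| * (B1 * B2)) B3.
apply: (@Rintegral_strata _ (borel_mx v m) _ mu _ stratum_key _ _ _ B) => //.
- exact: measurable_regular.
- by apply: measurable_funM => //; exact: measurable_cst.
- exact: measurable_weight.
- by move=> g rg; rewrite le_max bcF.
- by move=> g rg; rewrite le_max bW// orbT.
- exact: measurable_stratum.
move=> k; rewrite -/(stratum k).
have [[Y0 [rY0 kY0]]|empty] := pselect (exists g, stratum k g); last first.
  have -> : stratum k = set0.
    by apply/seteqP; split=> // g hg; apply: empty; exists g.
  by rewrite !Rintegral_set0.
pose A := (\prod_(i | i != il) X i ^ k.1.1 i) * X il ^ (v c1 + 2 * k.1.2).
have fs : (mu (stratum k) < +oo)%E.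
  by apply: (mu_sub_lty hv vs inv hmu (measurable_stratum k)); exact: stratum_sub.
have wb0 g : stratum k g -> vge v 0 (wb k.1.2 g).
  by move=> /stratum_defect[_ []].
have iv : mu.-integrable (stratum k) (EFin \o (fun g => vpow v (X il ^+ 2) (wb k.1.2 g))).
  apply: (integrable_bounded (B := 1) (measurable_stratum k) fs).
    exact: (measurable_vpow hv (measurable_stratum k) (cw k.1.2 c_b)).
  by move=> g sg; apply: vpow_le1 => //; exact: wb0.
transitivity (\int[mu]_(g in stratum k) (cst * A * vpow v (X il ^+ 2) (wb k.1.2 g))).
  apply: eq_Rintegral => g /set_mem sg; have [rg kg] := sg.
  rewrite /F mono_key kg -mulrA; congr (_ * _); rewrite /A -mulrA; congr (_ * _).
  rewrite expfzDr// -mulrA; congr (_ * _).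
  have bE : b_ g = pi ^ k.1.2 * wb k.1.2 g.
    by rewrite /wb mulrA -expfzDr ?(pi_neq0 H)// subrr expr0z mul1r.
  have p0 := pi_neq0 H; have [_ _ vp] := uq_pi H.
  rewrite /vpow bE mulf_eq0 expfz_eq0 (negPf p0) andbF /=.
  case: eqVneq => [_|w0]; first by rewrite mulr0.
  rewrite (Defs.valM hv) ?expfz_neq0// (valXz hv)// vp mulr1 expfzDr ?gt_eqF//.
  by congr (_ * _); rewrite expr2 expfzMl -expfzDr// mulr2n mulrDl mul1r.
rewrite RintegralZl//; last exact: measurable_stratum.
transitivity (\int[mu]_(g in stratum k) (A * clos (defect k))).
  rewrite Rintegral_cst; last exact: measurable_stratum.
  by rewrite -[RHS]mulrA -hs; ring.
apply: eq_Rintegral => g /set_mem [rg kg].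
by rewrite weight_key// kg.
Qed.

Let stratum_normal k g : stratum k g ->
  normal_triple v s (defect k) (wa k.1.2 g) (wc k.1.2 g) (wb k.1.2 g).
Proof. by move=> /stratum_defect[]. Qed.

Lemma integral_even X : ~~ odd m ->
  (forall i, i != il -> X i != 0 /\ `|X i| <= 1) -> 0 < X il -> X il < 1 ->
  let Q := (size T)%:R in let U := X il ^+ 2 / Q in
  (Q + 1) * (1 - U) * \int[mu]_(g in (K : set (borel_mx v m))) integrand X g =
  \int[mu]_(g in (regular : set (borel_mx v m)))
    weight (fun l => (Q - U) + (1 - Q * U) * U ^+ l) X g.
Proof.
move=> em hX t0 t1 Q U.
have Q1 : 1 <= Q by rewrite ler1n; exact: (size_T_gt0 H).
have Q0 : 0 < Q by exact: lt_le_trans Q1.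
have U0 : 0 <= U by rewrite divr_ge0 ?exprn_ge0 ?(ltW t0) ?(ltW Q0).
have U1 : U <= 1.
  rewrite ler_pdivrMr// mul1r; apply: le_trans Q1.
  by rewrite exprn_ile1 ?(ltW t0) ?(ltW t1).
apply: (Rintegral_integrand (Bc := `|Q - U| + `|1 - Q * U|)) => //.
  move=> l; apply: le_trans (ler_normD _ _) _; rewrite lerD2l normrM ler_piMr//.
  by rewrite ger0_norm ?exprn_ge0 ?exprn_ile1.
move=> k; apply: (stratum_integral_even H hmu (cw k.1.2 c_a) (cw k.1.2 c_b)
  (measurable_stratum k) (@stratum_sub k) (@stratum_normal k) (@stratum_c_even k.1.2)
  (@stratum_transl k) (stratum_swap k)) => //.
- by rewrite exprn_gt0.
- by rewrite exprn_ilt1 ?(ltW t0).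
Qed.

Lemma integral_odd X : odd m ->
  (forall i, i != il -> X i != 0 /\ `|X i| <= 1) -> 0 < X il -> X il < 1 ->
  let Q := (size T)%:R in let S := X il ^+ 2 / Q ^+ 2 in
  (Q ^+ 3 + 1) * (1 - S ^+ 2) * \int[mu]_(g in (K : set (borel_mx v m))) integrand X g =
  \int[mu]_(g in (regular : set (borel_mx v m)))
    weight (fun l => (Q + S) * (Q ^+ 2 - S + (Q ^+ 2 * S - 1) * (- S) ^+ l)) X g.
Proof.
move=> om hX t0 t1 Q S.
have Q1 : 1 <= Q by rewrite ler1n; exact: (size_T_gt0 H).
have Q0 : 0 < Q ^+ 2 by rewrite exprn_gt0//; exact: lt_le_trans Q1.
have S0 : 0 <= S by rewrite divr_ge0 ?exprn_ge0 ?(ltW t0) ?(ltW Q0).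
have S1 : S <= 1.
  rewrite ler_pdivrMr// mul1r; apply: (@le_trans _ _ 1).
    by rewrite exprn_ile1 ?(ltW t0) ?(ltW t1).
  by rewrite exprn_ege1.
apply: (Rintegral_integrand (Bc := `|Q + S| * (`|Q ^+ 2 - S| + `|Q ^+ 2 * S - 1|))) => //.
  move=> l; rewrite normrM ler_wpM2l//; apply: le_trans (ler_normD _ _) _.
  rewrite lerD2l normrM ler_piMr// normrX normrN ger0_norm//.
  by rewrite exprn_ile1.
move=> k; apply: (stratum_integral_odd H hmu (cw k.1.2 c_a) (cw k.1.2 c_b)
  (measurable_stratum k) (@stratum_sub k) (@stratum_normal k) (@stratum_c_even k.1.2)
  (@stratum_transl k) (stratum_swap k)) => //.
- by rewrite exprn_gt0.
- by rewrite exprn_ilt1 ?(ltW t0).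
Qed.

End Strata.

(** * Continuation in the last variable *)

(* [f] has a power series expansion at 0, with the Cauchy estimates for the radius [r] *)
Definition expandable (R : realType) (r : R) (f : R -> R) : Prop :=
  exists (c : nat -> R) (B : R), forall t, 0 < `|t| -> `|t| < r -> forall J : nat,
    `|f t - \sum_(j < J) c j * t ^+ j| <= B * (`|t| / r) ^+ J.

Section Expandable.
Variables (R : realType) (r : R).
Hypothesis r_gt0 : 0 < r.

Lemma expandable_ext (f g : R -> R) : (forall t, 0 < `|t| -> `|t| < r -> f t = g t) ->
  expandable r f -> expandable r g.
Proof. by move=> h [c [B hc]]; exists c, B => t t0 t1 J; rewrite -h//; exact: hc. Qed.

Lemma expandableD f g : expandable r f -> expandable r g -> expandable r (fun t => f t + g t).
Proof.
move=> [c [B hc]] [c' [B' hc']]; exists (fun j => c j + c' j), (B + B') => t t0 t1 J.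
under eq_bigr do rewrite mulrDl; rewrite big_split /= opprD addrACA mulrDl.
by apply: le_trans (ler_normD _ _) _; apply: lerD; [exact: hc|exact: hc'].
Qed.

Lemma expandableZ a f : expandable r f -> expandable r (fun t => a * f t).
Proof.
move=> [c [B hc]]; exists (fun j => a * c j), (`|a| * B) => t t0 t1 J.
under eq_bigr do rewrite -mulrA; rewrite -mulr_sumr -mulrBr normrM -mulrA.
by apply: ler_wpM2l => //; exact: hc.
Qed.

Lemma expandableX f : expandable r f -> expandable r (fun t => t * f t).
Proof.
move=> [c [B hc]]; exists (fun j => if j is j'.+1 then c j' else 0), (B * r) => t t0 t1 [|J].
  rewrite big_ord0 subr0 expr0 mulr1 normrM mulrC.
  have := hc t t0 t1 0%N; rewrite big_ord0 subr0 expr0 mulr1 => h.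
  by apply: ler_pM => //; exact: ltW.
rewrite big_ord_recl /= mul0r add0r.
under eq_bigr do rewrite exprS mulrCA; rewrite -mulr_sumr -mulrBr normrM exprS.
rewrite (_ : B * r * _ = `|t| * (B * (`|t| / r) ^+ J)); last by field; rewrite gt_eqF.
by rewrite ler_wpM2l//; exact: hc.
Qed.

Lemma expandable_poly (p : {poly R}) f : expandable r f -> expandable r (fun t => p.[t] * f t).
Proof.
move=> hf; elim/poly_ind: p => [|p c ih].
  by apply: expandable_ext (expandableZ 0 hf) => t _ _; rewrite horner0.
apply: expandable_ext (expandableD (expandableX ih) (expandableZ c hf)) => t _ _.
by rewrite hornerMXaddC; ring.
Qed.

Lemma expandable1 : 1 < r -> expandable r (fun=> 1).
Proof.
move=> r1; exists (fun j => (j == 0%N)%:R), 1 => t t0 t1 [|J].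
  by rewrite big_ord0 subr0 expr0 normr1 mulr1.
rewrite big_ord_recl /= expr0 mulr1 big1 ?addr0 ?subrr ?normr0; last first.
  by move=> i _; rewrite mul0r.
by rewrite mul1r exprn_ge0// divr_ge0// ltW.
Qed.

(** If the earlier coefficients vanish, the estimate on (0, 1) bounds |c_J| by B t for every small
    t, so c_J = 0. With all coefficients zero, the Cauchy estimates bound f by a sequence tending to
    0. *)
Lemma expandable_eq0 f : 1 < r -> expandable r f -> (forall t, 0 < t -> t < 1 -> f t = 0) ->
  forall t, 0 < `|t| -> `|t| < r -> f t = 0.
Proof.
move=> r1 [c [B hc]] h0.
have B0 : 0 <= B.
  have h2 : `|1/2 : R| = 1/2 by rewrite ger0_norm//; lra.
  have := hc (1/2); rewrite h2 => h; have := h _ _ 0%N; rewrite expr0 mulr1.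
  by move=> h'; apply: le_trans (h' _ _) => //; lra.
have c0 J : c J = 0.
  elim/ltn_ind: J => J ih; apply/eqP; rewrite -normr_le0; apply/ler_addgt0Pl => e e0.
  rewrite addr0; pose t := Num.min (1/2) (e / (B + 1)).
  have t0 : 0 < t by rewrite lt_min; apply/andP; split; [lra|rewrite divr_gt0// ltr_wpDl].
  have t1 : t < 1 by rewrite gt_min; apply/orP; left; lra.
  have te : B * t <= e.
    apply: (@le_trans _ _ ((B + 1) * t)); first by rewrite ler_wpM2r; lra.
    by rewrite mulrC -ler_pdivlMr ?ge_min ?lexx ?orbT//; lra.
  have := hc t; rewrite gtr0_norm// => /(_ t0 (lt_trans t1 r1) J.+1).
  rewrite h0// big_ord_recr /= big1 => [|i _]; last by rewrite ih ?mul0r.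
  rewrite !add0r normrN normrM normrX (gtr0_norm t0) => h.
  have tJ : 0 < t ^+ J by rewrite exprn_gt0.
  rewrite -(ler_pM2r tJ); apply: (le_trans h).
  apply: (@le_trans _ _ (B * t ^+ J.+1)).
    apply: ler_wpM2l => //; apply: lerXn2r; rewrite ?nnegrE ?divr_ge0 ?(ltW t0) ?(ltW r_gt0)//.
    by rewrite ler_piMr ?(ltW t0)// invf_le1// ltW.
  by rewrite exprS mulrA ler_wpM2r// (ltW tJ).
move=> t t0 t1; apply/eqP; rewrite -normr_le0.
have tr : `|t| / r < 1 by rewrite ltr_pdivrMr// mul1r.
have hJ J : `|f t| <= B * (`|t| / r) ^+ J.
  by have := hc t t0 t1 J; rewrite big1 ?subr0// => i _; rewrite c0 mul0r.
have cv : (fun J => B * (`|t| / r) ^+ J) @ \oo --> (B * 0 : R).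
  by apply: cvgM; [exact: cvg_cst|apply: cvg_expr; rewrite normrM normr_id ger0_norm ?invr_ge0 ?ltW].
rewrite mulr0 in cv.
rewrite -(cvg_lim _ cv)//; apply: limr_ge; first exact: (cvgP _ cv).
by near=> J; exact: hJ.
Unshelve. all: by end_near.
Qed.

End Expandable.

(** The coefficients integrate G over the level sets of N, and the remainder of order J is the
    integral over N >= J, where |t|^N <= r^N (|t| / r)^J. *)
Lemma expandable_integral d (T : measurableType d) (R : realType)
    (mu : {measure set T -> \bar R}) (D : set T) (G : T -> R) (N : T -> nat) (B r : R) :
  0 < r -> measurable D -> (mu D < +oo)%E -> measurable_fun D G ->
  (forall h : nat -> R, measurable_fun D (h \o N)) ->
  (forall x, D x -> `|G x| * r ^+ N x <= B) ->
  expandable r (fun t => \int[mu]_(x in D) (G x * t ^+ N x)).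
Proof.
move=> r0 mD fD mG mN hB.
pose F (J : nat) t x := G x * (t ^+ N x * (J <= N x)%N%:R).
have mF J t : measurable_fun D (F J t).
  by apply: measurable_funM => //; exact: (mN (fun n => t ^+ n * (J <= n)%N%:R)).
have bF J t x : `|t| < r -> D x -> `|F J t x| <= B * (`|t| / r) ^+ J.
  move=> tr Dx; have t0 : 0 <= `|t| / r by rewrite divr_ge0// ltW.
  have t1 : `|t| / r <= 1 by rewrite ler_pdivrMr// mul1r ltW.
  have B0 : 0 <= B by apply: le_trans (hB x Dx); rewrite mulr_ge0// exprn_ge0// ltW.
  rewrite /F; case: leqP => JN; last by rewrite !mulr0 normr0 mulr_ge0// exprn_ge0.
  rewrite mulr1 normrM normrX.
  have -> : `|t| ^+ N x = r ^+ N x * (`|t| / r) ^+ N x.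
    by rewrite -exprMn mulrCA divff ?mulr1 ?gt_eqF.
  rewrite mulrA; apply: ler_pM; [by rewrite mulr_ge0// exprn_ge0// ltW| |exact: hB|].
    by rewrite exprn_ge0.
  by apply: ler_wiXn2l.
have iF J t : `|t| < r -> mu.-integrable D (EFin \o F J t).
  by move=> tr; apply: (integrable_bounded mD fD (mF J t)) => x Dx; exact: bF.
pose c j := \int[mu]_(x in D) (G x * (N x == j)%:R).
exists c, (B * fine (mu D)) => t t0 tr J.
have -> : \int[mu]_(x in D) (G x * t ^+ N x) - \sum_(j < J) c j * t ^+ j =
    \int[mu]_(x in D) F J t x.
  elim: J => [|J ih].
    by rewrite big_ord0 subr0; apply: eq_Rintegral => x _; rewrite /F leq0n mulr1.
  have mC : measurable_fun D (fun x => G x * (N x == J)%:R).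
    by apply: measurable_funM => //; exact: (mN (fun n => (n == J)%:R)).
  have bC x : D x -> `|G x * (N x == J)%:R| <= B / r ^+ J.
    move=> Dx; have rJ : 0 < r ^+ J by rewrite exprn_gt0.
    have := hB x Dx; case: eqP => [->|_] h; first by rewrite mulr1 ler_pdivlMr.
    rewrite mulr0 normr0 divr_ge0 ?(ltW rJ)//.
    by apply: le_trans h; rewrite mulr_ge0// exprn_ge0// ltW.
  rewrite big_ord_recr /= opprD addrA ih mulrC /c -RintegralZl//; last first.
    exact: (integrable_bounded mD fD mC bC).
  rewrite -RintegralB//; first last.
  - apply: (integrable_bounded (B := `|t ^+ J| * (B / r ^+ J)) mD fD).
      by apply: measurable_funM => //; exact: measurable_cst.
    by move=> x Dx; rewrite normrM ler_wpM2l// bC.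
  - exact: iF.
  apply: eq_Rintegral => x _; rewrite /F; case: (ltngtP J (N x)) => h.
  - by rewrite !mulr0 subr0.
  - by rewrite !mulr0 subr0.
  - by rewrite -h !mulr0 !mulr1 mulrC subrr.
rewrite mulrAC; apply: (Rintegral_le_bound mD fD (mF J t)) => x Dx; exact: bF.
Qed.

Definition upd (I : eqType) (A : Type) (X : I -> A) (i : I) (t : A) : I -> A :=
  fun j => if j == i then t else X j.

Section Continuation.
Variables (R : realType) (L : fieldType) (v : L -> int) (s : {rmorphism L -> L}).
Variables (T : seq L) (pi eps kap : L).
Hypothesis H : @unramified_quadratic L v s T pi eps kap.
Hypothesis two_neq0 : (2 : L) != 0.
Variables (m r : nat) (hr : m./2 = r.+1).
Variable mu : {measure set (borel_mx v m) -> \bar R}.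
Local Notation K := (integralK s v (m := m)).
Hypothesis hmu : is_haar K mu.
Variables (x : 'M[L]_m) (W : 'M[L]_(m, r.+1)) (C : 'M[L]_(r.+1)).
Hypothesis xE : x = antidiag L m - 2 *: (W *m C *m ct s W).
Hypothesis CW : C *m (ct s W *m antidiag L m *m W) = 1%:M.
Variable il : 'I_(m./2).
Hypothesis hil : il = r :> nat.

Implicit Types (g : 'M[L]_m) (X : 'I_(m./2) -> R).

Local Notation regular := (regular v s hr x il).
Local Notation key := (stratum_key v s hr x W il).
Local Notation dfc g := (defect v C (key g)).
Local Notation mon := (mono v s x il).
Local Notation wgt := (weight v s hr x W C il).

Lemma mono_upd X t g : mon (upd X il t) g = mon X g.
Proof. by apply: eq_bigr => i ni; rewrite /upd (negPf ni). Qed.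

Lemma measurable_key_fun (h : {ffun 'I_(m./2) -> int} * int * int -> R) :
  measurable_fun (regular : set (borel_mx v m)) (fun g : borel_mx v m => h (key g)).
Proof.
apply: (@measurable_fun_key _ (borel_mx v m) _ _ _ key _ _ h) => // k.
exact: (measurable_stratum H hr xE CW il k).
Qed.

(** The closed form produces two powers of t, with exponents v(dD) - l + v 2 and v(dD) + l + v 2,
    made nonnegative by t^N. At radius B the larger one costs B^(2 v(dD)) up to a constant, which
    the bound B^-2 on the variable of d_(n-1) absorbs. *)
Lemma expandable_weight (ka B : R) (a b : {poly R}) X :
  1 < B -> `|ka| <= 1 -> (forall i, X i != 0) ->
  (forall i, i != il -> `|X i| <= B ^- 2) ->
  exists N : nat, expandable B (fun t => t ^+ N *
    \int[mu]_(g in (regular : set (borel_mx v m)))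
      wgt (fun l => a.[t] + b.[t] * (ka * t ^+ 2) ^+ l) (upd X il t) g) /\
    forall t, 0 < `|t| -> `|t| < B ->
      mu.-integrable (regular : set (borel_mx v m)) (EFin \o (fun g =>
        wgt (fun l => a.[t] + b.[t] * (ka * t ^+ 2) ^+ l) (upd X il t) g)).
Proof.
move=> B1 ka1 X0 hX; have B0 : 0 < B by exact: lt_trans B1.
have BB : B ^- 2 <= 1 by rewrite invf_le1 ?exprn_gt0// exprn_ege1// ltW.
have [N hN] := weight_exponents H two_neq0 hr hmu xE CW hil; exists N.
have mreg := measurable_regular H hr x il.
have freg : (mu regular < +oo)%E.
  by apply: (mu_sub_lty (uq_val H) (vgeS H) (uq_invol H) hmu mreg) => g [].
have [N' hN'] := mono_bound R H two_neq0 hr x CW hil.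
pose n1 g := `|(v (dD s hr x g) - (dfc g)%:Z + v 2 + N%:Z)%R|%N.
pose n2 g := `|(v (dD s hr x g) + (dfc g)%:Z + v 2 + N%:Z)%R|%N.
have n1E g : regular g -> (n1 g)%:Z = v (dD s hr x g) - (dfc g)%:Z + v 2 + N%:Z.
  by move=> rg; have [h _] := hN g rg; rewrite /n1 gez0_abs// -lerBlDr sub0r.
have n2E g : regular g -> (n2 g)%:Z = v (dD s hr x g) + (dfc g)%:Z + v 2 + N%:Z.
  move=> rg; have [h _] := hN g rg; rewrite /n2 gez0_abs// -lerBlDr sub0r.
  by apply: (le_trans h); rewrite lerD2r lerD2l -subr_ge0 opprK addr_ge0.
have n12 g : regular g -> (n1 g <= n2 g)%N.
  move=> rg; rewrite -lez_nat n1E// n2E// !lerD2r lerD2l.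
  by rewrite -subr_ge0 opprK addr_ge0.
(* Moving B^2 into the variable of d_(n-1) produces exactly B^(2 v(dD)), and the rescaled variable
   is still bounded by 1. *)
pose D := (\prod_(i | i != il) `|rescale r (B ^+ 2) X i| ^ N') * B ^+ (2 * N).
have hD g : regular g -> `|mon X g| * B ^+ n2 g <= D.
  move=> rg; have BB0 : B ^+ 2 != 0 by rewrite gt_eqF// exprn_gt0.
  have := hN' (rescale r (B ^+ 2) X) _ g rg.
  rewrite (mono_rescale H two_neq0 CW hil BB0 X0 rg) normrM normrXz.
  rewrite (gtr0_norm (exprn_gt0 2 B0)) => h; rewrite /D.
  apply: (@le_trans _ _ (`|mon X g| * (B ^+ 2) ^ v (dD s hr x g) * B ^+ (2 * N))).
    rewrite -mulrA ler_wpM2l// [B ^+ 2]exprnP exprz_exp [X in X <= _]exprnP [X in _ <= _ * X]exprnP -expfzDr ?gt_eqF//.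
    apply: ler_weXz2l; first exact: ltW.
    have [_ h2] := hN g rg; rewrite n2E//.
    by apply: (@le_trans _ _ (2 * v (dD s hr x g) + N%:Z + N%:Z)); [rewrite lerD2r|rewrite -addrA lerD2l mul2n -addnn PoszD].
  apply: ler_wpM2r; first by rewrite exprn_ge0// ltW.
  apply: h => i ni; rewrite /rescale; case: (i.+1 == r).
    split; first by rewrite mulf_neq0.
    rewrite normrM (gtr0_norm (exprn_gt0 2 B0)).
    by rewrite -ler_pdivlMr ?exprn_gt0// div1r; exact: hX.
  by split=> //; exact: le_trans (hX i ni) BB.
have D0 g : regular g -> 0 <= D.
  by move=> rg; apply: le_trans (hD g rg); rewrite mulr_ge0// exprn_ge0// ltW.
have hD1 g : regular g -> `|mon X g| * B ^+ n1 g <= D.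
  move=> rg; apply: le_trans (hD g rg); apply: ler_wpM2l => //.
  by apply: ler_weXn2l; [exact: ltW|exact: n12].
have mm : measurable_fun (regular : set (borel_mx v m)) (mon X : borel_mx v m -> R).
  exact: (measurable_mono H xE CW).
have hn1 (h : nat -> R) : measurable_fun (regular : set (borel_mx v m)) (h \o (n1 : borel_mx v m -> nat)).
  exact: (measurable_key_fun (fun k => h `|(k.2 - (defect v C k)%:Z + v 2 + N%:Z)%R|%N)).
have hn2 (h : nat -> R) : measurable_fun (regular : set (borel_mx v m)) (h \o (n2 : borel_mx v m -> nat)).
  exact: (measurable_key_fun (fun k => h `|(k.2 + (defect v C k)%:Z + v 2 + N%:Z)%R|%N)).
pose G2 g := mon X g * ka ^+ dfc g.
have mG2 : measurable_fun (regular : set (borel_mx v m)) (G2 : borel_mx v m -> R).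
  by apply: measurable_funM => //; exact: (measurable_key_fun (fun k => ka ^+ defect v C k)).
have hG2 g : regular g -> `|G2 g| * B ^+ n2 g <= D.
  move=> rg; apply: le_trans (hD g rg); apply: ler_wpM2r; first by rewrite exprn_ge0// ltW.
  by rewrite normrM ler_piMr// normrX exprn_ile1.
have e1 := expandable_integral B0 mreg freg mm hn1 hD1.
have e2 := expandable_integral B0 mreg freg mG2 hn2 hG2.
pose F t g := a.[t] * (mon X g * t ^+ n1 g) + b.[t] * (G2 g * t ^+ n2 g).
have wE t g : t != 0 -> regular g ->
    wgt (fun l => a.[t] + b.[t] * (ka * t ^+ 2) ^+ l) (upd X il t) g = t ^- N * F t g.
  move=> tn0 rg; rewrite /weight mono_upd /upd eqxx.
  have t1E : t ^+ n1 g = t ^+ N * t ^ (v (dD s hr x g) - (dfc g)%:Z + v 2).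
    by rewrite exprnP n1E// expfzDr// mulrC.
  have t2E : t ^+ n2 g = t ^+ N * t ^ (v (dD s hr x g) - (dfc g)%:Z + v 2) * t ^+ (2 * dfc g).
    rewrite -mulrA exprnP n2E// expfzDr// mulrC; congr (_ * _).
    by rewrite [t ^+ (2 * _)]exprnP -expfzDr//; congr (_ ^ _); rewrite mul2n -addnn PoszD; ring.
  rewrite /F t1E t2E /G2 exprMn -exprM.
  have arith (A A' P M k t2 tN : R) : tN != 0 ->
      M * P * (A + A' * (k * t2)) = tN^-1 * (A * (M * (tN * P)) + A' * (M * k * (tN * P * t2))).
    by move=> tN0; field.
  by apply: arith; rewrite expf_neq0.
have int t (G : 'M[L]_m -> R) (n : 'M[L]_m -> nat) : `|t| < B ->
    measurable_fun (regular : set (borel_mx v m)) (G : borel_mx v m -> R) ->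
    (forall h : nat -> R, measurable_fun (regular : set (borel_mx v m)) (h \o (n : borel_mx v m -> nat))) ->
    (forall g, regular g -> `|G g| * B ^+ n g <= D) ->
    mu.-integrable (regular : set (borel_mx v m)) (EFin \o (fun g => G g * t ^+ n g)).
  move=> tB mG mn hGn; apply: (integrable_bounded (B := D) mreg freg).
    by apply: measurable_funM => //; exact: (mn (fun n => t ^+ n)).
  move=> g rg; apply: le_trans (hGn g rg); rewrite normrM normrX; apply: ler_wpM2l => //.
  by apply: lerXn2r; rewrite ?nnegrE ?(ltW B0)// ltW.
have scale (c : R) (f : borel_mx v m -> R) : mu.-integrable (regular : set (borel_mx v m)) (EFin \o f) ->
    mu.-integrable (regular : set (borel_mx v m)) (EFin \o (fun g => c * f g)).
  by move=> iF; apply: (eq_integrable mreg _ _ _ (integrableZl mreg c iF)) => g _ /=; rewrite EFinM.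
have i1 t (tB : `|t| < B) := int t _ _ tB mm hn1 hD1.
have i2 t (tB : `|t| < B) := int t _ _ tB mG2 hn2 hG2.
have iF t : `|t| < B -> mu.-integrable (regular : set (borel_mx v m)) (EFin \o F t).
  move=> tB; have h := integrableD mreg (scale a.[t] _ (i1 t tB)) (scale b.[t] _ (i2 t tB)).
  by apply: (eq_integrable mreg _ _ _ h) => g _ /=; rewrite EFinD.
split; last first.
  move=> t t0 tB; have tn0 : t != 0 by rewrite -normr_gt0.
  apply: (eq_integrable mreg _ _ _ (scale (t ^- N) _ (iF t tB))) => g /set_mem rg.
  by rewrite /= wE.
apply: (expandable_ext _ (expandableD (expandable_poly B0 a e1) (expandable_poly B0 b e2))) => t t0 tB.
have tn0 : t != 0 by rewrite -normr_gt0.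
rewrite -(RintegralZl a.[t] mreg (i1 t tB)) -(RintegralZl b.[t] mreg (i2 t tB)).
rewrite -(RintegralD mreg (scale a.[t] _ (i1 t tB)) (scale b.[t] _ (i2 t tB))).
transitivity (t ^+ N * (t ^- N * \int[mu]_(g in (regular : set (borel_mx v m))) F t g)).
  by rewrite mulrA mulfV ?mul1r// expf_neq0.
congr (_ * _); rewrite -(RintegralZl (t ^- N) mreg (iF t tB)).
by apply: eq_Rintegral => g /set_mem rg; rewrite wE.
Qed.

End Continuation.

(** * Laurent polynomials in each variable *)

Definition laurent (F : fieldType) (f : F -> F) : Prop :=
  exists (N : nat) (p : {poly F}), forall y, y != 0 -> f y = y ^- N * p.[y].

Section Laurent.
Variable F : fieldType.
Implicit Types f g : F -> F.

Lemma laurent_ext f g : (forall y, y != 0 -> f y = g y) -> laurent f -> laurent g.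
Proof. by move=> h [N [p hp]]; exists N, p => y y0; rewrite -h//; exact: hp. Qed.

Lemma laurent_cst c : laurent (fun=> c : F).
Proof. by exists 0%N, c%:P => y _; rewrite hornerC expr0 invr1 mul1r. Qed.

Lemma laurent_id : laurent (fun y : F => y).
Proof. by exists 0%N, 'X => y _; rewrite hornerX expr0 invr1 mul1r. Qed.

Lemma laurentV : laurent (fun y : F => y^-1).
Proof. by exists 1%N, 1 => y _; rewrite hornerC mulr1 expr1. Qed.

Lemma laurentD f g : laurent f -> laurent g -> laurent (fun y => f y + g y).
Proof.
move=> [N [p hp]] [M [q hq]]; exists (N + M)%N, ('X^M * p + 'X^N * q) => y y0.
by rewrite hp// hq// !hornerE exprD; field; rewrite !expf_neq0.
Qed.

Lemma laurentM f g : laurent f -> laurent g -> laurent (fun y => f y * g y).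
Proof.
move=> [N [p hp]] [M [q hq]]; exists (N + M)%N, (p * q) => y y0.
by rewrite hp// hq// hornerM exprD invfM mulrACA.
Qed.

Lemma laurentN f : laurent f -> laurent (fun y => - f y).
Proof.
move=> hf; apply: (laurent_ext _ (laurentM (laurent_cst (- 1)) hf)) => y _.
by rewrite mulN1r.
Qed.

Lemma laurentX f n : laurent f -> laurent (fun y => f y ^+ n).
Proof.
move=> hf; elim: n => [|n ih]; first by apply: (laurent_ext _ (laurent_cst 1)) => y _; rewrite expr0.
by apply: (laurent_ext _ (laurentM hf ih)) => y _; rewrite exprS.
Qed.

Lemma laurent_sum (I : Type) (s : seq I) (f : I -> F -> F) :
  (forall i, laurent (f i)) -> laurent (fun y => \sum_(i <- s) f i y).
Proof.
move=> hf; elim: s => [|a s ih].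
  by apply: (laurent_ext _ (laurent_cst 0)) => y _; rewrite big_nil.
by apply: (laurent_ext _ (laurentD (hf a) ih)) => y _; rewrite big_cons.
Qed.

Lemma laurent_prod (I : Type) (s : seq I) (f : I -> F -> F) :
  (forall i, laurent (f i)) -> laurent (fun y => \prod_(i <- s) f i y).
Proof.
move=> hf; elim: s => [|a s ih].
  by apply: (laurent_ext _ (laurent_cst 1)) => y _; rewrite big_nil.
by apply: (laurent_ext _ (laurentM (hf a) ih)) => y _; rewrite big_cons.
Qed.

Lemma laurent_meval n (P : mpoly.mpoly n F) (f : 'I_n -> F -> F) :
  (forall i, laurent (f i)) -> laurent (fun y => mpoly.meval (fun i => f i y) P).
Proof.
move=> hf; apply: (laurent_ext (fun y _ => esym (mpoly.mevalE (fun i => f i y) P))).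
apply: laurent_sum => mm; apply: laurentM; first exact: laurent_cst.
by apply: laurent_prod => i; exact: laurentX.
Qed.

Lemma laurent_eq0 f (u : nat -> F) : laurent f -> injective u -> (forall k, u k != 0) ->
  (forall k, f (u k) = 0) -> forall y, y != 0 -> f y = 0.
Proof.
move=> [N [p hp]] inj u0 hu y y0; rewrite hp//.
suff -> : p = 0 by rewrite horner0 mulr0.
apply/eqP; apply: contraT => p0.
have := max_poly_roots (rs := [seq u k | k <- iota 0 (size p)]) p0.
rewrite size_map size_iota ltnn => -> //; last by rewrite map_inj_uniq ?iota_uniq.
apply/allP => _ /mapP[k _ ->]; apply/rootP.
have := hu k; rewrite hp// => /eqP; rewrite mulf_eq0 invr_eq0 expf_eq0 (negPf (u0 k)) andbF /=.
by move/eqP.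
Qed.

(** Induction on the number of coordinates outside their grids: when one of them runs over its
    infinite grid, one fewer is bad, so E vanishes there and [laurent_eq0] applies. *)
Lemma laurent_multi_eq0 (I : finType) (E : (I -> F) -> F) (u : I -> nat -> F) :
  (forall Y i, laurent (fun y => E (upd Y i y))) ->
  (forall i, injective (u i)) -> (forall i k, u i k != 0) ->
  (forall kk : I -> nat, E (fun i => u i (kk i)) = 0) ->
  forall Y, (forall i, Y i != 0) -> E Y = 0.
Proof.
move=> hE inj u0 h0.
pose bad Y := [set i : I | ~~ `[< exists k, Y i = u i k >]]%SET.
suff h n : forall Y, (#|bad Y| <= n)%N -> (forall i, Y i != 0) -> E Y = 0.
  by move=> Y; exact: (h #|bad Y|).
elim: n => [|n ih] Y.
  rewrite leqn0 cards_eq0 => /eqP bY Y0.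
  have good i : exists k, Y i = u i k.
    apply/asboolP; apply: contraT => hi; have : i \in bad Y by rewrite inE.
    by rewrite bY inE.
  have [kk hk] := choice good.
  by rewrite (_ : Y = fun i => u i (kk i)) ?h0//; apply/funext.
move=> hn Y0; have [/eqP|[i hi]] := set_0Vmem (bad Y).
  by rewrite -cards_eq0 => /eqP e; apply: ih => //; rewrite e.
have := laurent_eq0 (hE Y i) (inj i) (u0 i) _ (Y0 i).
rewrite (_ : upd Y i (Y i) = Y); last first.
  by apply/funext => j; rewrite /upd; case: eqP => [->|].
apply=> k; apply: ih => [|j]; last by rewrite /upd; case: (j == i).
rewrite -ltnS; apply: (leq_trans _ hn); apply: proper_card; apply/properP; split.
  apply/fintype.subsetP => j; rewrite !inE /upd; case: eqP => [->|//].
  by move/asboolP; case; exists k.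
by exists i => //; rewrite !inE /upd eqxx negbK; apply/asboolP; exists k.
Qed.

End Laurent.

(** * Complex Laurent polynomials at real points *)

Section ComplexLaurent.
Variable R : realType.
Implicit Types f : R[i] -> R[i].

Lemma horner_real_complex (p : {poly R[i]}) : exists p1 p2 : {poly R},
  forall t : R, p.[t%:C%C] = (p1.[t] +i* p2.[t])%C.
Proof.
elim/poly_ind: p => [|p [a b] [p1 [p2 hp]]].
  by exists 0, 0 => t; rewrite !horner0.
exists (p1 * 'X + a%:P), (p2 * 'X + b%:P) => t; rewrite !hornerMXaddC hp.
by apply/eqP; rewrite eq_complex /= !mulr0 subr0 add0r !eqxx.
Qed.

Lemma real_complex_neq0 (t : R) : (t%:C%C != 0) = (t != 0).
Proof. by rewrite eq_complex /= eqxx andbT. Qed.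

Lemma laurent_real_complex f : laurent f -> exists (N : nat) (p1 p2 : {poly R}),
  forall t, t != 0 -> f t%:C%C = (t ^- N * p1.[t] +i* (t ^- N * p2.[t]))%C.
Proof.
move=> [N [p hp]]; have [p1 [p2 h]] := horner_real_complex p.
exists N, p1, p2 => t t0; rewrite hp ?real_complex_neq0// h -(rmorphXn (real_complex R)).
rewrite -(fmorphV (real_complex R)).
by apply/eqP; rewrite eq_complex /= !mul0r subr0 addr0 !eqxx.
Qed.

(** As h is real, the relation splits into real and imaginary parts. Clearing negative powers of t
    turns each part into an expandable function that vanishes on (0, 1). *)
Lemma laurent_continuation (r : R) N (h : R -> R) f g : 1 < r ->
  expandable r (fun t => t ^+ N * h t) -> laurent f -> laurent g ->
  (forall t : R, 0 < t -> t < 1 -> f t%:C%C * (h t)%:C%C = g t%:C%C) ->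
  forall t : R, 0 < `|t| -> `|t| < r -> f t%:C%C * (h t)%:C%C = g t%:C%C.
Proof.
move=> r1 eh /laurent_real_complex[a [f1 [f2 hf]]] /laurent_real_complex[b [g1 [g2 hg]]] hfg.
have r0 : 0 < r by exact: lt_trans r1.
have key (p q : {poly R}) : (forall t, 0 < t -> t < 1 -> t ^- a * p.[t] * h t = t ^- b * q.[t]) ->
    forall t, 0 < `|t| -> `|t| < r -> t ^- a * p.[t] * h t = t ^- b * q.[t].
  move=> hpq.
  have e : expandable r (fun t => ('X^b * p).[t] * (t ^+ N * h t) + (- 'X^(a + N) * q).[t] * 1).
    by apply: expandableD; apply: expandable_poly => //; exact: expandable1.
  have eE t : t != 0 -> ('X^b * p).[t] * (t ^+ N * h t) + (- 'X^(a + N) * q).[t] * 1 =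
      t ^+ (a + b + N) * (t ^- a * p.[t] * h t - t ^- b * q.[t]).
    have arith (A B C P Q U : R) : A != 0 -> B != 0 ->
        B * P * (C * U) + - (A * C) * Q * 1 = A * B * C * (A^-1 * P * U - B^-1 * Q).
      by move=> A0 B0; field; rewrite A0 B0.
    by move=> t0; rewrite !hornerM hornerN !hornerXn !exprD; apply: arith; rewrite expf_neq0.
  move=> t t0 tr; have tn0 : t != 0 by rewrite -normr_gt0.
  have := expandable_eq0 r0 r1 e _ t0 tr; rewrite eE// => e0; apply/eqP.
  have := e0 _; rewrite -subr_eq0 => /(_ _)/eqP; rewrite mulf_eq0 expf_eq0 (negPf tn0) andbF /=.
  by apply=> t' t'0 t'1; rewrite eE ?gt_eqF// hpq// subrr mulr0.
have hR t : t != 0 -> (f t%:C%C * (h t)%:C%C = g t%:C%C) <->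
   (t ^- a * f1.[t] * h t = t ^- b * g1.[t] /\ t ^- a * f2.[t] * h t = t ^- b * g2.[t]).
  move=> t0; rewrite hf// hg//; split=> [/eqP|[e1 e2]].
    by rewrite eq_complex /= !mulr0 subr0 add0r => /andP[/eqP -> /eqP ->].
  by apply/eqP; rewrite eq_complex /= !mulr0 subr0 add0r e1 e2 !eqxx.
move=> t t0 tr; have tn0 : t != 0 by rewrite -normr_gt0.
apply/(hR t tn0); split; apply: key => // t' t'0 t'1.
- by have [] := (hR t' (lt0r_neq0 t'0)).1 (hfg t' t'0 t'1).
- by have [] := (hR t' (lt0r_neq0 t'0)).1 (hfg t' t'0 t'1).
Qed.

End ComplexLaurent.

(** * Complex powers of q *)

Section ComplexPower.
Variable R : realType.
Implicit Types (a b : R) (s t : R[i]).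

Lemma cpowD a s t : cpow a (s + t) = cpow a s * cpow a t.
Proof.
case: s => s1 s2; case: t => t1 t2; rewrite /cpow /=.
rewrite mulrDl expRD mulrDl cosD sinD.
by apply/eqP; rewrite eq_complex /=; apply/andP; split; apply/eqP; ring.
Qed.

Lemma cpow0 a : cpow a 0 = 1 :> R[i].
Proof. by rewrite /cpow /= !mul0r expR0 cos0 sin0; apply/eqP; rewrite eq_complex /=; apply/andP; split; apply/eqP; ring. Qed.

Lemma cpow_neq0 a s : cpow a s != 0.
Proof.
apply/eqP => h; have := cpow0 a; rewrite -(subrr s) cpowD h mul0r => /esym/eqP.
by rewrite oner_eq0.
Qed.

Lemma cpowN a s : cpow a (- s) = (cpow a s)^-1.
Proof. by apply: (mulIf (cpow_neq0 a s)); rewrite -cpowD addNr cpow0 mulVf ?cpow_neq0. Qed.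

Lemma cpowMn a s (n : nat) : cpow a (s *+ n) = cpow a s ^+ n.
Proof. by elim: n => [|n ih]; rewrite ?mulr0n ?cpow0// mulrS exprS cpowD ih. Qed.

Lemma cpowMz a s (n : int) : cpow a (n%:~R * s) = cpow a s ^ n.
Proof.
rewrite mulrzl; case: n => n; first exact: cpowMn.
by rewrite NegzE -exprnN -cpowMn -cpowN mulrNz.
Qed.

Lemma cpowM a b s : 0 < a -> 0 < b -> cpow (a * b) s = cpow a s * cpow b s.
Proof.
move=> a0 b0; case: s => s1 s2; rewrite /cpow /= lnM ?posrE// mulrDr expRD mulrDr cosD sinD.
by apply/eqP; rewrite eq_complex /=; apply/andP; split; apply/eqP; ring.
Qed.

Lemma cpow1 s : cpow (1 : R) s = 1.
Proof. by rewrite /cpow ln1 !mulr0 expR0 cos0 sin0; apply/eqP; rewrite eq_complex /=; apply/andP; split; apply/eqP; ring. Qed.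

Lemma cpowXz a s (n : int) : 0 < a -> cpow (a ^ n) s = cpow a s ^ n.
Proof.
move=> a0; have hn (k : nat) : cpow (a ^+ k) s = cpow a s ^+ k.
  elim: k => [|k ih]; first by rewrite !expr0 cpow1.
  by rewrite !exprS cpowM ?exprn_gt0// ih.
case: n => n; first exact: hn.
rewrite NegzE -!exprnN; apply: (mulIf (expf_neq0 n.+1 (cpow_neq0 a s))).
by rewrite mulVf ?expf_neq0 ?cpow_neq0// -hn -cpowM ?invr_gt0 ?exprn_gt0// mulVf ?cpow1// gt_eqF// exprn_gt0.
Qed.

Variables (q : nat) (q1 : (1 < q)%N).

Let lnq : 0 < ln (q%:R : R).
Proof. by rewrite ln_gt0// ltr1n. Qed.
Let q0 : 0 < (q%:R : R). Proof. by rewrite ltr0n ltnW. Qed.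

Lemma qpow1 : qpow q 1 = (q%:R : R[i]).
Proof.
rewrite /qpow /cpow /= mul1r mul0r cos0 sin0 lnK ?posrE//.
by rewrite -(rmorph_nat (real_complex R)); apply/eqP; rewrite eq_complex /=; apply/andP; split; apply/eqP; ring.
Qed.

Lemma qpow_i : qpow q (0 +i* (pi / (2 * ln q%:R)))%C = 'i%C :> R[i].
Proof.
rewrite /qpow /cpow /= mul0r expR0.
have -> : pi / (2 * ln (q%:R : R)) * ln q%:R = pi / 2.
  by field; rewrite gt_eqF.
rewrite cos_pihalf sin_pihalf.
by apply/eqP; rewrite eq_complex /=; apply/andP; split; apply/eqP; ring.
Qed.

(** The absolute value of X fixes the real part of s, and a negative sign is an imaginary part pi /
    log q. Negative values occur because for odd m the reflection multiplies a coordinate by a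
    negative w. *)
Lemma qpow_surj (X : R) : X != 0 -> `|X| <= 1 ->
  exists s, 0 <= complex.Re s /\ qpow q s = (X^-1)%:C%C.
Proof.
move=> X0 X1; have aX : 0 < `|X| by rewrite normr_gt0.
exists ((- ln `|X| / ln q%:R) +i* (if X < 0 then pi / ln q%:R else 0))%C; split=> /=.
  by rewrite divr_ge0 ?(ltW lnq)// oppr_ge0 ln_le0.
rewrite /qpow /cpow /= divfK ?gt_eqF// expRN lnK ?posrE//.
case: ltP => hX.
  rewrite divfK ?gt_eqF// cospi sinpi ltr0_norm//.
  by apply/eqP; rewrite eq_complex /= invrN !mulr0 mul0r subr0 add0r mulrN1 opprK !eqxx.
rewrite mul0r cos0 sin0 ger0_norm//.
by apply/eqP; rewrite eq_complex /= !mulr0 mul0r subr0 add0r mulr1 !eqxx.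
Qed.

Lemma omega_real (L : fieldType) (v : L -> int) (s : {rmorphism L -> L}) (m : nat)
    (mu : {measure set (borel_mx v m) -> \bar R}) (x : 'M[L]_m)
    (z : 'I_(m./2) -> R[i]) (X : 'I_(m./2) -> R) :
  (forall i, qpow q (z i) = ((X i)^-1)%:C%C) ->
  omega q s mu x z =
    (\int[mu]_(g in (integralK s v : set (borel_mx v m))) integrand v s x X g)%:C%C.
Proof.
move=> hz.
have E g : omega_integrand q v z (herm_act s g x) = (integrand v s x X g)%:C%C.
  rewrite /omega_integrand /integrand /du; case: ifPn => [//|].
  rewrite negb_exists => /forallP hd; rewrite (rmorph_prod (real_complex R)).
  apply: eq_bigr => i _; rewrite /vabs (negPf (hd i)) cpowXz//.
  rewrite -/(qpow q (z i)) hz -exprz_inv -(fmorphV (real_complex R)) invrK.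
  by rewrite -(fmorphXz (real_complex R)).
rewrite /omega; congr (_ +i* _)%C; first by apply: eq_Rintegral => g _; rewrite E.
transitivity (\int[mu]_(g in (integralK s v : set (borel_mx v m))) (0 : R)).
  by apply: eq_Rintegral => g _; rewrite E.
by rewrite /Rintegral integral0_eq.
Qed.

End ComplexPower.

(** * The functional equation *)

Section LaurentUnit.
Variable F : fieldType.
Implicit Types f g : F -> F.

(** Invertible Laurent functions: the reflection divides by a coordinate, and w is raised to the
    integer power [v 2]. *)
Definition laurent_unit f := laurent f /\ laurent (fun y => (f y)^-1).

Lemma laurent_unit_cst c : laurent_unit (fun=> c : F).
Proof. by split; exact: laurent_cst. Qed.

Lemma laurent_unit_id : laurent_unit (fun y : F => y).
Proof. by split; [exact: laurent_id|exact: laurentV]. Qed.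

Lemma laurent_unitV f : laurent_unit f -> laurent_unit (fun y => (f y)^-1).
Proof. by move=> [h1 h2]; split=> //; apply: laurent_ext h1 => y _; rewrite invrK. Qed.

Lemma laurent_unitM f g : laurent_unit f -> laurent_unit g -> laurent_unit (fun y => f y * g y).
Proof.
move=> [f1 f2] [g1 g2]; split; first exact: laurentM.
by apply: laurent_ext (laurentM f2 g2) => y _; rewrite invfM.
Qed.

Lemma laurent_unitXz f (n : int) : laurent_unit f -> laurent_unit (fun y => f y ^ n).
Proof.
move=> [f1 f2]; have hp (k : nat) : laurent_unit (fun y => f y ^+ k).
  by split; [exact: laurentX|apply: laurent_ext (laurentX k f2) => y _; rewrite exprVn].
case: n => k; first exact: hp.
by have [h1 h2] := laurent_unitV (hp k.+1); split.
Qed.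

Lemma laurent_horner (p : {poly F}) f : laurent f -> laurent (fun y => p.[f y]).
Proof.
move=> hf; elim/poly_ind: p => [|p c ih].
  by apply: laurent_ext (laurent_cst 0) => y _; rewrite horner0.
apply: laurent_ext (laurentD (laurentM ih hf) (laurent_cst c)) => y _.
by rewrite hornerMXaddC.
Qed.

End LaurentUnit.

(** O is the integral over [regular] at a point and l e O the one at its reflection, tied to the
    fractions n / d and n' / d'. Elimination by multiplication never divides by O, d or d', which
    may vanish. *)
Lemma cross_elimination (F : fieldType) (c rho rho' e e' l gn gd O d d' n n' : F) :
  c != 0 -> rho' != 0 -> e * e' = 1 -> d * O = c * rho * n -> d' * (l * e * O) = c * rho' * n' ->
  l * rho * gd = gn * rho' -> gn * n * d' = gd * e' * n' * d.
Proof.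
move=> c0 r0 ee h1 h2 h3; apply: (mulfI (mulf_neq0 c0 r0)).
transitivity (c * (gn * rho') * n * d'); first by ring.
rewrite -h3; transitivity (l * gd * d' * (c * rho * n)); first by ring.
rewrite -h1; transitivity (gd * e' * d * (c * rho' * n')); last by ring.
rewrite -h2; transitivity (l * gd * d' * d * O * (e * e')); last by ring.
by rewrite ee mulr1; ring.
Qed.

(** * The reflection on real points and its algebraic extension *)

Section FunctionalEquation.
Variables (R : realType) (L : fieldType) (v : L -> int) (s : {rmorphism L -> L}).
Variables (T : seq L) (pi eps kap : L).
Hypothesis H : @unramified_quadratic L v s T pi eps kap.
Hypothesis two_neq0 : (2 : L) != 0.
Variables (m r : nat) (hr : m./2 = r.+1).
Variable mu : {measure set (borel_mx v m) -> \bar R}.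
Local Notation K := (integralK s v (m := m)).
Hypothesis hmu : is_haar K mu.
Variables (x : 'M[L]_m) (W : 'M[L]_(m, r.+1)) (C : 'M[L]_(r.+1)).
Hypothesis xE : x = antidiag L m - 2 *: (W *m C *m ct s W).
Hypothesis CW : C *m (ct s W *m antidiag L m *m W) = 1%:M.
Variable il : 'I_(m./2).
Hypothesis hil : il = r :> nat.

Implicit Types (g : 'M[L]_m) (X : 'I_(m./2) -> R) (Y : 'I_(m./2) -> R[i]).

Local Notation regular := (regular v s hr x il).
Local Notation key := (stratum_key v s hr x W il).
Local Notation wgt := (weight v s hr x W C il).

(* The substitution [tau] in the coordinates [X_i = q^(-s_i)]: the last one is inverted
   up to a constant and the previous one multiplied by [q^(2 z_n)]. *)
Definition flip (F : fieldType) (P : F) (X : 'I_(m./2) -> F) : 'I_(m./2) -> F :=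
  fun i => if i == il then P / X il
           else if i.+1 == r then X i * (X il ^+ 2 / P) else X i.

(** The reflection replaces t by t / w and multiplies the variable of d_(n-1) by w, so the powers
    w^v(dD) cancel. The power w^l is taken up by the symmetry of the closed form, and w^(- v 2)
    remains. *)
Lemma weight_flip (P la : R) (clos clos' : nat -> R) X g :
  P != 0 -> (forall i, X i != 0) -> regular g ->
  (forall l, clos' l * (X il ^+ 2 / P) ^+ l = la * clos l) ->
  wgt clos' (flip P X) g = la * (X il ^+ 2 / P) ^ (- v 2) * wgt clos X g.
Proof.
move=> P0 X0 rg hc; set t := X il; set w := t ^+ 2 / P.
have t0 : t != 0 by exact: X0.
have w0 : w != 0 by rewrite mulf_neq0 ?invr_eq0// expf_neq0.
have -> : flip P X = upd (rescale r w X) il (t / w).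
  apply/funext => i; rewrite /flip /upd /rescale; case: eqP => // _.
  by rewrite /w /t; field; rewrite P0 X0.
rewrite /weight mono_upd (mono_rescale H two_neq0 CW hil w0 X0 rg) /upd eqxx -/t.
set l := defect _ _ _; set d := v (dD _ _ _ _).
have -> : (t / w) ^ (d - l%:Z + v 2) = t ^ (d - l%:Z + v 2) * ((w ^ d)^-1 * w ^ l%:Z * w ^ (- v 2)).
  rewrite expfzMl -exprz_inv; congr (_ * _); rewrite !expfzDr ?invr_eq0// !exprz_inv opprK.
  by rewrite -invr_expz.
have := hc l; rewrite -/w -/t; set c' := clos' l => e.
have arith (A B D wd wl : R) : wd != 0 ->
    A * wd * (B * (wd^-1 * wl * D)) * c' = A * B * D * (c' * wl) by move=> wd0; field.
rewrite arith ?expfz_neq0// e.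
by move: (mono _ _ _ _ _ _) (t ^ _) (w ^ _) => A B D; ring.
Qed.

Variables (Wr : ratfun R m./2) (q : nat).
Hypothesis q1 : (1 < q)%N.
Hypothesis hW : continues q (omega q s mu x) Wr.

Local Notation num Y := (mpoly.meval Y (rf_num Wr)).
Local Notation den Y := (mpoly.meval Y (rf_den Wr)).
Local Notation cinv X := (fun i => ((X i)^-1)%:C%C).

Lemma continues_integral X : (forall i, X i != 0 /\ `|X i| <= 1) ->
  den (cinv X) * (\int[mu]_(g in (K : set (borel_mx v m))) integrand v s x X g)%:C%C = num (cinv X).
Proof.
move=> hX; have [z hz] := choice (fun i => qpow_surj q1 (hX i).1 (hX i).2).
have := hW (fun i => (hz i).1); rewrite /num_at /den_at.
have -> : (fun i => qpow q (z i)) = cinv X by apply/funext => i; rewrite (hz i).2.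
by rewrite (omega_real q1 s mu x (fun i => (hz i).2)).
Qed.

Variables (P c : R) (al be rho gn gd : {poly R}) (la : R -> R).
Hypothesis P1 : 2 <= `|P|.
Hypothesis c_neq0 : c != 0.
Hypothesis hint : forall X, (forall i, i != il -> X i != 0 /\ `|X i| <= 1) ->
  0 < X il -> X il < 1 -> let w := X il ^+ 2 / P in
  c * rho.[w] * \int[mu]_(g in (K : set (borel_mx v m))) integrand v s x X g =
  \int[mu]_(g in (regular : set (borel_mx v m))) wgt (fun l => al.[w] + be.[w] * w ^+ l) X g.
(** Inverting w exchanges [al] and [be] up to a common factor [la]; comparing [la] with the
    denominators [rho] leaves [gn] / [gd], the inverse of gamma. *)
Hypothesis hsym : forall w : R, w != 0 -> `|w| < 1 ->
  [/\ al.[w^-1] = la w * be.[w], be.[w^-1] = la w * al.[w], rho.[w^-1] != 0 &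
      la w * rho.[w] * gd.[w] = gn.[w] * rho.[w^-1]].

Let P_neq0 : P != 0.
Proof. by rewrite -normr_gt0; apply: lt_le_trans P1; rewrite ltr0n. Qed.

(** Large enough to contain both a point slightly above 1 and its reflection P / X_il, of absolute
    value below |P|. *)
Let B : R := `|P| + 1.
Let Omega X := \int[mu]_(g in (regular : set (borel_mx v m)))
  wgt (fun l => al.[X il ^+ 2 / P] + be.[X il ^+ 2 / P] * (X il ^+ 2 / P) ^+ l) X g.

Let B_gt1 : 1 < B. Proof. by rewrite /B; move: P1; set p := `|P| => ?; lra. Qed.

Let wpoly : {poly R} := P^-1 *: 'X^2.
Let wpolyE t : wpoly.[t] = t ^+ 2 / P. Proof. by rewrite hornerZ hornerXn mulrC. Qed.

Let upd_id X t : X il = t -> upd X il t = X.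
Proof. by move=> <-; apply/funext => i; rewrite /upd; case: eqP => [->|]. Qed.

Lemma Omega_integrable X : (forall i, X i != 0) -> (forall i, i != il -> `|X i| <= B ^- 2) ->
  `|X il| < B ->
  mu.-integrable (regular : set (borel_mx v m)) (EFin \o (fun g =>
     wgt (fun l => al.[X il ^+ 2 / P] + be.[X il ^+ 2 / P] * (X il ^+ 2 / P) ^+ l) X g)).
Proof.
move=> X0 hX hB; have P1' : `|P^-1| <= 1.
  by rewrite normfV invf_le1 ?normr_gt0// (le_trans _ P1)// ler1n.
have [N [_ h]] := expandable_weight H two_neq0 hr hmu xE CW hil (al \Po wpoly) (be \Po wpoly)
  B_gt1 P1' X0 hX.
have := h (X il); rewrite normr_gt0 X0 upd_id// !horner_comp !wpolyE => h'.
by move: (h' isT hB); under [X in EFin \o X]eq_fun do rewrite (mulrC P^-1).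
Qed.

(** For 0 < X_il < 1 this combines [hint] with the defining property of [Wr]. As a relation between
    power series and Laurent polynomials in X_il it extends up to B, past the range in which [Wr] is
    tied to the integral. *)
Lemma continuation X : (forall i, X i != 0) -> (forall i, i != il -> `|X i| <= B ^- 2) ->
  `|X il| < B ->
  den (cinv X) * (Omega X)%:C%C = (c * rho.[X il ^+ 2 / P])%:C%C * num (cinv X).
Proof.
move=> X0 hX hB; have P1' : `|P^-1| <= 1.
  by rewrite normfV invf_le1 ?normr_gt0// (le_trans _ P1)// ler1n.
have B0 : 0 < B by exact: lt_trans B_gt1.
have BB : B ^- 2 <= 1 by rewrite invf_le1 ?exprn_gt0// exprn_ege1// ltW.
have [N [h _]] := expandable_weight H two_neq0 hr hmu xE CW hil (al \Po wpoly) (be \Po wpoly)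
  B_gt1 P1' X0 hX.
have {}h : expandable B (fun t => t ^+ N * Omega (upd X il t)).
  apply: (expandable_ext _ h) => t _ _; congr (_ * _); apply: eq_Rintegral => g _.
  have tE : upd X il t il = t by rewrite /upd eqxx.
  by rewrite !horner_comp !wpolyE tE (mulrC P^-1).
have lY : forall i, laurent (fun y : R[i] => upd (cinv X) il y^-1 i).
  move=> i; rewrite /upd; case: (i == il); first exact: laurentV.
  exact: laurent_cst.
pose f (y : R[i]) := den (upd (cinv X) il y^-1).
pose rhoC := map_poly (real_complex R) (c *: (rho \Po wpoly)).
pose G (y : R[i]) := rhoC.[y] * num (upd (cinv X) il y^-1).
have lf : laurent f by exact: laurent_meval.
have lG : laurent G.
  apply: laurentM; last exact: laurent_meval.
  by exists 0%N, rhoC => y _; rewrite expr0 invr1 mul1r.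
have updE (t : R) : upd (cinv X) il (t%:C%C)^-1 = cinv (upd X il t).
  apply/funext => i; rewrite /upd; case: (i == il) => //.
  by rewrite -(fmorphV (real_complex R)).
have GE (t : R) : G t%:C%C = (c * rho.[t ^+ 2 / P])%:C%C * num (cinv (upd X il t)).
  by rewrite /G updE /rhoC horner_map /= hornerZ horner_comp wpolyE.
have hfG (t : R) : 0 < t -> t < 1 -> f t%:C%C * (Omega (upd X il t))%:C%C = G t%:C%C.
  move=> t0 t1; rewrite GE /f updE.
  have hX1 i : i != il -> upd X il t i != 0 /\ `|upd X il t i| <= 1.
    by move=> ni; rewrite /upd (negPf ni); split=> //; exact: le_trans (hX i ni) BB.
  have tE : upd X il t il = t by rewrite /upd eqxx.
  have := hint hX1; rewrite tE => /(_ t0 t1) /= e.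
  rewrite /Omega tE -e rmorphM mulrCA; congr (_ * _).
  apply: continues_integral => i; have [->|ni] := eqVneq i il; last exact: hX1.
  by rewrite tE gt_eqF// gtr0_norm// ltW.
have := laurent_continuation B_gt1 h lf lG hfG _ hB; rewrite normr_gt0 X0 => /(_ isT).
by rewrite GE /f updE upd_id.
Qed.

(** X_il > 1 puts the reflected coordinate below |P|, and X_il^2 < 2 <= |P| gives |w| < 1, so
    [continuation] applies at the point and at its reflection. *)
Lemma real_identity X : (forall i, X i != 0) -> (forall i, i != il -> `|X i| <= B ^- 2) ->
  1 < X il -> X il ^+ 2 < 2 -> let w := X il ^+ 2 / P in
  (gn.[w])%:C%C * num (cinv X) * den (cinv (flip P X)) =
  (gd.[w] * w ^ v 2)%:C%C * num (cinv (flip P X)) * den (cinv X).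
Proof.
move=> X0 hX t1 t2 w; set t := X il.
have t0 : 0 < t by exact: lt_trans t1.
have w0 : w != 0 by rewrite mulf_neq0 ?invr_eq0// expf_neq0.
have w1 : `|w| < 1.
  rewrite normrM normfV ltr_pdivrMr ?normr_gt0// mul1r; apply: lt_le_trans P1.
  by rewrite ger0_norm// sqr_ge0.
have tB : `|t| < B.
  rewrite gtr0_norm//; apply: (@lt_trans _ _ (t ^+ 2)); last first.
    by apply: (lt_le_trans t2); apply: (le_trans P1); rewrite lerDl.
  by rewrite expr2 ltr_pMl.
have X'0 i : flip P X i != 0.
  rewrite /flip; case: (i == il); first by rewrite mulf_neq0 ?invr_eq0.
  by case: (i.+1 == r) => //; exact: (mulf_neq0 (X0 i) w0).
have hX' i : i != il -> `|flip P X i| <= B ^- 2.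
  move=> ni; rewrite /flip (negPf ni); case: (i.+1 == r); last exact: hX.
  by rewrite normrM; apply: le_trans (hX i ni); rewrite ler_piMr// ltW.
have X'il : flip P X il = P / t by rewrite /flip eqxx.
have t'B : `|flip P X il| < B.
  rewrite X'il normrM normfV (gtr0_norm t0) ltr_pdivrMr//.
  apply: (@lt_trans _ _ B); first by rewrite /B ltrDl.
  by rewrite ltr_pMr// (lt_trans _ B_gt1).
have w'E : flip P X il ^+ 2 / P = w^-1.
  by rewrite X'il /w -/t; field; rewrite P_neq0 gt_eqF.
have [s1 s2 s3 s4] := hsym w0 w1.
have OE : Omega (flip P X) = la w * w ^ (- v 2) * Omega X.
  rewrite /Omega -(RintegralZl _ (measurable_regular H hr x il) (Omega_integrable X0 hX tB)).
  apply: eq_Rintegral => g /set_mem rg; apply: weight_flip => // l.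
  rewrite w'E -/w s1 s2 mulrDl mulrDr addrC exprVn; congr (_ + _); first by field; rewrite expf_neq0.
  by rewrite mulrA.
have c1 := continuation X0 hX tB; have := continuation X'0 hX' t'B.
rewrite OE w'E -/w in c1 *.
move=> c2; move: (den (cinv X)) (den (cinv (flip P X))) (num (cinv X)) (num (cinv (flip P X))) c1 c2.
move=> d d' n n'; rewrite !rmorphM /= => c1 c2.
have C_neq0 (y : R) : y != 0 -> y%:C%C != 0 by rewrite real_complex_neq0.
have ww : (w ^ (- v 2))%:C%C * (w ^ v 2)%:C%C = 1 :> R[i].
  by rewrite -rmorphM -expfzDr// addNr expr0z.
have := congr1 (real_complex R) s4; rewrite !rmorphM /= => s4'.
exact: (cross_elimination (C_neq0 _ c_neq0) (C_neq0 _ s3) ww c1 c2 s4').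
Qed.

Lemma complex_identity Y : (forall i, Y i != 0) ->
  let w := (Y il ^+ 2 * P%:C%C)^-1 in let Y' := flip (P^-1)%:C%C Y in
  (map_poly (real_complex R) gn).[w] * num Y * den Y' =
  (map_poly (real_complex R) gd).[w] * w ^ v 2 * num Y' * den Y.
Proof.
move=> Y0 /=; apply/eqP; rewrite -subr_eq0; apply/eqP.
pose wY Y := (Y il ^+ 2 * P%:C%C)^-1 : R[i].
pose E Y := (map_poly (real_complex R) gn).[wY Y] * num Y * den (flip (P^-1)%:C%C Y) -
  (map_poly (real_complex R) gd).[wY Y] * wY Y ^ v 2 * num (flip (P^-1)%:C%C Y) * den Y.
have B0 : 0 < B by exact: lt_trans B_gt1.
(* Injective sequences of admissible values: 1 + 1/(k+4) exceeds 1 and its square is at most 25/16 <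
   2, while 1/(B^2 + k) is at most B^-2. *)
pose Xr (i : 'I_(m./2)) (k : nat) : R :=
  if i == il then 1 + (k.+4)%:R^-1 else (B ^+ 2 + k%:R)^-1.
have Xr0 i k : 0 < Xr i k.
  rewrite /Xr; case: (i == il); first by rewrite addr_gt0// invr_gt0 ltr0n.
  by rewrite invr_gt0 ltr_pwDl ?exprn_gt0.
apply: (@laurent_multi_eq0 _ _ E (fun i k => ((Xr i k)^-1)%:C%C)) => //.
- move=> Z i; have hc j : laurent_unit (fun y : R[i] => upd Z i y j).
    by rewrite /upd; case: (j == i); [exact: laurent_unit_id|exact: laurent_unit_cst].
  have hw : laurent_unit (fun y => wY (upd Z i y)).
    apply: laurent_unitV; apply: laurent_unitM; last exact: laurent_unit_cst.
    exact: (laurent_unitXz 2 (hc il)).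
  have hf j : laurent_unit (fun y => flip (P^-1)%:C%C (upd Z i y) j).
    rewrite /flip; case: (j == il).
      by apply: laurent_unitM; [exact: laurent_unit_cst|exact: laurent_unitV].
    case: (j.+1 == r) => //; apply: laurent_unitM => //.
    apply: laurent_unitM; last exact: laurent_unit_cst.
    exact: (laurent_unitXz 2 (hc il)).
  have l1 (p : mpoly.mpoly m./2 R[i]) : laurent (fun y => mpoly.meval (upd Z i y) p).
    by apply: laurent_meval => j; have [] := hc j.
  have l2 (p : mpoly.mpoly m./2 R[i]) :
      laurent (fun y => mpoly.meval (flip (P^-1)%:C%C (upd Z i y)) p).
    by apply: laurent_meval => j; have [] := hf j.
  have [w1 _] := hw; have [w2 _] := laurent_unitXz (v 2) hw.
  have hg p := laurent_horner p w1.
  apply: laurentD; first by apply: laurentM => //; apply: laurentM.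
  by apply: laurentN; apply: laurentM => //; apply: laurentM => //; apply: laurentM.
- move=> i k k' /(@complexI R)/invr_inj; rewrite /Xr; case: (i == il).
    by move=> /addrI/invr_inj/eqP; rewrite eqr_nat => /eqP[].
  by move=> /invr_inj/addrI/eqP; rewrite eqr_nat => /eqP.
- by move=> i k; rewrite real_complex_neq0 invr_eq0 gt_eqF.
move=> kk; pose X i := Xr i (kk i).
have X0 i : X i != 0 by rewrite (gt_eqF (Xr0 _ _)).
have hX i : i != il -> `|X i| <= B ^- 2.
  move=> ni; rewrite /X /Xr (negPf ni) ger0_norm ?invr_ge0 ?addr_ge0 ?exprn_ge0 ?(ltW B0)//.
  by rewrite lef_pV2 ?posrE ?exprn_gt0// ?lerDl// ltr_pwDl ?exprn_gt0.
have k4 : ((kk il).+4%:R : R)^-1 <= 4^-1.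
  by rewrite lef_pV2 ?posrE ?ltr0n// ler_nat.
have k0 : 0 < ((kk il).+4%:R : R)^-1 by rewrite invr_gt0 ltr0n.
have XE : X il = 1 + (kk il).+4%:R^-1 by rewrite /X /Xr eqxx.
have t1 : 1 < X il by rewrite XE ltrDl.
have t2 : X il ^+ 2 < 2 by rewrite XE; move: k4 k0; set y := _^-1 => ? ?; nra.
have := real_identity X0 hX t1 t2; rewrite /E.
have -> : flip (P^-1)%:C%C (cinv X) = cinv (flip P X).
  apply/funext => i; rewrite /flip; case: (i == il).
    by rewrite -!(fmorphV (real_complex R)) -(rmorphM (real_complex R)) invfM invrK mulrC.
  case: (i.+1 == r) => //.
  rewrite -(rmorphXn (real_complex R)) -(fmorphV (real_complex R)) -!(rmorphM (real_complex R)).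
  by congr (_%:C)%C; rewrite exprVn [RHS]invfM [in RHS]invfM.
have -> : wY (cinv X) = (X il ^+ 2 / P)%:C%C.
  rewrite /wY -(rmorphXn (real_complex R)) -(rmorphM (real_complex R)) -(fmorphV (real_complex R)).
  by congr (_%:C)%C; rewrite exprVn invfM invrK.
move=> e; rewrite !horner_map /= -(fmorphXz (real_complex R)) -(rmorphM (real_complex R)).
by rewrite e subrr.
Qed.

End FunctionalEquation.

(** * The reflection in the variables z *)

Section ChangeOfVariables.
Variables (R : realType) (q m : nat).
Hypothesis q1 : (1 < q)%N.
Hypothesis hm : (2 <= m)%N.
Local Notation il := (last_index hm).
Implicit Type z : 'I_(m./2) -> R[i].

Let q_neq0 : (q%:R : R[i]) != 0.
Proof. by rewrite pnatr_eq0 -lt0n ltnW. Qed.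

(** The constant P with q^(-2 s_n) = P q^(2 z_n): the shift 1/2 in s_n gives q, and the shift 1 - i
    pi / (2 log q) gives (q / i)^2 = - q^2. *)
Definition flip_const : R[i] := if odd m then - q%:R ^+ 2 else q%:R.

Lemma qpowD (a b : R[i]) : qpow q (a + b) = qpow q a * qpow q b.
Proof. exact: cpowD. Qed.

Lemma qpowN (a : R[i]) : qpow q (- a) = (qpow q a)^-1.
Proof. exact: cpowN. Qed.

Lemma qpow_neq0 (a : R[i]) : qpow q a != 0. Proof. exact: cpow_neq0. Qed.

Lemma half_half : m./2 = (m./2.-1).+1.
Proof. by case: m hm => [|[|k]]. Qed.

Lemma s_of_z_last z : s_of_z q z il = if odd m
  then - z il - 1 + (0 +i* (pi / (2 * ln q%:R)))%C else - z il - 2^-1.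
Proof. by rewrite /s_of_z insubF//= -half_half ltnn. Qed.

Let sqr_qpow_half : qpow q 2^-1 ^+ 2 = q%:R :> R[i].
Proof.
rewrite -cpowMn -(qpow1 R q1); congr qpow.
by rewrite -[LHS]mulr_natl divff// pnatr_eq0.
Qed.

Lemma qpow_double_last z :
  (qpow q (s_of_z q z il) ^+ 2 * flip_const)^-1 = qpow q (2 * z il).
Proof.
have -> : qpow q (2 * z il) = qpow q (z il) ^+ 2 by rewrite mulr_natl; exact: cpowMn.
rewrite s_of_z_last /flip_const.
case: ifP => _; rewrite !(qpowD, qpowN) ?qpow1 ?qpow_i//.
  have arith (a b i : R[i]) : a != 0 -> b != 0 -> i ^+ 2 = -1 ->
      ((a^-1 * b^-1 * i) ^+ 2 * - b ^+ 2)^-1 = a ^+ 2.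
    by move=> a0 b0 i2; rewrite !exprMn i2; field; rewrite a0 b0.
  by apply: arith => //; [exact: qpow_neq0|exact: sqr_i].
have arith (a b h : R[i]) : a != 0 -> b != 0 -> h ^+ 2 = b -> ((a^-1 * h^-1) ^+ 2 * b)^-1 = a ^+ 2.
  by move=> a0 b0 hb; rewrite exprMn [h^-1 ^+ 2]exprVn hb; field; rewrite a0 b0.
by apply: arith => //; exact: qpow_neq0.
Qed.

(** [tau] changes s_n and, through its term z_n, also s_(n-1): the two special cases of [flip]. The
    constant is inverted because the coordinates here are q^(s_i), the inverses of the X_i. *)
Lemma flip_qpow z : flip m./2.-1 il flip_const^-1 (fun i => qpow q (s_of_z q z i)) =
  (fun i => qpow q (s_of_z q (tau hm z) i)).
Proof.
have w := qpow_double_last z.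
apply/funext => i; rewrite /flip; have [->|ni] := eqVneq i il.
  rewrite s_of_z_last [in RHS]s_of_z_last /tau eqxx /flip_const opprK.
  case: ifP => _; rewrite !(qpowD, qpowN) ?qpow1 ?qpow_i//.
    have arith (a b u : R[i]) : a != 0 -> b != 0 -> u ^+ 2 = -1 ->
        (- b ^+ 2)^-1 / (a^-1 * b^-1 * u) = a * b^-1 * u.
      move=> a0 b0 u2; have u0 : u != 0 by rewrite -sqrf_eq0 u2 oppr_eq0 oner_eq0.
      have uV : u^-1 = - u by apply: (mulIf u0); rewrite mulVf// mulNr -expr2 u2 opprK.
      by rewrite [(_ * u)^-1]invfM uV; field; rewrite a0 b0.
    by apply: arith => //; [exact: qpow_neq0|exact: sqr_i].
  have arith (a b h : R[i]) : a != 0 -> b != 0 -> h ^+ 2 = b -> b^-1 / (a^-1 * h^-1) = a * h^-1.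
    move=> a0 b0 hb; have h0 : h != 0 by rewrite -sqrf_eq0 hb.
    by rewrite -hb; field; rewrite a0 h0.
  by apply: arith => //; exact: qpow_neq0.
have -> : qpow q (s_of_z q z il) ^+ 2 / flip_const^-1 = (qpow q (2 * z il))^-1.
  by rewrite -w !invrK.
rewrite /s_of_z; case: insubP => [j _ ej|hi]; last first.
  case/eqP: ni; apply: val_inj => /=; have := ltn_ord i; lia.
rewrite [in RHS]/tau (negPf ni) /tau -val_eqE /= ej.
case: eqP => e.
  have -> : z j = z il by congr z; apply: val_inj; rewrite /= ej.
  have -> : qpow q (2 * z il) = qpow q (z il) ^+ 2 by rewrite mulr_natl; exact: cpowMn.
  rewrite !(qpowD, qpowN); move: (qpow q (z il)) (qpow_neq0 (z il)) (qpow q (z i)) (qpow_neq0 (z i)) => a a0 b b0.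
  by field; rewrite a0 b0 qpow_neq0.
by [].
Qed.

End ChangeOfVariables.

Lemma size_T_gt1 (L : fieldType) (v : L -> int) (s : {rmorphism L -> L})
    (T : seq L) (pi eps kap : L) :
  @unramified_quadratic L v s T pi eps kap -> (1 < size T)%N.
Proof.
move=> H; have hv := uq_val H; have h0 := uq_repr H (rmorph0 s) (vge0 v 0).
have v1 : vge v 0 1 by rewrite vgeE ?oner_neq0// (val1 hv).
have h1 := uq_repr H (rmorph1 s) v1.
case: T h0 h1 {H} => [//|a [|//]] /=; rewrite !addn0 => h0 h1.
have : vge v 1 (1 - a - (0 - a)).
  by apply: vgeB => //; [move: h1|move: h0]; case: (vge v 1 _).
by rewrite opprB addrA subrK subr0 vgeE ?oner_neq0// (val1 hv).
Qed.

(** * The two closed forms *)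

Section Parity.
Variables (R : realType) (L : fieldType) (v : L -> int) (s : {rmorphism L -> L}).
Variables (T : seq L) (pi eps kap : L).
Hypothesis H : @unramified_quadratic L v s T pi eps kap.
Hypothesis two_neq0 : (2 : L) != 0.
Variables (m r : nat) (hr : m./2 = r.+1).
Variable mu : {measure set (borel_mx v m) -> \bar R}.
Hypothesis hmu : is_haar (integralK s v (m := m)) mu.
Variables (x : 'M[L]_m) (W : 'M[L]_(m, r.+1)) (C : 'M[L]_(r.+1)).
Hypothesis xE : x = antidiag L m - 2 *: (W *m C *m ct s W).
Hypothesis CW : C *m (ct s W *m antidiag L m *m W) = 1%:M.
Variable il : 'I_(m./2).
Hypothesis hil : il = r :> nat.
Variable Wr : ratfun R m./2.
Local Notation q := (size T).
Hypothesis hW : continues q (omega q s mu x) Wr.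
Variable Y : 'I_(m./2) -> R[i].
Hypothesis Y0 : forall i, Y i != 0.

Local Notation num Y := (mpoly.meval Y (rf_num Wr)).
Local Notation den Y := (mpoly.meval Y (rf_den Wr)).

Let q1 : (1 < q)%N := size_T_gt1 H.
Let Q : R := q%:R.
Let Q2 : 2 <= Q. Proof. by rewrite ler_nat. Qed.

Let QC : Q%:C%C = q%:R.
Proof. exact: (rmorph_nat (real_complex R)). Qed.

(** Inversion of w sends q - w to (- 1/w)(1 - q w) and 1 - w to (- 1/w)(1 - w). The two factors
    agree, so gamma is 1. *)
Lemma identity_even : ~~ odd m ->
  let w := (Y il ^+ 2 * q%:R)^-1 in let Y' := flip r il (q%:R)^-1 Y in
  num Y * den Y' = w ^ v 2 * num Y' * den Y.
Proof.
move=> em; have Q0 : Q != 0 by rewrite gt_eqF//; move: Q2; lra.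
have P1 : 2 <= `|Q| by rewrite ger0_norm//; move: Q2; lra.
have c0 : Q + 1 != 0 by rewrite gt_eqF//; move: Q2; lra.
have := @complex_identity _ _ _ _ _ _ _ _ H two_neq0 m r hr mu hmu x W C xE CW il hil Wr q q1 hW
  Q (Q + 1) (Q%:P - 'X) (1 - Q *: 'X) (1 - 'X) 1 1 (fun w => - w^-1) P1 c0 _ _ Y Y0.
rewrite /= !rmorph1 !hornerC !mul1r (fmorphV (real_complex R)) /= QC; apply.
- move=> X hX t0 t1; have := integral_even H two_neq0 hr hmu xE CW hil em hX t0 t1.
  rewrite /= -/Q !hornerE => ->; apply: eq_Rintegral => g _.
  by rewrite /weight; congr (_ * _); rewrite !hornerE.
- move=> w w0 w1; rewrite !hornerE; split; [by field|by field| |by field].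
  rewrite subr_eq0 eq_sym invr_eq1; apply: contraTneq w1 => ->.
  by rewrite normr1 ltxx.
Qed.

(** With w = - S the power (- S)^l becomes w^l. The common factor q + S = q - w is not symmetric
    under inversion, and it is what produces gamma. *)
Lemma identity_odd : odd m ->
  let w := (Y il ^+ 2 * - q%:R ^+ 2)^-1 in let Y' := flip r il (- q%:R ^+ 2)^-1 Y in
  (q%:R * w - 1) * num Y * den Y' = (q%:R - w) * w ^ v 2 * num Y' * den Y.
Proof.
move=> om; have Q0 : Q != 0 by rewrite gt_eqF//; move: Q2; lra.
have P1 : 2 <= `|- Q ^+ 2|.
  rewrite normrN ger0_norm ?sqr_ge0//; move: Q2; nra.
have c0 : Q ^+ 3 + 1 != 0.
  by rewrite gt_eqF// ltr_wpDl// exprn_ge0//; move: Q2; lra.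
have := @complex_identity _ _ _ _ _ _ _ _ H two_neq0 m r hr mu hmu x W C xE CW il hil Wr q q1 hW
  (- Q ^+ 2) (Q ^+ 3 + 1) ((Q%:P - 'X) * ((Q ^+ 2)%:P + 'X)) (- (Q%:P - 'X) * (Q ^+ 2 *: 'X + 1))
  (1 - 'X^2) (Q *: 'X - 1) (Q%:P - 'X)
  (fun w => - (Q * w - 1) / (w ^+ 2 * (Q - w))) P1 c0 _ _ Y Y0.
have PC : (- Q ^+ 2)%:C%C = - q%:R ^+ 2 :> R[i].
  by rewrite (rmorphN (real_complex R)) (rmorphXn (real_complex R)) /= QC.
rewrite /= (fmorphV (real_complex R)) /= !PC.
rewrite !(rmorphB, rmorph1) /= map_polyZ map_polyX map_polyC /= QC !hornerE.
apply.
- move=> X hX t0 t1; have := integral_odd H two_neq0 hr hmu xE CW hil om hX t0 t1.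
  have wE : X il ^+ 2 / - Q ^+ 2 = - (X il ^+ 2 / Q ^+ 2) by rewrite invrN mulrN.
  rewrite /= -/Q wE; set S := X il ^+ 2 / Q ^+ 2.
  have -> : (1 - 'X^2).[- S] = 1 - S ^+ 2 by rewrite !hornerE sqrrN.
  move=> ->; apply: eq_Rintegral => g _; rewrite /weight; congr (_ * _).
  have arith (a b : R) (l : nat) : ((a%:P - 'X) * ((a ^+ 2)%:P + 'X)).[- b] +
      (- (a%:P - 'X) * (a ^+ 2 *: 'X + 1)).[- b] * (- b) ^+ l =
      (a + b) * (a ^+ 2 - b + (a ^+ 2 * b - 1) * (- b) ^+ l).
    by rewrite !hornerE; move: ((- b) ^+ l) => u; ring.
  by rewrite arith.
- move=> w w0 w1.
  have Qw : Q - w != 0.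
    by rewrite subr_eq0 gt_eqF//; apply: le_lt_trans (ler_norm w) _; move: Q2 w1; lra.
  have arith (a : R) : a - w != 0 ->
    [/\ (a - w^-1) * (a ^+ 2 + w^-1) = - (a * w - 1) / (w ^+ 2 * (a - w)) * (- (a - w) * (a ^+ 2 * w + 1)),
        - (a - w^-1) * (a ^+ 2 * w^-1 + 1) =
          - (a * w - 1) / (w ^+ 2 * (a - w)) * ((a - w) * (a ^+ 2 + w)) &
        - (a * w - 1) / (w ^+ 2 * (a - w)) * (1 - w ^+ 2) * (a - w) = (a * w - 1) * (1 - w^-1 ^+ 2)].
    by move=> aw; split; field; rewrite w0 aw.
  have [a1 a2 a3] := arith Q Qw.
  rewrite !(hornerM, hornerN, hornerD, hornerZ, hornerC, hornerX, hornerXn); split=> //.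
  rewrite subr_eq0 eq_sym exprVn invr_eq1; apply: contraTneq w1 => h.
  have : `|w| ^+ 2 == 1 by rewrite -normrX h normr1.
  by rewrite sqrp_eq1// => /eqP ->; rewrite ltxx.
Qed.

End Parity.

Theorem theorem2p7 (R : realType)
  (* k is a finite extension of Q_p with normalized valuation v and residue
     field of cardinality q *)
  (p : nat) (Qp : fieldType) (vp : Qp -> int) (hQp : is_padic_field p vp)
  (k : fieldExtType Qp) (v : k -> int) (hv : normalized_valuation v)
  (hvp : exists2 c : int, 0 < c & extends_valuation c vp v)
  (q : nat) (hq : (residue_field v #= `I_q)%card)
  (* k' is the unramified quadratic extension of k, conj its conjugation *)
  (k' : fieldExtType k) (hk' : \dim {:k'} = 2%N)
  (v' : k' -> int) (hv' : normalized_valuation v')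
  (hunram : extends_valuation 1 v v')
  (conj : {lrmorphism k' -> k'}) (hconj : exists a : k', conj a != a)
  (m : nat) (hm : (2 <= m)%N)
  (mu : {measure set (borel_mx v' m) -> \bar R})
  (hmu : is_haar (integralK conj v') mu)
  (he : odd m -> v 2%:R <= 1)
  (x : 'M[k']_m) (hx : hermX conj x)
  (* W is omega(x; s) as a rational function of q^(s_1), ..., q^(s_n) *)
  (W : ratfun R m./2) (hW : continues q (omega q conj mu x) W) :
  forall z : 'I_(m./2) -> R[i],
    rfz_defined q W z -> rfz_defined q W (tau hm z) ->
    gamma_den q m (z (last_index hm)) != 0 ->
    rfz q W z =
      qpow q (2 * (v 2%:R)%:~R * z (last_index hm)) *
      gamma q m (z (last_index hm)) * rfz q W (tau hm z).
Proof.
have [p_prime hvpn natp _ completep] := hQp.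
have ch0 n : (0 < n)%N -> (n%:R : k') != 0.
  move=> n0; have [nQ _] := natp n n0.
  by rewrite -(rmorph_nat (in_alg k')) fmorph_eq0 -(rmorph_nat (in_alg k)) fmorph_eq0.
have [c c0 hext] := hvp.
have cv : vcomplete v by apply: (complete_extension hvpn hv c0 hext).
have [T [pi' [eps [kap [sT H]]]]] := unramified_quadratic_package hv hv' cv hk' hunram hconj hq.
have hr := half_half hm.
have [W' [C [xE CW]]] := hermitian_involution ch0 (ltnW hm) hr hx.
subst q; have q1 := size_T_gt1 H.
(* The exponent found above is the valuation of 2 in k'; since k' is unramified over k it is the e
   of the statement. *)
have v2 : v' 2 = v 2.
  have k2 : (2 : k) != 0.
    by have [n2 _] := natp 2%N isT; rewrite -(rmorph_nat (in_alg k)) fmorph_eq0.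
  by rewrite -[2 in LHS](scaler_nat 2 (1 : k')) hunram// mul1r.
move=> z; set Y := fun i => qpow (size T) (s_of_z (size T) z i).
set Y' := fun i => qpow (size T) (s_of_z (size T) (tau hm z) i).
have Y0 i : Y i != 0 by exact: qpow_neq0.
rewrite /rfz_defined /rfz /num_at /den_at -/Y -/Y'.
have flipE := flip_qpow q1 hm z; have wE := qpow_double_last q1 hm z.
have -> : qpow (size T) (2 * (v 2)%:~R * z (last_index hm)) =
    qpow (size T) (2 * z (last_index hm)) ^ v 2 :> R[i].
  by rewrite -mulrA mulrCA; exact: cpowMz.
have q0 : ((size T)%:R : R[i]) != 0 by rewrite pnatr_eq0 -lt0n ltnW.
rewrite /gamma /gamma_num /gamma_den; move: flipE wE; rewrite /flip_const.
case: ifPn => om flipE wE d0 d'0 g0.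
  have := identity_odd H (ch0 2%N isT) hr hmu xE CW (il := last_index hm) (erefl _) hW Y0 om.
  rewrite /= flipE wE v2 -/Y' qpowD qpowN qpow1// => e.
  (* The polynomial identity is divided by the nonzero denominators; b w - 1 is b times
     [gamma_den]. *)
  have arith (b w u n n' d d' : R[i]) : d != 0 -> d' != 0 -> b != 0 -> w - b^-1 != 0 ->
      (b * w - 1) * n * d' = (b - w) * u * n' * d ->
      n / d = u * ((1 - b^-1 * w) / (w - b^-1)) * (n' / d').
    move=> dn0 d'n0 b0 wb h; have bw : b * w - 1 != 0.
      by rewrite -(mulfV b0) -mulrBr mulf_neq0.
    have -> : n = (b - w) * u * n' * d / (d' * (b * w - 1)).
      by rewrite -h; field; rewrite d'n0 bw.
    by field; rewrite dn0 d'n0 b0 -mulrC bw.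
  exact: arith d0 d'0 q0 g0 e.
have := identity_even H (ch0 2%N isT) hr hmu xE CW (il := last_index hm) (erefl _) hW Y0 om.
rewrite /= flipE wE v2 -/Y' divr1 mulr1 => e.
have arith (u n n' d d' : R[i]) : d != 0 -> d' != 0 -> n * d' = u * n' * d -> n / d = u * (n' / d').
  move=> dn0 d'n0 h; have -> : n = u * n' * d / d' by rewrite -h mulfK.
  by field; rewrite dn0 d'n0.
exact: arith d0 d'0 e.
Qed.
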